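(* Let $\mu$ be a nonempty partition, $i_1,\dots,i_k\ge0$, and let $\mathsf{W}^{\mathsf{Vert}}_\mu\big(\prod_{j=1}^k\tau_{i_j}([0])\big)$ be the 1-leg descendent vertex. For every integer $a>0$, the evaluation $$\mathsf{W}^{\mathsf{Vert}}_\mu\Big(\prod_{j=1}^k\tau_{i_j}([0])\Big)\Big|_{s_3=\frac{1}{a}(s_1+s_2)}$$ is well-defined and is a Laurent polynomial in $q$ with coefficients in $\mathbb{Q}(s_1,s_2)$.
   Context: View $\mu$ as a finite set of lattice points $(k_1,k_2)\in\mathbb{Z}_{\ge0}^2$; $\mu[x_1,x_2]\subset\mathbb{C}[x_1,x_2]$ is the monomial ideal spanned by the monomials $x_1^{k_1}x_2^{k_2}$ with $(k_1,k_2)\notin\mu$. $\mathbf{T}=(\mathbb{C}^* )^3$ acts on $R=\mathbb{C}[x_1,x_2,x_3]$ by $(t_1,t_2,t_3)\cdot x_i=t_ix_i$; a monomial $x^w$ has character $t^w$, and $s_i$ corresponds to $t_i$ (the weight $t^w$ has equivariant first Chern class $w_1s_1+w_2s_2+w_3s_3$). Let $M_3=\mathbb{C}[x_3,x_3^{-1}]\otimes\mathbb{C}[x_1,x_2]/\mu[x_1,x_2]$, with its canonical invariant element $1$ generating the submodule $\langle1\rangle$. For each finite-dimensional $\mathbf{T}$-invariant $R$-submodule $Q\subset M_3/\langle1\rangle$, let $\ell(Q)=\dim_{\mathbb{C}}Q$ and let $\mathsf{F}_Q$ be the $\mathbf{T}$-character of the preimage of $Q$ in $M_3$ (so $\mathsf{F}_Q=\mathsf{F}_\mu/(1-t_3)+\mathrm{char}(Q)$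 with $\mathsf{F}_\mu=\sum_{(k_1,k_2)\in\mu}t_1^{k_1}t_2^{k_2}$). Bar denotes $t_i\mapsto t_i^{-1}$. Set $\mathsf{G}_\mu=-\mathsf{F}_\mu-\overline{\mathsf{F}}_\mu/(t_1t_2)+\mathsf{F}_\mu\overline{\mathsf{F}}_\mu(1-t_1)(1-t_2)/(t_1t_2)$ and $$\mathsf{V}_Q=\mathsf{F}_Q-\frac{\overline{\mathsf{F}}_Q}{t_1t_2t_3}+\mathsf{F}_Q\overline{\mathsf{F}}_Q\frac{(1-t_1)(1-t_2)(1-t_3)}{t_1t_2t_3}+\frac{\mathsf{G}_\mu(t_1,t_2)}{1-t_3},$$ which is a Laurent polynomial $\sum_w c_wt^w$ in $t_1,t_2,t_3$ (a known fact). Put $e(-\mathsf{V}_Q)=\prod_w(w_1s_1+w_2s_2+w_3s_3)^{-c_w}$, and for a Laurent polynomial $W=\sum_w b_wt^w$ put $\mathrm{ch}_m(W)=\sum_w b_w(w_1s_1+w_2s_2+w_3s_3)^m/m!$ (note $\mathsf{F}_Q(1-t_1)(1-t_2)(1-t_3)$ is a Laurent polynomial). Define $\mathsf{w}_{i_1,\dots,i_k}(Q)=e(-\mathsf{V}_Q)\prod_{j=1}^k\mathrm{ch}_{2+i_j}\big(\mathsf{F}_Q(1-t_1)(1-t_2)(1-t_3)\big)$ and $$\mathsf{W}^{\mathsf{Vert}}_\mu\Big(\prod_{j=1}^k\tau_{i_j}([0])\Big)=\Big(\frac{1}{s_1s_2}\Big)^k\sum_Q\mathsf{w}_{i_1,\dots,i_k}(Q)\,q^{\ell(Q)+|\mu|}\in\mathbb{Q}(s_1,s_2,s_3)((q)),$$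 the sum over all such $Q$. *)

(* Defs.v *)
From HB Require Import structures.
From mathcomp Require Import all_boot all_order all_algebra.
From mathcomp Require Import fraction.
From mathcomp Require Import mpoly.
From Stdlib Require Import ClassicalEpsilon.

Set Implicit Arguments.
Unset Strict Implicit.
Unset Printing Implicit Defensive.

Import Order.TTheory GRing.Theory Num.Theory.
Local Open Scope ring_scope.

(* Rational functions in three variables over Q.  The same type is used *)
(* for Q(t1,t2,t3) (characters) and for Q(s1,s2,s3) (equivariant        *)
(* parameters); variable index 0,1,2 = t1,t2,t3 resp. s1,s2,s3.         *)
Definition Poly3 := {mpoly rat[3]}.
Definition Poly2 := {mpoly rat[2]}.
Definition RF3 := {fraction Poly3}.
Definition RF2 := {fraction Poly2}.

Notation "x %:F" := (@FracField.tofrac _ x) : ring_scope.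

Definition tv (i : 'I_3) : RF3 := ('X_i : Poly3)%:F.
Definition sv (i : 'I_3) : RF3 := ('X_i : Poly3)%:F.

(* Weights w = (w1,w2,w3) in Z^3 and Laurent polynomials as formal lists *)
(* of (weight, integer coefficient); the represented Laurent polynomial  *)
(* has coefficient of t^w equal to the sum of the coefficients listed    *)
(* with weight w.                                                        *)
Definition weight := (int * int * int)%type.
Definition laurent := seq (weight * int).

Definition w1 (w : weight) : int := w.1.1.
Definition w2 (w : weight) : int := w.1.2.
Definition w3 (w : weight) : int := w.2.

Definition tmon (w : weight) : RF3 :=
  tv 0 ^ w1 w * tv 1 ^ w2 w * tv 2 ^ w3 w.

Definition lemb (L : laurent) : RF3 := \sum_(p <- L) p.2%:~R * tmon p.1.

Definition barL (L : laurent) : laurent :=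
  [seq ((- w1 p.1, - w2 p.1, - w3 p.1), p.2) | p <- L].

Definition lcoef (L : laurent) (w : weight) : int :=
  \sum_(p <- L | p.1 == w) p.2.

(* equivariant first Chern class of the weight t^w: w1 s1 + w2 s2 + w3 s3 *)
Definition c1w (w : weight) : RF3 :=
  (w1 w)%:~R * sv 0 + (w2 w)%:~R * sv 1 + (w3 w)%:~R * sv 2.

Definition eneg (V : laurent) : RF3 :=
  \prod_(w <- undup (map fst V)) c1w w ^ (- lcoef V w).

Definition chm (m : nat) (W : laurent) : RF3 :=
  \sum_(p <- W) p.2%:~R * c1w p.1 ^+ m / (m`!)%:R.

Definition young (mu : seq (nat * nat)) : bool :=
  uniq mu &&
  all (fun p => ((0 < p.1)%N ==> ((p.1.-1, p.2) \in mu)) &&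
                ((0 < p.2)%N ==> ((p.1, p.2.-1) \in mu))) mu.

Definition Fmu (mu : seq (nat * nat)) : laurent :=
  [seq ((p.1%:Z, p.2%:Z, 0%:Z), 1%:Z) | p <- mu].

(* M_3/<1> has the monomial basis x1^k1 x2^k2 x3^k3, (k1,k2) in mu, k3<0, *)
(* each spanning a distinct T-weight space; x_i acts by moving to the     *)
(* neighbouring monomial, or by 0 if that leaves the basis.  A           *)
(* finite-dimensional T-invariant R-submodule Q is the span of a finite   *)
(* set of such monomials closed under this action; we record Q by this   *)
(* (duplicate-free) list of exponents (k1,k2,k3).                        *)
Definition is_submod (mu : seq (nat * nat)) (Q : seq (nat * nat * int)) : bool :=
  uniq Q &&
  all (fun x =>
         [&& (x.1.1, x.1.2) \in mu, x.2 < 0,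
             ((x.1.1.+1, x.1.2) \in mu) ==> ((x.1.1.+1, x.1.2, x.2) \in Q),
             ((x.1.1, x.1.2.+1) \in mu) ==> ((x.1.1, x.1.2.+1, x.2) \in Q) &
             (x.2 + 1 < 0) ==> ((x.1.1, x.1.2, x.2 + 1) \in Q)]) Q.

Definition charQ (Q : seq (nat * nat * int)) : laurent :=
  [seq ((x.1.1%:Z, x.1.2%:Z, x.2), 1%:Z) | x <- Q].

Definition FQ mu Q : RF3 := lemb (Fmu mu) / (1 - tv 2) + lemb (charQ Q).
Definition FQbar mu Q : RF3 :=
  lemb (barL (Fmu mu)) / (1 - (tv 2)^-1) + lemb (barL (charQ Q)).

Definition Gmu mu : RF3 :=
  - lemb (Fmu mu) - lemb (barL (Fmu mu)) / (tv 0 * tv 1)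
  + lemb (Fmu mu) * lemb (barL (Fmu mu)) * (1 - tv 0) * (1 - tv 1) / (tv 0 * tv 1).

Definition VQexpr mu Q : RF3 :=
  FQ mu Q - FQbar mu Q / (tv 0 * tv 1 * tv 2)
  + FQ mu Q * FQbar mu Q * (1 - tv 0) * (1 - tv 1) * (1 - tv 2) / (tv 0 * tv 1 * tv 2)
  + Gmu mu / (1 - tv 2).

(* A Laurent-polynomial representative of V_Q (exists by the known fact; *)
(* all representatives give the same coefficients c_w).                  *)
Definition VQ mu Q : laurent :=
  epsilon (inhabits [::]) (fun L : laurent => lemb L = VQexpr mu Q).

Definition FQdesc mu Q : laurent :=
  epsilon (inhabits [::])
    (fun L : laurent => lemb L = FQ mu Q * (1 - tv 0) * (1 - tv 1) * (1 - tv 2)).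

Definition wQ mu (ii : seq nat) Q : RF3 :=
  eneg (VQ mu Q) * \prod_(i <- ii) chm (2 + i) (FQdesc mu Q).

(* Enumeration of the Q with l(Q) = m: they lie in mu x {-m..-1}.       *)
Fixpoint subseqs {T : Type} (s : seq T) : seq (seq T) :=
  match s with
  | [::] => [:: [::]]
  | x :: s' => subseqs s' ++ map (cons x) (subseqs s')
  end.

Definition box (mu : seq (nat * nat)) (m : nat) : seq (nat * nat * int) :=
  [seq (p.1, p.2, - (j.+1)%:Z) | p <- mu, j <- iota 0 m].

Definition submods (mu : seq (nat * nat)) (m : nat) : seq (seq (nat * nat * int)) :=
  [seq Q <- subseqs (box mu m) | (size Q == m) && is_submod mu Q].

Definition Wcoef mu (ii : seq nat) (n : nat) : RF3 :=
  if (size mu <= n)%N then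
    (1 / (sv 0 * sv 1)) ^+ size ii *
    \sum_(Q <- submods mu (n - size mu)) wQ mu ii Q
  else 0.

Definition spec (a : nat) (p : Poly3) : Poly2 :=
  comp_mpoly [tuple ('X_0 : Poly2); 'X_1; (a%:R : rat)^-1 *: ('X_0 + 'X_1)] p.

(* Main.v *)
(* A submodule [Q] is given by heights [h] on the cells of [mu], increasing along
   rows and columns; the label of a cell is [h - a * row]. Splitting each factor of
   the weight at [u := s1 + s2 - a s3 = 0] shows that [e(-V_Q)] equals, up to a
   factor independent of [Q], a power [u ^ dgf] times a product of row differences
   times a unit, where [dgf] and the shape of the product depend only on the labels
   on each diagonal. We sum over all placements of given labels on their diagonals.
   In the expansion of unit and descendents the coefficient of [u ^ m] is a
   polynomial of degree [m] in the power sums of the rows, and the sum of the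
   leading coefficient against a polynomial of degree [D] vanishes as soon as
   [D + dg < 0]: using Lagrange interpolation and the residue theorem on one
   diagonal, one lowers the labels one by one until they are all congruent modulo
   [a + 1] up to a shift depending on the content, in which case [dg >= 0]. Hence
   there is no pole. If the length of [Q] is large, the labels have a gap; the
   labels above it form an upper set [S] of cells, the weights of [S] and of its
   complement decouple, and the exponent of [u] increases by half the sum of the
   squared differences of the lengths of consecutive diagonals of [S], which is
   positive. So these coefficients vanish at [u = 0]. *)
Require Import Defs.
From HB Require Import structures.
From mathcomp Require Import all_boot all_order all_algebra.
From mathcomp Require Import all_fingroup.
From mathcomp Require Import fraction.
From mathcomp Require Import mpoly.
From mathcomp Require Import zify ring lra.
From Stdlib Require Import ClassicalEpsilon.
Set Implicit Arguments.
Unset Strict Implicit.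
Unset Printing Implicit Defensive.
Import Order.TTheory GRing.Theory Num.Theory.
Local Open Scope ring_scope.


(** * Power series and residues *)

(** A single weight can have a pole at [u = 0]; only sums are regular. After eliminating s1, the
    Chern class of [t1^i t2^j t3^(-h)] reads [i u - ((i - j) s2 + (h - a i) s3)]. The bracket holds
    the content and the label, so these alone decide which factors vanish at [u = 0], while the row
    is the coefficient of [u]. Hence fillings with the same labels on each diagonal belong together,
    and a coefficient of [u ^ m] has degree at most [m] in the rows. The obstacle is that heights
    must increase, so the sum does not run over all placements. It is overcome because a forbidden
    move of a label is exactly a pole cancelled by a zero of the numerator. Interpolation and
    residue theorem change degree and exponent by opposite amounts, so the bound [D + dg < 0]
    persists. Once the labels are spaced by [a + 1], the exponent is governed by the form with
    values 2, -1, -1 on equal and adjacent contents. It is a sum of squares in differences of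
    diagonal lengths, which are at most one, and this excludes [dg < 0]. Nonnegativity of the
    heights is never imposed: a negative height at the corner makes the weight vanish. *)

Section Series.
Variable K : fieldType.
Hypothesis K0 : forall n : nat, n.+1%:R != 0 :> K.

Definition mulfac (n : K) (H : nat -> K) (m : nat) : K :=
  if m is m'.+1 then H m - n * H m' else H m.
Fixpoint divfac (r : K) (H : nat -> K) (m : nat) : K :=
  if m is m'.+1 then H m + r * divfac r H m' else H m.
(* Coefficients of [\prod_(n <- N) (1 - n z) / \prod_(r <- D) (1 - r z)]. *)
Definition hser (N D : seq K) : nat -> K :=
  foldr mulfac (foldr divfac (fun m => (m == 0)%:R) D) N.

Definition psum (N D : seq K) (i : nat) : K :=
  \sum_(r <- D) r ^+ i - \sum_(n <- N) n ^+ i.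

(** Newton's identities, that is [z H' = H \sum_i q_i z^i] for the generating series; [q] is the
    logarithmic derivative of [H]. *)
Definition newton (q H : nat -> K) :=
  forall m, m.+1%:R * H m.+1 = \sum_(i < m.+1) q i.+1 * H (m - i)%N.

Lemma hser0 N D : hser N D 0 = 1.
Proof.
by rewrite /hser; elim: N => [|n N] //=; elim: D => [|r D] //=; rewrite eqxx.
Qed.

(** Multiplication by [1 - n z] adds [- \sum_i n^i z^i] to the logarithmic derivative. *)
Lemma newton_mulfac n q H : newton q H ->
  newton (fun i => q i - n ^+ i) (mulfac n H).
Proof.
move=> hH m.
(* Convolving the powers of [n] with [(1 - n z) H] telescopes. *)
have step : \sum_(i < m.+1) n ^+ i.+1 * mulfac n H (m - i)%N = n * H m.
  elim: m => [|m IH]; first by rewrite big_ord1 /= expr1.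
  rewrite big_ord_recl /= subn0 expr1.
  have -> : \sum_(i < m.+1) n ^+ (bump 0 i).+1 * mulfac n H (m.+1 - bump 0 i)%N
          = n * \sum_(i < m.+1) n ^+ i.+1 * mulfac n H (m - i)%N.
    rewrite mulr_sumr; apply: eq_bigr => i _.
    by rewrite /bump /= add1n subSS exprS mulrA.
  by rewrite IH; ring.
have stepq : \sum_(i < m.+1) q i.+1 * mulfac n H (m - i)%N
           = m.+1%:R * H m.+1 - n * (m%:R * H m).
  rewrite hH; case: m {step} => [|m]; first by rewrite !big_ord1 /= !(mul0r,mulr0,subr0).
  rewrite (hH m) mulr_sumr big_ord_recr [in RHS]big_ord_recr /= !subnn /=.
  rewrite [RHS]addrAC -sumrB; congr (_ + _).
  by apply: eq_bigr => i _; rewrite subSn ?leq_ord //=; ring.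
under eq_bigr do rewrite mulrBl.
rewrite sumrB step stepq /= [m.+1%:R]mulrSr; ring.
Qed.

Lemma newton_divfac r q H : newton q H ->
  newton (fun i => q i + r ^+ i) (divfac r H).
Proof.
move=> hH.
have E j : mulfac r (divfac r H) j = H j by case: j => //= j; ring.
elim=> [|m IH].
  have h0 := hH 0%N; move: h0; rewrite !big_ord1 /= => h0.
  by rewrite mulrDr h0; ring.
rewrite [divfac _ _ _.+2]/= mulrDr hH.
have -> : m.+2%:R * (r * divfac r H m.+1) =
    r * (m.+1%:R * divfac r H m.+1) + r * divfac r H m.+1.
  by rewrite [in LHS]mulrSr; ring.
rewrite IH.
under eq_bigr do rewrite -E.
rewrite [RHS]big_ord_recr /= subnn [in LHS]big_ord_recr /= subnn /=.
have -> : \sum_(i < m.+1) q i.+1 * mulfac r (divfac r H) (m.+1 - i)%N =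
   \sum_(i < m.+1) q i.+1 * divfac r H (m.+1 - i)%N
   - \sum_(i < m.+1) r * (q i.+1 * divfac r H (m - i)%N).
  by rewrite -sumrB; apply: eq_bigr => i _; rewrite subSn ?leq_ord //=; ring.
have -> : r * (\sum_(i < m.+1) (q i.+1 + r ^+ i.+1) * divfac r H (m - i)%N) =
  \sum_(i < m.+1) r * (q i.+1 * divfac r H (m - i)%N)
  + \sum_(i < m.+1) r ^+ i.+2 * divfac r H (m - i)%N.
  rewrite mulr_sumr -big_split /=; apply: eq_bigr => i _.
  by rewrite [r ^+ i.+2]exprS; ring.
under [in RHS]eq_bigr do rewrite mulrDl.
rewrite big_split /=.
have -> : \sum_(i < m.+1) r ^+ i.+1 * divfac r H (m.+1 - i)%N
  = r * divfac r H m.+1 + \sum_(i < m.+1) r ^+ i.+2 * divfac r H (m - i)%N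
    - r ^+ m.+2 * H 0%N.
  rewrite big_ord_recl [in RHS]big_ord_recr /= subnn expr1.
  rewrite (_ : \sum_(i < m) _ = \sum_(i < m) r ^+ i.+2 * divfac r H (m - i)%N).
    by rewrite /=; ring.
  by apply: eq_bigr => i _; rewrite /bump /= add1n subSS.
rewrite [divfac _ _ m.+1]/=; ring.
Qed.

Lemma newton_ext q q' H : (forall i, q i = q' i) -> newton q H -> newton q' H.
Proof. by move=> e hH m; rewrite hH; apply: eq_bigr => i _; rewrite e. Qed.

Lemma hser_newton N D : newton (psum N D) (hser N D).
Proof.
rewrite /hser; elim: N => [|n N IH] /=.
  elim: D => [|r D IH] /=.
    by move=> m; rewrite /= mulr0 big1 // => i _; rewrite /psum !big_nil subrr mul0r.
  apply: newton_ext (newton_divfac r IH) => i.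
  by rewrite /psum big_cons big_nil !subr0 addrC.
apply: newton_ext (newton_mulfac n IH) => i.
by rewrite /psum big_cons opprD addrA addrAC.
Qed.

Lemma newton_uniq q H G : newton q H -> newton q G -> H 0%N = G 0%N -> H =1 G.
Proof.
move=> hH hG e0 m; elim/ltn_ind: m => [[|m]] IH //.
apply: (mulfI (K0 m)); rewrite hH hG; apply: eq_bigr => i _.
by rewrite IH // ltnS leq_subr.
Qed.

(** In characteristic zero the series is recovered from its logarithmic derivative, so factors
    common to [N] and [D] may be cancelled. *)
Lemma hser_eq N D N' D' : (forall i, psum N D i.+1 = psum N' D' i.+1) ->
  hser N D =1 hser N' D'.
Proof.
move=> e; apply: (@newton_uniq (psum N D)); rewrite ?hser0 //.
  exact: hser_newton.
by move=> m; rewrite hser_newton; apply: eq_bigr => i _; rewrite e.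
Qed.

(* [hser] shifted to index [i - size D], extended by zero to negative indices. *)
Definition hserz N D (i : nat) : K :=
  if (size D <= i)%N then hser N D (i - size D) else 0.

(** * Divided differences and sums of residues *)

Definition lagr (D : seq K) (f : K -> K) : K :=
  \sum_(y <- D) f y / \prod_(r <- rem y D) (y - r).

Lemma lagr_cons r D f : uniq (r :: D) ->
  lagr (r :: D) (fun y => (y - r) * f y) = lagr D f.
Proof.
case/andP=> rD uD; rewrite /lagr big_cons subrr !mul0r add0r.
apply: eq_big_seq => y yD /=.
have ny : y != r by apply: contraNneq rD => <-.
by rewrite [r == y]eq_sym (negbTE ny) big_cons -mulf_div divff ?mul1r ?subr_eq0.
Qed.

Lemma lagr_perm D D' f : perm_eq D D' -> lagr D f = lagr D' f.
Proof.
move=> p; rewrite /lagr (perm_big _ p) /=; apply: eq_big_seq => y yD; congr (_ / _).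
apply: perm_big; rewrite -(perm_cons y).
have yD' : y \in D by rewrite (perm_mem p).
by rewrite -(permPl (perm_to_rem yD')) -(permPr (perm_to_rem yD)).
Qed.

Lemma lagrB D f g : lagr D (fun y => f y - g y) = lagr D f - lagr D g.
Proof. by rewrite /lagr -sumrB; apply: eq_bigr => y _; rewrite mulrBl. Qed.

Lemma lagrZ D c f : lagr D (fun y => c * f y) = c * lagr D f.
Proof. by rewrite /lagr mulr_sumr; apply: eq_bigr => y _; rewrite mulrA. Qed.

Lemma eq_lagr D f g : f =1 g -> lagr D f = lagr D g.
Proof. by move=> e; rewrite /lagr; apply: eq_bigr => y _; rewrite e. Qed.

Lemma lagr1 D : uniq D -> lagr D (fun=> 1) = (size D == 1)%:R.
Proof.
elim: {D}(size D) {-2}D (erefl (size D)) => [|n IH] [|r D] //= => [_|[sD]] uD.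
  by rewrite /lagr big_nil.
case: D sD uD => [|s D] sD uD.
  by rewrite /lagr big_seq1 /= eqxx big_nil invr1 mulr1.
have nrs : s != r by move: uD; rewrite /= inE => /andP[/norP[+ _] _]; rewrite eq_sym.
have sw : perm_eq (r :: s :: D) (s :: r :: D).
  exact/permPl/(perm_catCA [:: r] [:: s] D).
have uD' : uniq (s :: r :: D) by rewrite -(perm_uniq sw).
(* Since [s - r = (y - r) - (y - s)], this product is a difference of two divided differences with
   one node fewer, which agree by induction. *)
have e : (s - r) * lagr (r :: s :: D) (fun=> 1) = 0.
  rewrite -lagrZ (@eq_lagr _ _ (fun y => (y - r) * 1 - (y - s) * 1)); last by move=> y; ring.
  rewrite lagrB lagr_cons // (lagr_perm _ sw).
  rewrite lagr_cons //; rewrite !IH ?subrr //.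
  - by case/andP: uD' => _ /andP[? ?]; apply/andP.
  - by case/andP: uD.
have -> : (size (s :: D)).+1 == 1 = false by [].
by apply/eqP; move/eqP: e; rewrite mulf_eq0 subr_eq0 (negbTE nrs).
Qed.

(** Divided differences of powers are complete homogeneous symmetric polynomials of the nodes; both
    sides obey the recursion given by [y^(i+1) = (y - r) y^i + r y^i]. *)
Lemma lagr_exp D i : uniq D -> lagr D (fun y => y ^+ i) = hserz [::] D i.+1.
Proof.
elim: i D => [|i IH] D uD.
  rewrite (@eq_lagr _ _ (fun=> 1)) // lagr1 // /hserz.
  by case: D {uD} => [|r [|s D]] //=.
case: D uD => [|r D] uD; first by rewrite /lagr big_nil /hserz /=.
rewrite (@eq_lagr _ _ (fun y => (y - r) * y ^+ i - (- r) * y ^+ i)); last by move=> y; rewrite exprS; ring.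
rewrite lagrB lagrZ lagr_cons // (IH _ uD) IH; last by case/andP: uD.
rewrite mulNr opprK /hserz /= !ltnS.
have [h|h|h] := ltngtP (size D) i.+1.
- by rewrite -ltnS h !subSS subSn.
- by rewrite leqNgt ltnW // mulr0 addr0.
- by rewrite h leqNgt ltnSn mulr0 addr0 !subnn.
Qed.


Lemma lagr_num N D i : uniq D ->
  lagr D (fun y => y ^+ i * \prod_(n <- N) (y - n)) = hserz N D (i + size N).+1.
Proof.
move=> uD; elim: N i => [|n N IH] i.
  by rewrite addn0 -lagr_exp //; apply: eq_lagr => y; rewrite big_nil mulr1.
have e y : y ^+ i * \prod_(m <- n :: N) (y - m) =
    y ^+ i.+1 * \prod_(m <- N) (y - m) - n * (y ^+ i * \prod_(m <- N) (y - m)).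
  by rewrite big_cons exprS; ring.
rewrite (eq_lagr D e) lagrB lagrZ !IH /hserz /= addSn addnS.
have [h|h|h] := ltngtP (size D) (i + size N).+2.
- by rewrite -ltnS h subSn.
- by rewrite leqNgt ltnW // mulr0 subr0.
- by rewrite h ltnn mulr0 subr0 !subnn.
Qed.

Lemma prod_rem y (s : seq K) (f : K -> K) : y \in s ->
  \prod_(n <- s) f n = f y * \prod_(n <- rem y s) f n.
Proof. by move=> ys; rewrite (perm_big _ (perm_to_rem ys)) big_cons. Qed.

Lemma count_rem1 (y z : K) (s : seq K) : y \in s ->
  count_mem z s = ((y == z) + count_mem z (rem y s))%N.
Proof. by move=> ys; rewrite (seq.permP (perm_to_rem ys)). Qed.

(* The sum of the residues of [P(y) \prod_N (y - n) / \prod_D (y - r)] at its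
   poles; common factors of numerator and denominator are allowed as long as
   the remaining poles are simple. *)
Lemma residue_sum N D (P : {poly K}) :
  (forall y, y \notin N -> count_mem y D <= 1)%N ->
  (forall y, y \in N -> count_mem y D <= count_mem y N)%N ->
  \sum_(y <- D | y \notin N)
     P.[y] * \prod_(n <- N) (y - n) / \prod_(r <- rem y D) (y - r)
  = \sum_(i < size P) P`_i * hserz N D (i + size N).+1.
Proof.
elim: {N}(size N) {-2}N (erefl (size N)) D => [|sN IH] N sizeN D hD hN.
  have N0 : N = [::] by case: (N) sizeN.
  have uD : uniq D.
    apply: count_mem_uniq => y; have := hD y; rewrite N0 => /(_ isT).
    by rewrite -has_pred1 has_count; case: count => [|[]].
  transitivity (lagr D (fun y => \sum_(i < size P) P`_i * (y ^+ i * \prod_(n <- N) (y - n)))).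
    rewrite /lagr N0; apply: eq_bigr => y _; congr (_ / _).
    by rewrite horner_coef mulr_suml; apply: eq_bigr => i _; rewrite mulrA.
  rewrite /lagr; under eq_bigr do rewrite mulr_suml.
  rewrite exchange_big /=; apply: eq_bigr => i _.
  rewrite -lagr_num // -lagrZ /lagr; apply: eq_bigr => y _; by rewrite mulrA.
have [/hasP[z zN zD]|/hasPn dis] := boolP (has (mem D) N); last first.
  have uD : uniq D.
    apply: count_mem_uniq => y.
    have [yD|yD] := boolP (y \in D); last by apply/count_memPn.
    have yN : y \notin N by apply: contraL yD => /dis.
    by apply/eqP; rewrite eqn_leq hD // -has_count has_pred1.
  transitivity (lagr D (fun y => \sum_(i < size P) P`_i * (y ^+ i * \prod_(n <- N) (y - n)))).
    rewrite /lagr big_seq_cond [RHS]big_seq; apply: eq_big.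
      move=> y; case yD: (y \in D) => //=; apply: contraL yD => /dis //.
    move=> y _; congr (_ / _).
    by rewrite horner_coef mulr_suml; apply: eq_bigr => i _; rewrite mulrA.
  rewrite /lagr; under eq_bigr do rewrite mulr_suml.
  rewrite exchange_big /=; apply: eq_bigr => i _.
  rewrite -lagr_num // -lagrZ /lagr; apply: eq_bigr => y _; by rewrite mulrA.
have {}zD : z \in D := zD.
have sN' : size (rem z N) = sN by rewrite size_rem // sizeN.
have zD' : (0 < size D)%N by case: (D) zD.
(* A common factor [z] drops out of [psum], and the index shifts caused by the shorter [N] and [D]
   compensate each other. *)
transitivity (\sum_(i < size P) P`_i * hserz (rem z N) (rem z D) (i + size (rem z N)).+1); last first.
  apply: eq_bigr => i _; congr (_ * _).
  have [sD eD] : exists m, size D = m.+1 by exists (size D).-1; rewrite prednK.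
  rewrite /hserz !size_rem // eD sizeN /= addnS ltnS subSS; case: ifP => // _.
  apply: hser_eq => j.
  rewrite /psum [in RHS](perm_big _ (perm_to_rem zN)) [X in X - _ = _](perm_big _ (perm_refl _)).
  by rewrite [X in _ = X - _](perm_big _ (perm_to_rem zD)) /= !big_cons; ring.
rewrite -IH //; last 2 first.
- move=> y /count_memPn yN.
  have [e|nyz] := eqVneq z y.
    rewrite -e in yN *; have := hN z zN.
    by rewrite (count_rem1 _ zN) (count_rem1 _ zD) yN eqxx leq_add2l leqn0 => /eqP->.
  have : y \notin N by apply/count_memPn; rewrite (count_rem1 _ zN) yN (negbTE nyz).
  by move=> /hD; apply: leq_trans; rewrite (count_rem1 _ zD) leq_addl.
- move=> y yN; have := hN y; rewrite (mem_rem yN) => /(_ isT).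
  by rewrite (count_rem1 _ zN) (count_rem1 _ zD) leq_add2l.
rewrite [LHS](perm_big _ (perm_to_rem zD)) /= big_cons zN /= big_mkcond [RHS]big_mkcond /=.
apply: eq_big_seq => y yD.
have [yN|yN] /= := boolP (y \in N).
  have [e|nyz] := eqVneq y z; last first.
    have -> : y \in rem z N.
      have := yN; rewrite -!has_pred1 !has_count (count_rem1 _ zN) eq_sym (negbTE nyz).
      by [].
    by [].
  have -> // : y \in rem z N.
  rewrite e.
  have := hN _ zN; rewrite (count_rem1 _ zN) (count_rem1 _ zD) leq_add2l.
  move=> le; rewrite -has_pred1 has_count; apply: leq_trans le. by rewrite -has_count has_pred1 -{1}e.
have nyz : y != z by apply: contraNneq yN => ->.
have -> : y \notin rem z N by apply: contra yN => /mem_rem.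
rewrite /= (prod_rem _ zN).
have zr : z \in rem y D.
  by have := zD; rewrite -!has_pred1 !has_count (count_rem1 z (mem_rem yD)) (negbTE nyz).
rewrite (prod_rem _ zr).
have -> : \prod_(n <- rem z (rem y D)) (y - n) = \prod_(n <- rem y (rem z D)) (y - n).
  apply: perm_big; rewrite -(perm_cons z) -(permPl (perm_to_rem zr)) -(perm_cons y).
  rewrite perm_sym; apply: perm_trans (perm_to_rem (mem_rem yD)).
  rewrite perm_sym; apply: perm_trans (perm_to_rem zD) _.
  apply: perm_trans (_ : perm_eq _ (z :: y :: rem y (rem z D))) _.
    by rewrite perm_cons perm_to_rem.
  exact/permPl/(perm_catCA [:: z] [:: y]).
by rewrite mulrCA -mulf_div divff ?mul1r // subr_eq0.
Qed.
End Series.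


(** * Vanishing of sums over placements *)

Section Kill.
Variable K : fieldType.
Hypothesis K0 : forall n : nat, n.+1%:R != 0 :> K.

Lemma intr_char0 (m : int) : (m%:~R == 0 :> K) = (m == 0).
Proof.
case: m => [[|n]|n]; rewrite ?eqxx //; first by rewrite (negbTE (K0 n)).
by rewrite NegzE rmorphN oppr_eq0 /= (negbTE (K0 n)).
Qed.

Lemma intr_char0_inj : injective (fun m : int => m%:~R : K).
Proof. by move=> m n /eqP; rewrite -subr_eq0 -rmorphB intr_char0 subr_eq0 => /eqP. Qed.

Variables (I : finType) (A : {set I}) (d x : I -> int) (a : nat).
Hypothesis a0 : (0 < a)%N.
Hypothesis dx_inj : forall k l, d k = d l -> x k = x l -> k = l.

Implicit Types (lam mu : {ffun I -> int}) (t s : {perm I}).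

(* A permutation [t] places the label [lam k] at the cell [t k], which has the
   content of [k] and lies in row [X t k]. *)
Definition good t := perm_on A t && [forall k, d (t k) == d k].
Definition X t k : int := x (t k).
(* The heights [label + a * row] increase weakly along rows and columns. *)
Definition okp lam t := [forall k in A, forall l in A,
  ((d l == d k - 1) && (X t l == X t k) ==> (lam k <= lam l)) &&
  ((d l == d k + 1) && (X t l == X t k + 1) ==> (lam k <= lam l + a%:Z))].

(* Contribution of an ordered pair of cells to the leading coefficient at
   [s1 + s2 = a s3]: [dd], [delta] and [i] are the differences of the contents,
   of the labels and of the rows; [pd] is the exponent of [s1 + s2 - a s3]. The
   factors [sf], [sd] record the change when [delta] drops by one. *)
Definition pf (dd delta i : int) : K :=
  (if (dd == 0) && (delta < 0) then i%:~R^-1 else 1) *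
  (if (dd == 0) && (delta < - a%:Z) then (i - 1)%:~R^-1 else 1) *
  (if (dd == 1) && (delta < - a%:Z) then (i - 1)%:~R else 1) *
  (if (dd == -1) && (delta < 0) then i%:~R else 1).
Definition sf (dd delta i : int) : K :=
  (if (dd == 0) && (delta == 0) then i%:~R^-1 else 1) *
  (if (dd == 0) && (delta == - a%:Z) then (i - 1)%:~R^-1 else 1) *
  (if (dd == 1) && (delta == - a%:Z) then (i - 1)%:~R else 1) *
  (if (dd == -1) && (delta == 0) then i%:~R else 1).
Definition pd (dd delta : int) : int :=
  - ((dd == 0) && (delta < 0))%:Z - ((dd == 0) && (delta < - a%:Z))%:Z
  + ((dd == 1) && (delta < - a%:Z))%:Z + ((dd == -1) && (delta < 0))%:Z.
Definition sd (dd delta : int) : int :=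
  - ((dd == 0) && (delta == 0))%:Z - ((dd == 0) && (delta == - a%:Z))%:Z
  + ((dd == 1) && (delta == - a%:Z))%:Z + ((dd == -1) && (delta == 0))%:Z.

Lemma pfS dd delta i : pf dd (delta - 1) i = pf dd delta i * sf dd delta i.
Proof.
have e1 : (delta - 1 < 0) = (delta < 0) || (delta == 0) by lia.
have e2 : (delta - 1 < - a%:Z) = (delta < - a%:Z) || (delta == - a%:Z) by lia.
have n1 : ~~ ((delta < 0) && (delta == 0)) by lia.
have n2 : ~~ ((delta < - a%:Z) && (delta == - a%:Z)) by lia.
have ifor (b p q : bool) (c : K) : ~~ (p && q) ->
    (if b && (p || q) then c else 1) = (if b && p then c else 1) * (if b && q then c else 1).
  by case: b p q => [] [] [] //= _; rewrite ?mul1r ?mulr1.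
rewrite /pf /sf e1 e2 !ifor //.
by do 8![move: (if _ then _ else _) => ?]; ring.
Qed.

Lemma pdS dd delta : pd dd (delta - 1) = pd dd delta + sd dd delta.
Proof.
have e1 : (delta - 1 < 0) = (delta < 0) || (delta == 0) by lia.
have e2 : (delta - 1 < - a%:Z) = (delta < - a%:Z) || (delta == - a%:Z) by lia.
have n1 : ~~ ((delta < 0) && (delta == 0)) by lia.
have n2 : ~~ ((delta < - a%:Z) && (delta == - a%:Z)) by lia.
have ifor (b p q : bool) : ~~ (p && q) ->
    (b && (p || q))%:Z = (b && p)%:Z + (b && q)%:Z :> int.
  by case: b p q => [] [] [].
rewrite /pd /sd e1 e2 !ifor //.
by do 8![move: (Posz (nat_of_bool _)) => ?]; ring.
Qed.

Definition wt lam t : K := \prod_(k in A) \prod_(l in A) pf (d k - d l) (lam k - lam l) (X t k - X t l).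
Definition dg lam : int := \sum_(k in A) \sum_(l in A) pd (d k - d l) (lam k - lam l).
Definition dec lam k : {ffun I -> int} := [ffun j => lam j - (j == k)%:Z].
Definition inc lam k : {ffun I -> int} := [ffun j => lam j + (j == k)%:Z].

Lemma decK lam k : inc (dec lam k) k = lam.
Proof. by apply/ffunP => j; rewrite !ffunE addrNK. Qed.

Definition Tf lam k t : K := \prod_(m in A | m != k) sf (d k - d m) (lam k - lam m) (X t k - X t m).
Definition Bf lam k t : K := \prod_(l in A | l != k) sf (d l - d k) (lam l - lam k) (X t l - X t k).
Definition Td lam k : int := \sum_(m in A | m != k) sd (d k - d m) (lam k - lam m).
Definition Bd lam k : int := \sum_(l in A | l != k) sd (d l - d k) (lam l - lam k).

(** Lowering [k] decreases the differences [lam k - lam m] and increases [lam l - lam k]. So [Tf] is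
    read off at [lam] and [Bf] at the lowered labels; no division occurs, because the factors may
    vanish. *)
Lemma wt_dec lam k t : k \in A -> wt lam t * Tf lam k t = wt (dec lam k) t * Bf (dec lam k) k t.
Proof.
move=> kA.
have eT : Tf lam k t = \prod_(i in A) \prod_(j in A)
   (if (i == k) && (j != k) then sf (d i - d j) (lam i - lam j) (X t i - X t j) else 1).
  rewrite (bigD1 k) //= [X in _ * X]big1 ?mulr1; last first.
    by move=> i /andP[_ /negbTE ->]; rewrite big1.
  by rewrite eqxx /= /Tf big_mkcondr.
have eB : Bf (dec lam k) k t = \prod_(i in A) \prod_(j in A)
   (if (j == k) && (i != k) then sf (d i - d j) (dec lam k i - dec lam k j) (X t i - X t j) else 1).
  rewrite exchange_big /= (bigD1 k) //= [X in _ * X]big1 ?mulr1; last first.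
    by move=> i /andP[_ /negbTE ->]; rewrite big1.
  by rewrite eqxx /= /Bf big_mkcondr.
rewrite eT eB /wt -!big_split /=; apply: eq_bigr => i iA.
rewrite -!big_split /=; apply: eq_bigr => j jA; rewrite !ffunE.
have [->|ni] := eqVneq i k; have [->|nj] := eqVneq j k; rewrite /= ?mulr1 ?subr0 //.
- by congr (pf _ _ _); ring.
- by rewrite -pfS; congr (pf _ _ _); lia.
- by rewrite -pfS; congr (pf _ _ _); lia.
Qed.

Lemma dg_dec lam k : k \in A -> dg lam + Td lam k = dg (dec lam k) + Bd (dec lam k) k.
Proof.
move=> kA.
have eT : Td lam k = \sum_(i in A) \sum_(j in A)
   (if (i == k) && (j != k) then sd (d i - d j) (lam i - lam j) else 0).
  rewrite (bigD1 k) //= [X in _ + X]big1 ?addr0; last first.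
    by move=> i /andP[_ /negbTE ->]; rewrite big1.
  by rewrite eqxx /= /Td big_mkcondr.
have eB : Bd (dec lam k) k = \sum_(i in A) \sum_(j in A)
   (if (j == k) && (i != k) then sd (d i - d j) (dec lam k i - dec lam k j) else 0).
  rewrite exchange_big /= (bigD1 k) //= [X in _ + X]big1 ?addr0; last first.
    by move=> i /andP[_ /negbTE ->]; rewrite big1.
  by rewrite eqxx /= /Bd big_mkcondr.
rewrite eT eB /dg -!big_split /=; apply: eq_bigr => i iA.
rewrite -!big_split /=; apply: eq_bigr => j jA; rewrite !ffunE.
have [->|ni] := eqVneq i k; have [->|nj] := eqVneq j k; rewrite /= ?addr0 ?subr0 //.
- by congr (pd _ _); ring.
- by rewrite -pdS; congr (pd _ _); lia.
- by rewrite -pdS; congr (pd _ _); lia.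
Qed.

(** * Polynomials in the positions of the labels *)

Definition typ lam k : int * int := (d k, lam k).
Definition ps lam T n t : K := \sum_(l in A | typ lam l == T) (X t l)%:~R ^+ n.

(* Polynomials of degree at most [D] in the power sums of the positions carried
   by the labels of a given type. *)
Inductive PS lam : nat -> ({perm I} -> K) -> Prop :=
| PSc D c : PS lam D (fun=> c)
| PSp D T n : (n <= D)%N -> PS lam D (ps lam T n)
| PSadd D f g : PS lam D f -> PS lam D g -> PS lam D (fun t => f t + g t)
| PSmul D E F f g : (D + E <= F)%N -> PS lam D f -> PS lam E g -> PS lam F (fun t => f t * g t)
| PSext D f g : f =1 g -> PS lam D f -> PS lam D g.

Lemma PSle lam D E f : (D <= E)%N -> PS lam D f -> PS lam E f.
Proof.
move=> DE h; elim: h E DE => {D f}.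
- by move=> D c E _; apply: PSc.
- by move=> D T n nD E DE; apply: PSp; apply: leq_trans DE.
- by move=> D f g _ IHf _ IHg E DE; apply: PSadd; [apply: IHf|apply: IHg].
- by move=> D E F f g DEF hf _ hg _ G FG; apply: PSmul hf hg; apply: leq_trans FG.
- by move=> D f g e _ IH E DE; apply: PSext e _; apply: IH.
Qed.

Lemma PSsum lam D (J : Type) (r : seq J) (P : pred J) (f : J -> {perm I} -> K) :
  (forall j, P j -> PS lam D (f j)) -> PS lam D (fun t => \sum_(j <- r | P j) f j t).
Proof.
move=> h; elim: r => [|j r IH].
  by apply: PSext (PSc _ _ 0) => t; rewrite big_nil.
case Pj: (P j); last by apply: PSext IH => t; rewrite big_cons Pj.
by apply: PSext (PSadd (h _ Pj) IH) => t; rewrite big_cons Pj.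
Qed.

Lemma PSscale lam D c f : PS lam D f -> PS lam D (fun t => c * f t).
Proof. by apply: PSmul (PSc _ 0 c). Qed.

Lemma PSopp lam D f : PS lam D f -> PS lam D (fun t => - f t).
Proof. by move=> /(PSscale (-1)); apply: PSext => t; rewrite mulN1r. Qed.

Lemma PSshift lam T c n : PS lam n (fun t => \sum_(l in A | typ lam l == T) ((X t l)%:~R + c) ^+ n).
Proof.
have h : PS lam n (fun t => \sum_(i < n.+1) c ^+ i *+ 'C(n, i) * ps lam T (n - i) t).
  by apply: PSsum => i _; apply: PSscale; apply: PSp; rewrite leq_subr.
apply: PSext h => t; under eq_bigr do rewrite /ps mulr_sumr.
rewrite exchange_big /=; apply: eq_bigr => l _; rewrite exprDn; apply: eq_bigr => i _.
by rewrite mulrnAl mulrC.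
Qed.

(** In Newton's identities the degrees of [q_i] and [H_(m-i)] add up to [m]. *)
Lemma PSnewton lam q H :
  (forall t, newton (q t) (H t)) -> (forall t, H t 0%N = 1) ->
  (forall i, PS lam i.+1 (fun t => q t i.+1)) -> forall m, PS lam m (fun t => H t m).
Proof.
move=> hN H0 hq; elim/ltn_ind => [[|m]] IH.
  by apply: PSext (PSc _ _ 1) => t; rewrite H0.
have h : PS lam m.+1 (fun t => m.+1%:R^-1 * \sum_(i < m.+1) q t i.+1 * H t (m - i)%N).
  apply: PSscale; apply: PSsum => i _; apply: PSmul (hq i) (IH _ _).
  - by have := ltn_ord i; lia.
  - by rewrite ltnS leq_subr.
by apply: PSext h => t; rewrite -hN mulKf.
Qed.

(** Total degree at most [D], where the polynomial variable stands for one further position and has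
    degree one. *)
Definition PY lam (D : nat) (P : {perm I} -> {poly K}) :=
  (forall i t, (D < i)%N -> (P t)`_i = 0) /\
  (forall i, (i <= D)%N -> PS lam (D - i) (fun t => (P t)`_i)).

Lemma PYadd lam D P Q : PY lam D P -> PY lam D Q -> PY lam D (fun t => P t + Q t).
Proof.
move=> [P0 hP] [Q0 hQ]; split=> [i t h|i h]; first by rewrite coefD P0 ?Q0 ?addr0.
by apply: PSext (PSadd (hP _ h) (hQ _ h)) => t; rewrite coefD.
Qed.

Lemma PYmul lam D E P Q : PY lam D P -> PY lam E Q -> PY lam (D + E) (fun t => P t * Q t).
Proof.
move=> [P0 hP] [Q0 hQ]; split=> [i t h|i h].
  rewrite coefM big1 // => j _.
  have [h1|h1] := ltnP D j; first by rewrite P0 ?mul0r.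
  by rewrite Q0 ?mulr0 //; lia.
have hh : PS lam (D + E - i) (fun t => \sum_(j < i.+1) (P t)`_j * (Q t)`_(i - j)).
  apply: PSsum => j _; have hj := ltn_ord j.
  have [h1|h1] := ltnP D j.
    by apply: PSext (PSc _ _ 0) => t; rewrite P0 // mul0r.
  have [h2|h2] := ltnP E (i - j).
    by apply: PSext (PSc _ _ 0) => t; rewrite Q0 // mulr0.
  by apply: PSmul (hP _ h1) (hQ _ h2); lia.
by apply: PSext hh => t; rewrite coefM.
Qed.

Lemma PYC lam D f : PS lam D f -> PY lam D (fun t => (f t)%:P).
Proof.
move=> hf; split=> [i t h|i h]; first by rewrite coefC; case: i h.
by case: i h => [|i] h; [rewrite subn0; apply: PSext hf|apply: PSext (PSc _ _ 0)] => t; rewrite coefC.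
Qed.

Lemma PYconst lam (Q : {poly K}) : PY lam (size Q).-1 (fun=> Q).
Proof.
split=> [i t h|i h]; last exact: PSc.
by rewrite nth_default // (leq_trans (leqSpred _)).
Qed.

Lemma PYle lam D E P : (D <= E)%N -> PY lam D P -> PY lam E P.
Proof.
move=> DE [P0 hP]; split=> [i t h|i h]; first by rewrite P0 //; lia.
have [h1|h1] := leqP i D; first by apply: PSle (hP _ h1); lia.
by apply: PSext (PSc _ _ 0) => t; rewrite P0.
Qed.

(* Lowering one label turns it into an extra variable. *)
Lemma PS_dec lam k D f : k \in A -> PS lam D f ->
  exists2 P, PY (dec lam k) D P & forall t, f t = (P t).[(X t k)%:~R].
Proof.
move=> kA h; elim: h => {D f}.
- move=> D c; exists (fun=> c%:P); first exact: PYC (PSc _ _ _).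
  by move=> t; rewrite hornerC.
- move=> D T n nD.
  (* Only [k] changes its type, so a power sum changes by at most a monomial in the position of
     [k]. *)
  exists (fun t => (ps (dec lam k) T n t)%:P +
     (((typ lam k == T)%:R - (typ (dec lam k) k == T)%:R) *: 'X^n)).
    apply: PYadd; first exact/PYC/PSp.
    apply: PYle nD _; apply: PYle (PYconst _ _).
    by rewrite -subn1 leq_subLR add1n (leq_trans (size_scale_leq _ _)) // size_polyXn.
  move=> t; rewrite hornerD hornerC hornerZ hornerXn /ps.
  rewrite big_mkcondr /= (bigD1 k) //= [in RHS]big_mkcondr /= [in RHS](bigD1 k) //=.
  rewrite mulrBl -[RHS]addrA [RHS]addrC.
  have e : \sum_(i in A | i != k) (if typ (dec lam k) i == T then (X t i)%:~R ^+ n else 0 : K)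
     = \sum_(i in A | i != k) (if typ lam i == T then (X t i)%:~R ^+ n else 0 : K).
    by apply: eq_bigr => i /andP[_ /negbTE nik]; rewrite /typ ffunE nik subr0.
  rewrite e; do 2![case: ifP => _]; rewrite ?mul1r ?mul0r; ring.
- move=> D f g _ [P hP eP] _ [Q hQ eQ]; exists (fun t => P t + Q t); first exact: PYadd.
  by move=> t; rewrite hornerD eP eQ.
- move=> D E F f g DE _ [P hP eP] _ [Q hQ eQ]; exists (fun t => P t * Q t).
    by apply: PYle DE _; apply: PYmul.
  by move=> t; rewrite hornerM eP eQ.
- move=> D f g e _ [P hP eP]; exists P => // t; by rewrite -e.
Qed.

Lemma PY_dec lam k D P : k \in A -> PY lam D P ->
  exists2 Q, PY (dec lam k) D Q &
    forall t, (P t).[(X t k)%:~R - 1] = (Q t).[(X t k)%:~R].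
Proof.
move=> kA [P0 hP].
have : exists2 Q, PY (dec lam k) D Q & forall t,
    \sum_(i < D.+1) (P t)`_i * ((X t k)%:~R - 1) ^+ i = (Q t).[(X t k)%:~R].
  have : forall E, (E <= D.+1)%N -> exists2 Q, PY (dec lam k) D Q & forall t,
    \sum_(i < E) (P t)`_i * ((X t k)%:~R - 1) ^+ i = (Q t).[(X t k)%:~R].
    elim=> [|E IH] hE.
      exists (fun=> 0); last by move=> t; rewrite big_ord0 horner0.
      by apply: PYle (PYconst _ 0); rewrite size_poly0.
    have [Q hQ eQ] := IH (ltnW hE).
    have [R hR eR] := PS_dec kA (hP E hE).
    exists (fun t => Q t + R t * ('X - 1) ^+ E).
      apply: PYadd => //; apply: PYle (_ : D - E + E <= D)%N _; first by rewrite subnK.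
      apply: PYmul => //; apply: PYle (PYconst _ _).
      by rewrite -(polyC1 K) size_exp_XsubC.
    move=> t; rewrite big_ord_recr /= eQ eR hornerD hornerM horner_exp hornerD hornerX hornerN.
    by rewrite -(polyC1 K) hornerC.
  by move=> /(_ D.+1 (leqnn _)).
case=> Q hQ eQ; exists Q => // t; rewrite -eQ (@horner_coef_wide _ D.+1) //.
by apply/leq_sizeP => j hj; rewrite P0.
Qed.

Lemma goodd t k : good t -> d (t k) = d k.
Proof. by case/andP=> _ /forallP/(_ k)/eqP. Qed.

Lemma goodA t k : good t -> (t k \in A) = (k \in A).
Proof. by case/andP=> h _; rewrite (perm_closed _ h). Qed.

Lemma X_inj t k l : good t -> d k = d l -> X t k = X t l -> k = l.
Proof.
by move=> gt dkl /dx_inj; rewrite !goodd // => /(_ dkl) /perm_inj.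
Qed.

(** The other two corners of the square spanned by diagonal neighbours; they supply the extra zeros
    where two poles collide. *)
Hypothesis convex : forall k l, k \in A -> l \in A -> d k = d l -> x l = x k + 1 ->
  (exists2 m, m \in A & d m = d k + 1 /\ x m = x k + 1) /\
  (exists2 m, m \in A & d m = d k - 1 /\ x m = x k).

Lemma X_convex t k l : good t -> k \in A -> l \in A -> d k = d l -> X t l = X t k + 1 ->
  (exists2 m, m \in A & d m = d k + 1 /\ X t m = X t k + 1) /\
  (exists2 m, m \in A & d m = d k - 1 /\ X t m = X t k).
Proof.
move=> gt kA lA dkl xkl.
have [|||| [m mA [dm xm]] [n nA [dn xn]]] := @convex (t k) (t l).
- by rewrite goodA.
- by rewrite goodA.
- by rewrite !goodd.
- by move: xkl; rewrite /X.
rewrite goodd // in dm dn.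
have back j : j \in A -> exists2 i, i \in A & d i = d j /\ X t i = x j.
  move=> jA; exists ((t^-1)%g j); first by rewrite -(goodA _ gt) permKV.
  by rewrite -(goodd _ gt) /X permKV.
split.
  by have [i iA [di xi]] := back m mA; exists i; rewrite ?di ?xi.
by have [i iA [di xi]] := back n nA; exists i; rewrite ?di ?xi.
Qed.

Lemma okP lam t : reflect (forall k l, k \in A -> l \in A ->
    (d l = d k - 1 -> X t l = X t k -> lam k <= lam l) /\
    (d l = d k + 1 -> X t l = X t k + 1 -> lam k <= lam l + a%:Z)) (okp lam t).
Proof.
apply: (iffP forall_inP) => [h k l kA lA|h k kA].
  have /forall_inP/(_ _ lA)/andP[/implyP h1 /implyP h2] := h _ kA.
  by split=> dl xl; [apply: h1|apply: h2]; rewrite dl xl !eqxx.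
apply/forall_inP => l lA; have [h1 h2] := h _ _ kA lA.
by apply/andP; split; apply/implyP => /andP[/eqP dl /eqP xl]; [apply: h1|apply: h2].
Qed.

(** * Zeros and poles along one diagonal *)

Definition grp lam T := [seq l <- enum A | typ lam l == T].
(** [Nl] and [Dl] are the zeros and poles of one rational function of a position on the diagonal of
    [k]. Its residue at the position of a label equal to [k] describes raising that label; its
    residue one step before a label smaller by [a] describes lowering that one. *)
Definition Nl lam k t : seq K :=
  [seq (X t l)%:~R - 1 | l <- grp lam (d k + 1, lam k - a%:Z)] ++
  [seq (X t l)%:~R | l <- grp lam (d k - 1, lam k)].
Definition Dl lam k t : seq K :=
  [seq (X t l)%:~R | l <- grp lam (d k, lam k)] ++
  [seq (X t l)%:~R - 1 | l <- grp lam (d k, lam k - a%:Z)].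

Lemma mem_grp lam T l : (l \in grp lam T) = (l \in A) && (typ lam l == T).
Proof. by rewrite mem_filter mem_enum andbC. Qed.

Lemma grp_uniq lam T : uniq (grp lam T).
Proof. by rewrite filter_uniq // enum_uniq. Qed.

Lemma intr_sub1 (m : int) : m%:~R - 1 = (m - 1)%:~R :> K.
Proof. by rewrite rmorphB. Qed.

Lemma mem_Nl lam k t (z : int) : reflect
  ((exists l, [/\ l \in A, d l = d k + 1, lam l = lam k - a%:Z & X t l = z + 1]) \/
   (exists l, [/\ l \in A, d l = d k - 1, lam l = lam k & X t l = z]))
  ((z%:~R : K) \in Nl lam k t).
Proof.
rewrite mem_cat; apply: (iffP orP) => [[/mapP[l]|/mapP[l]]|[[l [lA dl el xl]]|[l [lA dl el xl]]]].
- rewrite mem_grp => /andP[lA /eqP[dl el]]; rewrite intr_sub1 => /intr_char0_inj ez.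
  by left; exists l; split=> //; rewrite ez subrK.
- rewrite mem_grp => /andP[lA /eqP[dl el]] /intr_char0_inj ez.
  by right; exists l.
- left; apply/mapP; exists l; first by rewrite mem_grp lA /typ dl el eqxx.
  by rewrite xl intr_sub1 addrK.
- right; apply/mapP; exists l; first by rewrite mem_grp lA /typ dl el eqxx.
  by rewrite xl.
Qed.

(** A raise is blocked by the next cell of the row or of the column if it has the same height. These
    cells are the entries of [Nl], so a forbidden raise has no residue. *)
Lemma ok_inc lam k t : okp lam t -> k \in A ->
  okp (inc lam k) t = ((X t k)%:~R \notin Nl lam k t).
Proof.
move=> /okP ok kA; apply/okP/idP => [h|h].
  apply/negP => /mem_Nl [[l [lA dl el xl]]|[l [lA dl el xl]]].
    have [_ /(_ dl xl)] := h _ _ kA lA; rewrite !ffunE eqxx.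
    have -> : (l == k) = false by apply/eqP => lk; move: dl; rewrite lk; lia.
    by rewrite el /=; lia.
  have [/(_ dl xl) + _] := h _ _ kA lA; rewrite !ffunE eqxx.
  have -> : (l == k) = false by apply/eqP => lk; move: dl; rewrite lk; lia.
  by rewrite el /=; lia.
move=> p q pA qA; rewrite !ffunE.
have [h1 h2] := ok _ _ pA qA.
have [ep|np] := eqVneq p k; last first.
  by split=> e1 e2; [have := h1 e1 e2|have := h2 e1 e2]; lia.
subst p; have [eq|nq] := eqVneq q k.
  by split=> e1 e2; move: e1; rewrite eq; lia.
split=> e1 e2.
  have := h1 e1 e2; rewrite le_eqVlt => /orP[/eqP e3|]; last by lia.
  by case/negP: h; apply/mem_Nl; right; exists q.
have := h2 e1 e2; rewrite le_eqVlt => /orP[/eqP e3|]; last by lia.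
by case/negP: h; apply/mem_Nl; left; exists q; split=> //; lia.
Qed.

(** The cells that block lowering [l] are again recorded in [Nl lam k], one step before the position
    of [l]; thus one rational function serves both kinds of moves. *)
Lemma ok_dec lam k l t : okp lam t -> l \in A -> d l = d k -> lam l = lam k - a%:Z ->
  okp (dec lam l) t = ((X t l - 1)%:~R \notin Nl lam k t).
Proof.
move=> /okP ok lA dl el; apply/okP/idP => [h|h].
  apply/negP => /mem_Nl [[m [mA dm em xm]]|[m [mA dm em xm]]].
    have [h1 _] := h m l mA lA; move: h1; rewrite !ffunE eqxx.
    have -> : (m == l) = false by apply/eqP => lk; move: dm; rewrite lk; lia.
    by move=> h1; have := h1; lia.
  have [_ h2] := h m l mA lA; move: h2; rewrite !ffunE eqxx.
  have -> : (m == l) = false by apply/eqP => lk; move: dm; rewrite lk; lia.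
  by move=> h2; have := h2; lia.
move=> p q pA qA; rewrite !ffunE.
have [h1 h2] := ok _ _ pA qA.
have [eq|nq] := eqVneq q l; last first.
  by split=> e1 e2; [have := h1 e1 e2|have := h2 e1 e2]; lia.
subst q; have [ep|np] := eqVneq p l.
  by split=> e1 e2; move: e1; rewrite ep; lia.
split=> e1 e2.
  have := h1 e1 e2; rewrite le_eqVlt => /orP[/eqP e3|]; last by lia.
  by case/negP: h; apply/mem_Nl; left; exists p; split=> //; lia.
have := h2 e1 e2; rewrite le_eqVlt => /orP[/eqP e3|]; last by lia.
by case/negP: h; apply/mem_Nl; right; exists p; split=> //; lia.
Qed.

Lemma prod_rem_map (J : eqType) (g : J -> K) (F : K -> K) (s : seq J) (r : seq K) k :
  uniq s -> k \in s ->
  \prod_(z <- rem (g k) ([seq g j | j <- s] ++ r)) F z =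
  (\prod_(j <- s | j != k) F (g j)) * \prod_(z <- r) F z.
Proof.
move=> us ks.
have p : perm_eq (rem (g k) ([seq g j | j <- s] ++ r)) ([seq g j | j <- rem k s] ++ r).
  have h : perm_eq ([seq g j | j <- s] ++ r) (g k :: ([seq g j | j <- rem k s] ++ r)).
    rewrite -cat_cons perm_cat2r -[_ :: _]/(map g (k :: rem k s)).
    exact/perm_map/perm_to_rem.
  rewrite -(perm_cons (g k)); apply: perm_trans h.
  rewrite perm_sym; apply: perm_to_rem.
  by rewrite mem_cat map_f.
by rewrite (perm_big _ p) big_cat big_map rem_filter // big_filter.
Qed.

Lemma typ_sub lam k l e f : (d l - d k == e) && (lam l - lam k == f) = (typ lam l == (d k + e, lam k + f)).
Proof.
rewrite /typ xpair_eqE; congr (_ && _); lia.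
Qed.

Lemma prod_grp lam T k (F : I -> K) : typ lam k != T ->
  \prod_(l in A | l != k) (if typ lam l == T then F l else 1) = \prod_(l <- grp lam T) F l.
Proof.
move=> nk; rewrite -big_mkcondr big_filter big_enum_cond /=; apply: eq_bigl => l.
by rewrite -andbA; congr (_ && _); case: eqVneq => // ->; rewrite (negbTE nk).
Qed.

Lemma BfE lam k t : k \in A ->
  Bf lam k t = \prod_(n <- Nl lam k t) (n - (X t k)%:~R) /
     \prod_(r <- rem (X t k)%:~R (Dl lam k t)) (r - (X t k)%:~R).
Proof.
move=> kA.
transitivity (\prod_(l in A | l != k)
  (((if typ lam l == (d k, lam k) then ((X t l)%:~R - (X t k)%:~R)^-1 else 1) *
   (if typ lam l == (d k, lam k - a%:Z) then ((X t l)%:~R - 1 - (X t k)%:~R)^-1 else 1)) *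
  ((if typ lam l == (d k + 1, lam k - a%:Z) then (X t l)%:~R - 1 - (X t k)%:~R else 1) *
  (if typ lam l == (d k - 1, lam k) then (X t l)%:~R - (X t k)%:~R else 1)) : K)).
  apply: eq_bigr => l _; rewrite /sf !typ_sub !addr0 -!mulrA.
  have e1 : (X t l - X t k)%:~R = (X t l)%:~R - (X t k)%:~R :> K by rewrite rmorphB.
  have e2 : (X t l - X t k - 1)%:~R = (X t l)%:~R - 1 - (X t k)%:~R :> K.
    by rewrite !rmorphB /= addrAC.
  by rewrite e1 e2.
rewrite !big_split /= (@prod_grp _ (d k, lam k - a%:Z)) ?(@prod_grp _ (d k + 1, lam k - a%:Z))
  ?(@prod_grp _ (d k - 1, lam k)); try by rewrite /typ xpair_eqE; lia.
rewrite -big_mkcondr /= prod_rem_map ?grp_uniq ?mem_grp ?kA /= ?eqxx //.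
rewrite [in RHS]big_cat /= !big_map mulrC; congr (_ * _).
rewrite invfM -!prodfV; congr (_ * _).
rewrite big_filter_cond big_enum_cond /=; apply: eq_bigl => l; by rewrite -andbA; congr (_ && _); rewrite andbC.
Qed.

Lemma TfE lam k l t : l \in A -> typ lam l = (d k, lam k - a%:Z) ->
  Tf lam l t = \prod_(n <- Nl lam k t) ((X t l)%:~R - 1 - n) /
     \prod_(r <- rem ((X t l)%:~R - 1) (Dl lam k t)) ((X t l)%:~R - 1 - r).
Proof.
move=> lA [dl el].
transitivity (\prod_(m in A | m != l)
  (((if typ lam m == (d k, lam k - a%:Z) then ((X t l)%:~R - 1 - ((X t m)%:~R - 1))^-1 else 1) *
   (if typ lam m == (d k, lam k) then ((X t l)%:~R - 1 - (X t m)%:~R)^-1 else 1)) *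
  ((if typ lam m == (d k - 1, lam k) then (X t l)%:~R - 1 - (X t m)%:~R else 1) *
  (if typ lam m == (d k + 1, lam k - a%:Z) then (X t l)%:~R - 1 - ((X t m)%:~R - 1) else 1)) : K)).
  apply: eq_bigr => m _; rewrite /sf -!mulrA.
  have e1 : (X t l - X t m)%:~R = (X t l)%:~R - 1 - ((X t m)%:~R - 1) :> K.
    by rewrite rmorphB /=; ring.
  have e2 : (X t l - X t m - 1)%:~R = (X t l)%:~R - 1 - (X t m)%:~R :> K.
    by rewrite !rmorphB /= addrAC.
  rewrite e1 e2 /typ !xpair_eqE dl el.
  congr (_ * (_ * (_ * _))).
  - by have -> : (d k - d m == 0) && (lam k - a%:Z - lam m == 0) = (d m == d k) && (lam m == lam k - a%:Z) by lia.
  - by have -> : (d k - d m == 0) && (lam k - a%:Z - lam m == - a%:Z) = (d m == d k) && (lam m == lam k) by lia.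
  - by have -> : (d k - d m == 1) && (lam k - a%:Z - lam m == - a%:Z) = (d m == d k - 1) && (lam m == lam k) by lia.
  - by have -> : (d k - d m == -1) && (lam k - a%:Z - lam m == 0) = (d m == d k + 1) && (lam m == lam k - a%:Z) by lia.
rewrite !big_split /= (@prod_grp _ (d k, lam k)) ?(@prod_grp _ (d k + 1, lam k - a%:Z))
  ?(@prod_grp _ (d k - 1, lam k)); try by rewrite /typ xpair_eqE dl el; lia.
have p : perm_eq (rem ((X t l)%:~R - 1) (Dl lam k t))
   (rem ((X t l)%:~R - 1) ([seq (X t l)%:~R - 1 | l <- grp lam (d k, lam k - a%:Z)] ++ [seq (X t l)%:~R | l <- grp lam (d k, lam k)])).
  rewrite -(perm_cons ((X t l)%:~R - 1)).
  have m1 : (X t l)%:~R - 1 \in [seq (X t l)%:~R - 1 : K | l <- grp lam (d k, lam k - a%:Z)].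
    by apply/mapP; exists l; rewrite // mem_grp lA /typ dl el eqxx.
  apply: perm_trans (perm_to_rem _); last by rewrite mem_cat m1.
  rewrite perm_sym; apply: perm_trans (perm_to_rem (_ : _ \in Dl lam k t)); last by rewrite mem_cat m1 orbT.
  exact/permPl/perm_catC.
rewrite [in RHS](perm_big _ p) /= -big_mkcondr /=.
rewrite (@prod_rem_map _ (fun m => (X t m)%:~R - 1) (fun r => (X t l)%:~R - 1 - r) _ _ l) ?grp_uniq //; last first.
  by rewrite mem_grp lA /typ dl el eqxx.
rewrite [in RHS]big_cat /= !big_map [LHS]mulrC; congr (_ * _); first by rewrite mulrC.
rewrite invfM -!prodfV; congr (_ * _).
rewrite big_filter_cond big_enum_cond /=; apply: eq_bigl => m; by rewrite -andbA; congr (_ && _); rewrite andbC.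
Qed.

Lemma count_map_inj (f : I -> K) (s : seq I) (z : K) : uniq s ->
  {in s &, injective f} -> (count_mem z (map f s) <= 1)%N.
Proof.
move=> us fi; rewrite count_uniq_mem ?leq_b1 //.
by rewrite map_inj_in_uniq.
Qed.

Lemma X_inj_grp lam T t (c : K) : good t ->
  {in grp lam T &, injective (fun l => (X t l)%:~R + c : K)}.
Proof.
case: T => T1 T2 gt p q; rewrite !mem_grp => /andP[_ /eqP[dp _]] /andP[_ /eqP[dq _]].
by move=> /addIr/intr_char0_inj; apply: X_inj; rewrite // dp.
Qed.

Lemma count_D1 lam T t (z : K) : good t -> (count_mem z [seq (X t l)%:~R : K | l <- grp lam T] <= 1)%N.
Proof.
move=> gt; rewrite (eq_map (g := fun l => (X t l)%:~R + 0)); last by move=> l; rewrite addr0.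
by apply: count_map_inj; [exact: grp_uniq|exact: X_inj_grp].
Qed.

Lemma count_D2 lam T t (z : K) : good t -> (count_mem z [seq ((X t l)%:~R - 1)%R : K | l <- grp lam T] <= 1)%N.
Proof. by move=> gt; apply: count_map_inj; [exact: grp_uniq|exact: X_inj_grp]. Qed.

(* At a point where two factors of the denominator vanish, convexity and
   monotonicity force two factors of the numerator to vanish. *)
Lemma double_zero lam t k (z : K) : good t -> okp lam t ->
  (1 < count_mem z (Dl lam k t))%N -> (1 < count_mem z (Nl lam k t))%N.
Proof.
move=> gt /okP ok; rewrite /Dl /Nl !count_cat.
have h1 := count_D1 lam (d k, lam k) z gt.
have h2 := count_D2 lam (d k, lam k - a%:Z) z gt.
move: h1 h2; set c1 := count_mem z _; set c2 := count_mem z _ => h1 h2 h3.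
have : (0 < c1)%N by lia.
have : (0 < c2)%N by lia.
rewrite /c1 /c2 {h1 h2 h3 c1 c2}.
rewrite -!has_count !has_pred1 => /mapP[l + zl] /mapP[p + zp].
rewrite !mem_grp => /andP[lA /eqP[dl el]] /andP[pA /eqP[dp ep]].
have xlp : X t l = X t p + 1.
  by apply/eqP; rewrite -subr_eq -(inj_eq intr_char0_inj) -intr_sub1 -zl -zp.
have [|[m mA [dm xm]] [n nA [dn xn]]] := X_convex gt pA lA _ xlp; first by rewrite dp.
have em : lam m = lam k - a%:Z.
  have [_] := ok _ _ pA mA; move=> /(_ dm xm).
  have [+ _] := ok _ _ mA lA; rewrite dm dl dp addrK => /(_ erefl).
  by rewrite xm xlp => /(_ erefl); lia.
have en : lam n = lam k.
  have [+ _] := ok _ _ pA nA; move=> /(_ dn xn).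
  have [_] := ok _ _ nA lA; rewrite dn dl dp subrK => /(_ erefl).
  by rewrite xn xlp => /(_ erefl); lia.
have c1 : (0 < count_mem z [seq ((X t l)%:~R - 1)%R : K | l <- grp lam (d k + 1, lam k - a%:Z)%R])%N.
  rewrite -has_count has_pred1; apply/mapP; exists m.
    by rewrite mem_grp mA /typ dm em dp eqxx.
  by rewrite zp xm rmorphD addrK.
have c2 : (0 < count_mem z [seq (X t l)%:~R : K | l <- grp lam (d k - 1, lam k)%R])%N.
  rewrite -has_count has_pred1; apply/mapP; exists n.
    by rewrite mem_grp nA /typ dn en dp eqxx.
  by rewrite zp xn.
exact: (leq_add c1 c2).
Qed.

Lemma Nl_typ lam k l t : typ lam k = typ lam l -> Nl lam k t = Nl lam l t.
Proof. by rewrite /Nl => -[-> ->]. Qed.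
Lemma Dl_typ lam k l t : typ lam k = typ lam l -> Dl lam k t = Dl lam l t.
Proof. by rewrite /Dl => -[-> ->]. Qed.

Lemma prod_sub_sign (s : seq K) z : \prod_(n <- s) (n - z) = (-1) ^+ size s * \prod_(n <- s) (z - n).
Proof.
elim: s => [|n s IH]; first by rewrite !big_nil mul1r.
by rewrite !big_cons IH /= exprS; ring.
Qed.

(** The residue theorem for [P(y) \prod_Nl (y - n) / \prod_Dl (y - r)]: the uncancelled poles are
    the allowed raises and lowerings, and the right-hand side is the contribution of infinity. The
    sign comes from [Bf], which has the factors [n - y]. *)
Lemma local_residue lam k t (P : {poly K}) : good t -> okp lam t -> k \in A ->
  (-1) ^+ (size (Nl lam k t) + (size (Dl lam k t)).-1) *
  (\sum_(l in A | (typ lam l == typ lam k) && okp (inc lam l) t) Bf lam l t * P.[(X t l)%:~R])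
  + \sum_(l in A | (typ lam l == (d k, lam k - a%:Z)) && okp (dec lam l) t)
      Tf lam l t * P.[(X t l)%:~R - 1]
  = \sum_(i < size P) P`_i * hserz (Nl lam k t) (Dl lam k t) (i + size (Nl lam k t)).+1.
Proof.
move=> gt ok kA; set N := Nl lam k t; set D := Dl lam k t.
rewrite -residue_sum //; last 2 first.
- move=> y yN; rewrite leqNgt; apply: contraL yN => /(double_zero gt ok) h.
  by rewrite negbK -has_pred1 has_count ltnW.
- move=> y yN; have [h|h] := leqP (count_mem y D) 1.
    by apply: leq_trans h _; rewrite -has_count has_pred1.
  (* Each of the two halves of [Dl] is free of repetitions, so no pole is worse than double. *)
  apply: leq_trans (double_zero gt ok h).
  by rewrite count_cat; apply: (leq_add (count_D1 _ _ _ gt) (count_D2 _ _ _ gt)).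
rewrite [in RHS]/D {1}/Dl big_cat /= !big_map; congr (_ + _); rewrite big_filter_cond big_enum_cond.
  rewrite mulr_sumr; apply: eq_big => l.
    rewrite -!andbA; case lA: (l \in A) => //=; case: eqP => //= dl; case: eqP => //= el.
    by rewrite ok_inc // (@Nl_typ _ l k) // /typ dl el.
  case/and3P => lA /eqP el _; rewrite BfE // (Nl_typ _ el) (Dl_typ _ el).
  rewrite !prod_sub_sign size_rem; last first.
    rewrite -(Dl_typ _ el) /Dl mem_cat; apply/orP; left; apply/mapP; exists l => //.
    by rewrite mem_grp lA /typ eqxx.
  rewrite -/N -/D exprD; set u := \prod_(_ <- N) _; set v := \prod_(_ <- _) _.
  rewrite invfM -[((-1) ^+ _)^-1]exprVn invrN1.
  have e m : (-1) ^+ m * (-1) ^+ m = 1 :> K by rewrite -expr2 sqrr_sign.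
  move: (e (size N)) (e (size D).-1); set p := (-1) ^+ _; set q := (-1) ^+ _ => ep eq.
  transitivity ((p * p) * (q * q) * (P.[(X t l)%:~R] * u / v)); first by ring.
  by rewrite ep eq !mul1r.
apply: eq_big => l.
  rewrite -!andbA; case lA: (l \in A) => //=; case: eqP => //= dl; case: eqP => //= el.
  by rewrite (@ok_dec lam k) // intr_sub1.
by case/and3P => lA /eqP el _; rewrite (TfE _ lA el) mulrC mulrA.
Qed.

(** * Interchanging equal labels *)

Section Relabel.
Variable s : {perm I}.
Hypothesis sA : perm_on A s.
Hypothesis sd0 : forall j, d (s j) = d j.

Let sA' j : (s j \in A) = (j \in A).
Proof. exact: perm_closed. Qed.

Lemma X_relabel t j : X (s * t)%g j = X t (s j).
Proof. by rewrite /X permM. Qed.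

Lemma good_relabel t : good (s * t)%g = good t.
Proof.
apply/andP/andP => -[h1 /forallP h2]; split.
- by have := perm_onM (perm_onV sA) h1; rewrite mulKg.
- apply/forallP => k; have /eqP := h2 ((s^-1)%g k).
  by rewrite permM permKV => ->; rewrite -sd0 permKV.
- exact: perm_onM.
- by apply/forallP => k; rewrite permM (eqP (h2 _)) sd0.
Qed.

Lemma ok_relabel lam lam' t : (forall j, lam' j = lam (s j)) -> okp lam' (s * t)%g = okp lam t.
Proof.
move=> e; apply/okP/okP => h k l kA lA.
  have pA j : j \in A -> (s^-1)%g j \in A by rewrite -(sA' ((s^-1)%g j)) permKV.
  have pd j : d ((s^-1)%g j) = d j by rewrite -(sd0 ((s^-1)%g j)) permKV.
  by have := h _ _ (pA _ kA) (pA _ lA); rewrite !pd !e !X_relabel !permKV.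
by have := h (s k) (s l); rewrite !sA' !sd0 !e !X_relabel; apply.
Qed.

Lemma wt_relabel lam t : (forall j, lam (s j) = lam j) -> wt lam (s * t)%g = wt lam t.
Proof.
move=> e; rewrite /wt [RHS](reindex_inj (@perm_inj _ s)) /=.
apply: eq_big => k; first by rewrite sA'.
move=> _; rewrite [RHS](reindex_inj (@perm_inj _ s)) /=.
apply: eq_big => l; first by rewrite sA'.
by move=> _; rewrite !X_relabel !sd0 !e.
Qed.

Lemma Bf_relabel lam k t : (forall j, lam (s j) = lam j) -> Bf lam k (s * t)%g = Bf lam (s k) t.
Proof.
move=> e; rewrite /Bf [RHS](reindex_inj (@perm_inj _ s)) /=.
apply: eq_big => l; first by rewrite sA' (inj_eq perm_inj).
by move=> _; rewrite !X_relabel !sd0 !e.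
Qed.

Lemma PS_relabel lam D f t : (forall j, lam (s j) = lam j) -> PS lam D f -> f (s * t)%g = f t.
Proof.
move=> e; elim=> //.
- move=> {}D T n _; rewrite /ps [RHS](reindex_inj (@perm_inj _ s)) /=.
  by apply: eq_big => l; rewrite ?sA' /typ ?sd0 ?e // X_relabel.
- by move=> {}D {}f g _ -> _ ->.
- by move=> {}D E F {}f g _ _ -> _ ->.
- by move=> {}D {}f g h _; rewrite !h.
Qed.

Lemma PY_relabel lam D P t : (forall j, lam (s j) = lam j) -> PY lam D P -> P (s * t)%g = P t.
Proof.
move=> e [P0 hP]; apply/polyP => i.
have [h|h] := leqP i D; last by rewrite !P0.
exact: PS_relabel e (hP i h).
Qed.
End Relabel.

(** A transposition of two labels of one type preserves everything in sight. The residue theorem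
    involves all labels of a type at once, and this reduces it to a statement about one of them. *)
Lemma sum_swap lam D P k l : k \in A -> l \in A -> typ lam k = typ lam l -> PY lam D P ->
  \sum_(t | [&& good t, okp lam t & okp (inc lam k) t])
     wt lam t * (Bf lam k t * (P t).[(X t k)%:~R]) =
  \sum_(t | [&& good t, okp lam t & okp (inc lam l) t])
     wt lam t * (Bf lam l t * (P t).[(X t l)%:~R]).
Proof.
move=> kA lA [dkl ekl] hP; pose s : {perm I} := tperm k l.
have sA : perm_on A s.
  by apply: subset_trans (tperm_on k l) _; apply/subsetP => j; rewrite !inE => /orP[]/eqP->.
have sd0 j : d (s j) = d j by rewrite /s; case: tpermP => // ->.
have se j : lam (s j) = lam j by rewrite /s; case: tpermP => // ->.
rewrite [LHS](reindex_inj (mulgI s)) /=; apply: eq_big => t.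
  rewrite good_relabel // (@ok_relabel _ sA sd0 lam) //; congr [&& _, _ & _].
  apply: ok_relabel => // j; rewrite !ffunE se; congr (_ + (nat_of_bool _)%:Z).
  by rewrite -(inj_eq (@perm_inj _ s)) tpermL.
move=> _; rewrite wt_relabel // Bf_relabel // (PY_relabel sA sd0 t se hP) X_relabel.
by rewrite tpermL.
Qed.

(** * Counting degrees and exponents *)

Definition szN lam k := (size (grp lam (d k + 1, lam k - a%:Z)%R) + size (grp lam (d k - 1, lam k)%R))%N.
Definition szD lam k := (size (grp lam (d k, lam k)) + size (grp lam (d k, lam k - a%:Z)%R))%N.

Lemma size_Nl lam k t : size (Nl lam k t) = szN lam k.
Proof. by rewrite size_cat !size_map. Qed.
Lemma size_Dl lam k t : size (Dl lam k t) = szD lam k.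
Proof. by rewrite size_cat !size_map. Qed.

Lemma sum_grp lam T k : k \in A ->
  \sum_(l in A | l != k) (typ lam l == T)%:Z = (size (grp lam T))%:Z - (typ lam k == T)%:Z.
Proof.
move=> kA; have -> : (size (grp lam T))%:Z = \sum_(l in A) (typ lam l == T)%:Z.
  rewrite size_filter -sum1_count (big_morph Posz PoszD (erefl _)) big_mkcond big_enum /=.
  by apply: eq_bigr => l _; case: (_ == _).
by rewrite (bigD1 k kA) /= addrAC subrr add0r.
Qed.

(** The change of the exponent equals the change of degree in [PS_reg], and the one in [TdE]; this
    is what preserves the bound on [D + dg]. *)
Lemma BdE lam k : k \in A -> Bd lam k = (szN lam k)%:Z - (szD lam k)%:Z + 1.
Proof.
have e1 : (lam k == lam k - a%:Z) = false by lia.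
have e1' : (lam k - a%:Z == lam k) = false by lia.
have e2 : (d k == d k + 1) = false by lia.
have e3 : (d k == d k - 1) = false by lia.
move=> kA; rewrite /Bd /sd.
under eq_bigr do rewrite !typ_sub !addr0.
rewrite !big_split !sumrN /= !sum_grp // /typ !xpair_eqE !eqxx e1 e2 e3 /szN /szD !PoszD /=.
lia.
Qed.

Lemma TdE lam k l : l \in A -> typ lam l = (d k, lam k - a%:Z) ->
  Td lam l = (szN lam k)%:Z - (szD lam k)%:Z + 1.
Proof.
have e1 : (lam k == lam k - a%:Z) = false by lia.
have e1' : (lam k - a%:Z == lam k) = false by lia.
have e2 : (d k == d k + 1) = false by lia.
have e3 : (d k == d k - 1) = false by lia.
move=> lA el; have [dl ll] := el.
rewrite /Td /sd.
transitivity (\sum_(m in A | m != l)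
  (- (typ lam m == (d k, lam k - a%:Z))%:Z - (typ lam m == (d k, lam k))%:Z
   + (typ lam m == (d k - 1, lam k))%:Z + (typ lam m == (d k + 1, lam k - a%:Z))%:Z)).
  apply: eq_bigr => m _; rewrite /typ !xpair_eqE dl ll.
  congr (- (nat_of_bool _)%:Z - (nat_of_bool _)%:Z + (nat_of_bool _)%:Z + (nat_of_bool _)%:Z); lia.
rewrite !big_split !sumrN /= !sum_grp // el !xpair_eqE !eqxx e1' e2 e3 /szN /szD !PoszD /=.
lia.
Qed.

Lemma PS_reg lam k D P E : PY lam D P -> (D + (szN lam k).+1 <= E + szD lam k)%N ->
  PS lam E (fun t => \sum_(i < size (P t)) (P t)`_i * hserz (Nl lam k t) (Dl lam k t) (i + szN lam k).+1).
Proof.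
move=> [P0 hP] hE.
have hq i : PS lam i.+1 (fun t => psum (Nl lam k t) (Dl lam k t) i.+1).
  have h T c : PS lam i.+1 (fun t => \sum_(l <- grp lam T) ((X t l)%:~R + c) ^+ i.+1).
    by apply: PSext (PSshift lam T c i.+1) => t; rewrite big_filter big_enum_cond.
  have := PSadd (PSadd (h (d k, lam k) 0) (h (d k, lam k - a%:Z) (-1)))
    (PSopp (PSadd (h (d k + 1, lam k - a%:Z) (-1)) (h (d k - 1, lam k) 0))).
  apply: PSext => t; rewrite /psum /Dl /Nl !big_cat !big_map /=.
  by congr (_ + _ - (_ + _)); apply: eq_bigr => l _; rewrite addr0.
have hH m : PS lam m (fun t => hser (Nl lam k t) (Dl lam k t) m).
  apply: (@PSnewton lam (fun t => psum (Nl lam k t) (Dl lam k t)) (fun t => hser (Nl lam k t) (Dl lam k t))) => //.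
  - by move=> t; apply: hser_newton.
  - by move=> t; rewrite hser0.
have h : PS lam E (fun t => \sum_(i < D.+1) (P t)`_i * hserz (Nl lam k t) (Dl lam k t) (i + szN lam k).+1).
  apply: PSsum => i _; rewrite /hserz.
  have [le|lt] := leqP (szD lam k) (i + szN lam k).+1; last first.
    by apply: PSext (PSc _ _ 0) => t; rewrite size_Dl leqNgt lt mulr0.
  have hi := ltn_ord i.
  apply: PSext (PSmul (_ : (D - i) + ((i + szN lam k).+1 - szD lam k) <= E)%N (hP i _) (hH _)); last 2 first.
  - by lia.
  - by rewrite -ltnS.
  by move=> t; rewrite size_Dl le.
apply: PSext h => t; have sP : (size (P t) <= D.+1)%N.
  by apply/leq_sizeP => j hj; rewrite P0.
rewrite (big_ord_widen _ (fun i => (P t)`_i * hserz (Nl lam k t) (Dl lam k t) (i + szN lam k).+1) sP).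
rewrite [RHS]big_mkcond /=; apply: eq_bigr => i _; case: ltnP => // h.
by rewrite nth_default // mul0r.
Qed.

(** * Lowering one label *)

Definition Claim lam := forall D f, PS lam D f -> D%:Z + dg lam < 0 ->
  \sum_(t | good t && okp lam t) wt lam t * f t = 0.

(* Lowering [k] leaves poles at the labels smaller than [k] by [a]; these are
   removed by lowering those labels in turn. *)
Inductive chain lam k : Prop :=
  Chain of Claim (dec lam k) &
    (forall l, l \in A -> typ (dec lam k) l = (d k, dec lam k k - a%:Z) -> chain (dec lam k) l).

(** Seen from the lowered labels, the terms are raises of [k], hence residues. The contribution of
    infinity is killed by [Claim], and the residues at labels smaller by [a] by the rest of the
    chain. *)
Lemma chain_sum0 lam k : chain lam k -> k \in A -> forall D P, PY (dec lam k) D P ->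
  D%:Z + dg lam + Td lam k < 0 ->
  \sum_(t | [&& good t, okp lam t & okp (dec lam k) t]) wt lam t * Tf lam k t * (P t).[(X t k)%:~R] = 0.
Proof.
move=> c; elim: c => {lam k} lam k cl _ IH kA D P hP hD.
set mu := dec lam k in cl IH hP.
have hB : D%:Z + dg mu + Bd mu k < 0 by rewrite -addrA -dg_dec // addrA.
rewrite BdE // in hB.
transitivity (\sum_(t | [&& good t, okp mu t & okp (inc mu k) t]) wt mu t * (Bf mu k t * (P t).[(X t k)%:~R])).
  apply: eq_big => t; first by rewrite decK; congr (_ && _); rewrite andbC.
  by move=> _; rewrite wt_dec // mulrA.
have nz : (size (grp mu (typ mu k)))%:R != 0 :> K.
  have : k \in grp mu (typ mu k) by rewrite mem_grp kA eqxx.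
  by case: (grp mu (typ mu k)) => //= *; apply: K0.
apply: (mulfI nz); rewrite mulr0.
set c := (-1) ^+ (szN mu k + (szD mu k).-1) : K.
have cn : c != 0 by rewrite signr_eq0.
apply: (mulfI cn); rewrite mulr0.
(* All labels of the type of [k] contribute equally, so multiplying by their number gives the full
   sum of raises. *)
transitivity (c * \sum_(l in A | typ mu l == typ mu k)
  \sum_(t | [&& good t, okp mu t & okp (inc mu l) t]) wt mu t * (Bf mu l t * (P t).[(X t l)%:~R])).
  congr (_ * _); rewrite [RHS](eq_bigr (fun=> \sum_(t | [&& good t, okp mu t & okp (inc mu k) t]) wt mu t * (Bf mu k t * (P t).[(X t k)%:~R]))).
    rewrite sumr_const mulr_natl; congr (_ *+ _).
    by rewrite size_filter -sum1_count big_enum_cond sum1_card.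
  by move=> l /andP[lA /eqP el]; apply: sum_swap hP.
transitivity (\sum_(t | good t && okp mu t) wt mu t *
   (c * \sum_(l in A | (typ mu l == typ mu k) && okp (inc mu l) t) Bf mu l t * (P t).[(X t l)%:~R])).
  under [RHS]eq_bigr do rewrite mulrCA mulr_sumr.
  rewrite -mulr_sumr; congr (_ * _).
  under eq_bigr do rewrite big_mkcond.
  rewrite exchange_big /= [RHS]big_mkcond /=; apply: eq_bigr => t _.
  case: (good t) => /=; last by rewrite big1.
  case: (okp mu t) => /=; last by rewrite big1.
  by rewrite -big_mkcondr; apply: eq_bigl => l; rewrite andbA.
transitivity (\sum_(t | good t && okp mu t) wt mu t * (
   \sum_(i < size (P t)) (P t)`_i * hserz (Nl mu k t) (Dl mu k t) (i + szN mu k).+1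
   - \sum_(l in A | (typ mu l == (d k, mu k - a%:Z)) && okp (dec mu l) t)
      Tf mu l t * (P t).[(X t l)%:~R - 1])).
  apply: eq_bigr => t /andP[gt ok]; congr (_ * _).
  have := local_residue (P t) gt ok kA.
  by rewrite size_Nl size_Dl -/c => <-; rewrite addrK.
under eq_bigr do rewrite mulrBr.
rewrite sumrB [X in X - _ = _](_ : _ = 0) ?sub0r; last first.
  (* If the denominator has too large a degree, infinity contributes nothing and no appeal to
     [Claim] is necessary. *)
  have [h|h] := leqP (szD mu k) (D + (szN mu k).+1).
    apply: (cl (D + (szN mu k).+1 - szD mu k)%N); last by lia.
    by apply: PS_reg hP _; lia.
  rewrite big1 // => t _; rewrite big1 ?mulr0 // => i _; rewrite /hserz size_Dl.
  have [hi|hi] := leqP i D; last by case: hP => P0 _; rewrite P0 ?mul0r.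
  by rewrite leqNgt (_ : (_ < _)%N = true) ?mulr0 //; lia.
apply/eqP; rewrite oppr_eq0; apply/eqP.
transitivity (\sum_(l in A | typ mu l == (d k, mu k - a%:Z))
  \sum_(t | [&& good t, okp mu t & okp (dec mu l) t]) wt mu t * Tf mu l t * (P t).[(X t l)%:~R - 1]).
  under eq_bigr do rewrite mulr_sumr.
  under [RHS]eq_bigr do rewrite big_mkcond.
  rewrite [RHS]exchange_big /= big_mkcond /=; apply: eq_bigr => t _.
  case: (good t) => /=; last by rewrite big1.
  case: (okp mu t) => /=; last by rewrite big1.
  rewrite -[RHS]big_mkcondr; apply: eq_big => l; first by rewrite andbA.
  by rewrite mulrA.
rewrite big1 // => l /andP[lA /eqP el].
have [Q hQ eQ] := PY_dec lA hP.
under eq_bigr do rewrite eQ.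
apply: (IH l lA el lA D Q hQ).
by rewrite (TdE lA el); lia.
Qed.

Lemma top_prod lam k t : k \in A -> good t ->
  (forall l, l \in A -> typ lam l != (d k + 1, lam k)) ->
  (forall l, l \in A -> typ lam l != (d k - 1, lam k + a%:Z)) ->
  (forall l, l \in A -> typ lam l != (d k, lam k + a%:Z)) ->
  Tf lam k t = (\prod_(r <- rem (X t k)%:~R [seq (X t l)%:~R | l <- grp lam (typ lam k)]) ((X t k)%:~R - r))^-1.
Proof.
move=> kA gt h1 h2 h3.
rewrite -[map _ _]cats0 prod_rem_map ?grp_uniq ?mem_grp ?kA ?eqxx // big_nil mulr1 -prodfV.
rewrite big_filter_cond big_enum_cond.
rewrite [RHS](eq_bigl (fun l => (l \in A) && (l != k) && (typ lam l == typ lam k))); last first.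
  by move=> l; case: (l \in A) => //; rewrite !andTb andbC.
rewrite [RHS]big_mkcondr /=; apply: eq_bigr => l /andP[lA _].
have := h1 l lA; have := h2 l lA; have := h3 l lA.
rewrite /typ /sf !xpair_eqE => n3 n2 n1.
have -> : (d k - d l == 0) && (lam k - lam l == - a%:Z) = false by lia.
have -> : (d k - d l == 1) && (lam k - lam l == - a%:Z) = false by lia.
have -> : (d k - d l == -1) && (lam k - lam l == 0) = false by lia.
have -> : (d k - d l == 0) && (lam k - lam l == 0) = (d l == d k) && (lam l == lam k) by lia.
by rewrite !mulr1 rmorphB.
Qed.

Lemma top_deg lam k : k \in A ->
  (forall l, l \in A -> typ lam l != (d k + 1, lam k)) ->
  (forall l, l \in A -> typ lam l != (d k - 1, lam k + a%:Z)) ->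
  (forall l, l \in A -> typ lam l != (d k, lam k + a%:Z)) ->
  Td lam k = 1 - (size (grp lam (typ lam k)))%:Z.
Proof.
move=> kA h1 h2 h3.
transitivity (- \sum_(l in A | l != k) (typ lam l == typ lam k)%:Z).
  rewrite -sumrN; apply: eq_bigr => l /andP[lA _].
  have := h1 l lA; have := h2 l lA; have := h3 l lA.
  rewrite /typ /sd !xpair_eqE => n3 n2 n1.
  have -> : (d k - d l == 0) && (lam k - lam l == - a%:Z) = false by lia.
  have -> : (d k - d l == 1) && (lam k - lam l == - a%:Z) = false by lia.
  have -> : (d k - d l == -1) && (lam k - lam l == 0) = false by lia.
  have -> : (d k - d l == 0) && (lam k - lam l == 0) = (d l == d k) && (lam l == lam k) by lia.
  by rewrite /= ?subr0 ?oppr0 ?addr0.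
by rewrite sum_grp // eqxx opprB.
Qed.

(** Nothing can block lowering [k], and of [Tf] only the factors from equal labels remain. *)
Definition top lam k := [/\ k \in A,
  forall l, l \in A -> typ lam l != (d k + 1, lam k),
  forall l, l \in A -> typ lam l != (d k - 1, lam k + a%:Z) &
  forall l, l \in A -> typ lam l != (d k, lam k + a%:Z)].

Lemma ok_dec_top lam k t : top lam k -> okp lam t -> okp (dec lam k) t.
Proof.
case=> kA h1 h2 _ /okP ok; apply/okP => p q pA qA; rewrite !ffunE.
have [o1 o2] := ok p q pA qA.
have [eq|nq] := eqVneq q k; last by split=> e1 e2; [have := o1 e1 e2|have := o2 e1 e2]; lia.
subst q; have [ep|np] := eqVneq p k; first by split=> e1 e2; move: e1; rewrite ep; lia.
have := h1 p pA; have := h2 p pA; rewrite /typ !xpair_eqE => n2 n1.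
by split=> e1 e2; [have := o1 e1 e2|have := o2 e1 e2]; lia.
Qed.

(** Lagrange interpolation on the [g] labels equal to [k] writes 1 as the sum of [Tf * X^(g-1)]. The
    degree grows by [g - 1] while lowering changes the exponent by [1 - g]. *)
Lemma claim_step lam k : top lam k ->
  (forall l, l \in A -> typ lam l = typ lam k -> chain lam l) -> Claim lam.
Proof.
move=> tk hc D f hf hD.
have topl l : l \in A -> typ lam l = typ lam k -> top lam l.
  by case: tk => kA h1 h2 h3 lA [dl ll]; split=> //; rewrite dl ll.
have kA : k \in A by case: tk.
set g := size (grp lam (typ lam k)).
have g0 : (0 < g)%N.
  by rewrite /g; have : k \in grp lam (typ lam k) by [rewrite mem_grp kA eqxx]; case: grp.
have one t : good t ->
    \sum_(l in A | typ lam l == typ lam k) Tf lam l t * (X t l)%:~R ^+ g.-1 = 1.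
  move=> gt; set s := [seq (X t l)%:~R : K | l <- grp lam (typ lam k)].
  have us : uniq s.
    rewrite map_inj_in_uniq ?grp_uniq // => p q pG qG /= e.
    by apply: (X_inj_grp (c := 0) gt pG qG); rewrite e.
  transitivity (lagr s (fun y => y ^+ g.-1)); last first.
    by rewrite lagr_exp // /hserz size_map -/g prednK // leqnn subnn hser0.
  rewrite /lagr /s big_map big_filter big_enum_cond /=; apply: eq_bigr => l /andP[lA /eqP el].
  have [_ h1 h2 h3] := topl l lA el.
  by rewrite (top_prod lA gt) // el mulrC.
transitivity (\sum_(t | good t && okp lam t) \sum_(l in A | typ lam l == typ lam k)
    wt lam t * Tf lam l t * ((X t l)%:~R ^+ g.-1 * f t)).
  apply: eq_bigr => t /andP[gt _]; rewrite -[LHS]mulr1 -[X in _ * X = _](one t gt) mulr_sumr.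
  by apply: eq_bigr => l _; move: (_ ^+ _) => z; ring.
rewrite exchange_big /= big1 // => l /andP[lA /eqP el].
have [P hP eP] := PS_dec lA hf.
have hQ : PY (dec lam l) (D + g.-1) (fun t => P t * 'X^(g.-1)).
  apply: PYmul => //; apply: PYle (PYconst _ _).
  by rewrite size_polyXn.
have tl := topl l lA el; have [_ h1 h2 h3] := tl.
rewrite -[RHS](chain_sum0 (hc l lA el) lA hQ); last first.
  by rewrite (top_deg lA) // el -/g PoszD; lia.
apply: eq_big => t.
  by case: (good t) => //=; case ok: (okp lam t); rewrite //= (ok_dec_top tl).
by move=> _; rewrite eP hornerM hornerXn [_ ^+ _ * _]mulrC.
Qed.

(** * Termination of the lowering process *)

Section Termination.
Variables (dn : I -> nat) (c0 : int) (W : nat).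
Hypothesis dnE : forall k, d k = (dn k)%:Z - c0.
Hypothesis dnW : forall k, (dn k < W)%N.
Hypothesis W1 : (1 < W)%N.
Hypothesis step : forall e : int,
  `|(\sum_(k in A) ((d k == e)%:Z - (d k == e + 1)%:Z) : int)| <= 1.

Let eps (e : nat) (k : I) : int := ((dn k).+1 == e)%:Z - (dn k == e)%:Z.

(** A second difference is a product of first differences; [eps e] is the first difference at [e],
    and [e = W] is included because [(dn k).+1] can reach it. *)
Lemma eps_sum k l : \sum_(e < W.+1) eps e k * eps e l =
  2 * (d k == d l)%:Z - (d k == d l + 1)%:Z - (d k == d l - 1)%:Z.
Proof.
have one (p : nat) (F : nat -> int) : (p < W.+1)%N ->
    \sum_(e < W.+1) (p == e)%:Z * F e = F p.
  move=> hp; rewrite (bigD1 (Ordinal hp)) //= eqxx mul1r big1 ?addr0 // => e ne.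
  have -> : (p == e) = false by apply: contraNF ne => /eqP e'; apply/eqP/val_inj.
  by rewrite mul0r.
under eq_bigr do rewrite [eps _ k]/eps mulrBl.
have hk := dnW k; have hl := dnW l.
rewrite sumrB (one _ (eps^~ l)) ?ltnS // (one (dn k) (eps^~ l)) ?ltnS ?(ltnW hk) // /eps !dnE; lia.
Qed.

(** With class sums [s_c] of total [s], the left side is [s^2 - \sum s_c^2]. For integers with
    [|s| <= 1] one has [s^2 <= |s| <= \sum |s_c| <= \sum s_c^2]. *)
Lemma sq_split (tc : I -> nat) (f : I -> int) : `|\sum_(k in A) f k| <= 1 ->
  \sum_(k in A) \sum_(l in A) (tc k != tc l)%:Z * (f k * f l) <= 0.
Proof.
move=> hf; pose T := \max_(k in A) tc k.
have hT k : k \in A -> (tc k < T.+1)%N by move=> kA; rewrite ltnS; apply: leq_bigmax_cond.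
have spl (F : I -> int) : \sum_(k in A) F k = \sum_(e < T.+1) \sum_(k in A | tc k == e) F k.
  rewrite (partition_big (fun k => inord (tc k) : 'I_T.+1) xpredT) //=.
  apply: eq_bigr => e _; apply: eq_bigl => k; case kA: (k \in A) => //=.
  by rewrite -val_eqE /= inordK ?hT.
have all : \sum_(k in A) \sum_(l in A) f k * f l = (\sum_(k in A) f k) ^+ 2.
  by rewrite expr2 mulr_suml; apply: eq_bigr => k _; rewrite mulr_sumr.
have same : \sum_(k in A) \sum_(l in A) (tc k == tc l)%:Z * (f k * f l) =
    \sum_(e < T.+1) (\sum_(k in A | tc k == e) f k) ^+ 2.
  rewrite spl; apply: eq_bigr => e _; rewrite expr2 mulr_suml; apply: eq_bigr => k /andP[kA /eqP ek].
  rewrite mulr_sumr [RHS]big_mkcondr /=; apply: eq_bigr => l _; rewrite ek eq_sym.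
  by case: eqP => _; rewrite ?mul1r ?mul0r.
have -> : \sum_(k in A) \sum_(l in A) (tc k != tc l)%:Z * (f k * f l) =
   (\sum_(k in A) f k) ^+ 2 - \sum_(e < T.+1) (\sum_(k in A | tc k == e) f k) ^+ 2.
  rewrite -all -same -sumrB; apply: eq_bigr => k _; rewrite -sumrB; apply: eq_bigr => l _.
  by case: (tc k == tc l); rewrite /=; ring.
rewrite subr_le0; apply: le_trans (_ : `|\sum_(k in A) f k| <= _).
  rewrite -[X in X <= _]ger0_norm ?sqr_ge0 // normrX expr2.
  by apply: ler_piMr => //.
rewrite spl; apply: le_trans (ler_norm_sum _ _ _) _; apply: ler_sum => e _.
move: (\sum_(k in A | _) _) => z; nia.
Qed.

(* The clock [(Lam, e)] runs down through the contents [e] and then decreases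
   [Lam]; [Dz] is the distance of a label below the clock. *)
Definition Dz lam Lam e l : int := Lam - (e < dn l)%N%:Z - lam l.
Definition inv lam Lam e := forall l, l \in A -> 0 <= Dz lam Lam e l.

(** The labels sit on levels [a + 1] apart, so in every case that matters both comparisons in [pd]
    only ask whether the level of [k] lies below that of [l]. Then [pd] is minus the form of
    [eps_sum], and [sq_split] applies to each first difference after symmetrisation. *)
Lemma clean_dg lam Lam e : inv lam Lam e ->
  (forall l, l \in A -> (a.+1 %| `|Dz lam Lam e l|)%N) -> 0 <= dg lam.
Proof.
move=> hi hc; pose tc l := (`|Dz lam Lam e l| %/ a.+1)%N.
have hD l : l \in A -> lam l = Lam - (e < dn l)%N%:Z - (tc l)%:Z * a.+1%:Z.
  move=> lA; rewrite -PoszM /tc divnK ?hc // gez0_abs ?hi // /Dz; ring.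
have pdE k l : k \in A -> l \in A -> pd (d k - d l) (lam k - lam l) =
   - (tc l < tc k)%N%:Z * (2 * (d k == d l)%:Z - (d k == d l + 1)%:Z - (d k == d l - 1)%:Z).
  move=> kA lA; rewrite (hD k kA) (hD l lA) /pd !dnE.
  have [m hm] : exists m : int, m = (tc k)%:Z * a.+1%:Z - (tc l)%:Z * a.+1%:Z by eexists.
  have -> : Lam - (e < dn k)%N%:Z - (tc k)%:Z * a.+1%:Z - (Lam - (e < dn l)%N%:Z - (tc l)%:Z * a.+1%:Z)
     = (e < dn l)%N%:Z - (e < dn k)%N%:Z - m by rewrite hm; ring.
  have -> : (dn k)%:Z - c0 - ((dn l)%:Z - c0) = (dn k)%:Z - (dn l)%:Z by ring.
  have [lt|lt|eq] := ltngtP (tc l) (tc k).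
  - have {}hm : a.+1%:Z <= m by rewrite hm; nia.
    have -> : ((e < dn l)%N%:Z - (e < dn k)%N%:Z - m < 0) = true by lia.
    have -> : ((dn k)%:Z - (dn l)%:Z == 0) && ((e < dn l)%N%:Z - (e < dn k)%N%:Z - m < - a%:Z)
       = ((dn k)%:Z - (dn l)%:Z == 0) by lia.
    have -> : ((dn k)%:Z - (dn l)%:Z == 1) && ((e < dn l)%N%:Z - (e < dn k)%N%:Z - m < - a%:Z)
       = ((dn k)%:Z - (dn l)%:Z == 1) by lia.
    rewrite !andbT; lia.
  - have {}hm : m <= - a.+1%:Z by rewrite hm; nia.
    have -> : ((e < dn l)%N%:Z - (e < dn k)%N%:Z - m < 0) = false by lia.
    have -> : ((e < dn l)%N%:Z - (e < dn k)%N%:Z - m < - a%:Z) = false by lia.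
    by rewrite !andbF mul0r.
  - have {}hm : m = 0 by rewrite hm eq subrr.
    have -> : ((e < dn l)%N%:Z - (e < dn k)%N%:Z - m < - a%:Z) = false by lia.
    have -> : ((dn k)%:Z - (dn l)%:Z == 0) && ((e < dn l)%N%:Z - (e < dn k)%N%:Z - m < 0) = false by lia.
    have -> : ((dn k)%:Z - (dn l)%:Z == -1) && ((e < dn l)%N%:Z - (e < dn k)%N%:Z - m < 0) = false by lia.
    by rewrite !andbF mul0r.
have dgE : dg lam = \sum_(k in A) \sum_(l in A) - (tc l < tc k)%N%:Z *
   \sum_(e < W.+1) eps e k * eps e l.
  apply: eq_bigr => k kA; apply: eq_bigr => l lA; by rewrite pdE // eps_sum.
have sym : dg lam = \sum_(k in A) \sum_(l in A) - (tc k < tc l)%N%:Z *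
   \sum_(e < W.+1) eps e k * eps e l.
  rewrite dgE exchange_big /=; apply: eq_bigr => k _; apply: eq_bigr => l _.
  by congr (_ * _); apply: eq_bigr => i _; rewrite mulrC.
have : 0 <= dg lam + dg lam.
  rewrite {1}dgE sym -big_split /=.
  rewrite (eq_bigr (fun k => \sum_(i < W.+1) \sum_(l in A) - ((tc k != tc l)%:Z * (eps i k * eps i l)))); last first.
    move=> k _; rewrite -big_split /= exchange_big /=; apply: eq_bigr => l _.
    rewrite -mulrDl [RHS]sumrN -[in RHS]mulr_sumr -mulNr; congr (_ * _).
    by case: ltngtP.
  rewrite exchange_big /=; apply: sumr_ge0 => i _.
  under eq_bigr do rewrite sumrN.
  rewrite sumrN oppr_ge0; apply: sq_split.
  have := step (i%:Z - 1 - c0); congr (`|_| <= _); apply: eq_bigr => k _.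
  rewrite /eps !dnE; lia.
by lia.
Qed.

Let clean lam Lam e l := (a.+1 %| `|Dz lam Lam e l|)%N.
Let r1 lam Lam e l := (dn l == e) && (`|Dz lam Lam e l| == 1 %[mod a.+1])%N.
(* Conserved by a move: a label at the current content is first lowered from a
   multiple of [a.+1], which is not counted until the clock has moved on. *)
Let Wc lam Lam e : int := \sum_(l in A) (Dz lam Lam e l - (r1 lam Lam e l)%:Z).
(** The number of ticks after which the clock shows content [q]. *)
Let dist (e q : nat) := (if q <= e then e - q else e + W - q)%N.
Let tops lam Lam e := [set l in A | (dn l == e) && (Dz lam Lam e l == 0)].

(** Data for a triple induction: a bound on the conserved quantity, the number of ticks beyond which
    contents are already clean, and a bound on the number of labels standing at the clock. *)
Definition state (w : int) (j n : nat) lam Lam e := [/\ inv lam Lam e, (e < W)%N, Wc lam Lam e < w,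
  (forall l, l \in A -> (j <= dist e (dn l))%N -> clean lam Lam e l) & (#|tops lam Lam e| < n)%N].

Lemma Dz_dec lam Lam e k l : Dz (dec lam k) Lam e l = Dz lam Lam e l + (l == k)%:Z.
Proof. by rewrite /Dz ffunE; ring. Qed.

(** The distance of [k] grows by one, but its residue becomes 1 and is discounted in [Wc]. Cleanness
    is demanded only at least one tick ahead, so the current content is exempt. *)
Lemma state_dec w j n lam Lam e k : k \in A -> dn k = e -> clean lam Lam e k ->
  state w j.+1 (n + (Dz lam Lam e k == 0)) lam Lam e -> state w j.+1 n (dec lam k) Lam e.
Proof.
move=> kA dk ck [hi he hw hc hn].
have hk := hi k kA.
have nck : ~~ r1 lam Lam e k by rewrite /r1 dk eqxx /=; move: ck; rewrite /clean /dvdn => /eqP ->; rewrite modn_small ?ltnS.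
have sck : r1 (dec lam k) Lam e k.
  rewrite /r1 dk eqxx Dz_dec eqxx /=; have -> : (`|(Dz lam Lam e k + 1)%R| = `|Dz lam Lam e k| + 1)%N by lia.
  by move: ck; rewrite /clean /dvdn => /eqP ck; rewrite -[X in X == _]modnDml ck.
split=> //.
- by move=> l lA; rewrite Dz_dec; have := hi l lA; lia.
- rewrite (_ : Wc (dec lam k) Lam e = Wc lam Lam e) //; apply: eq_bigr => l lA.
  have [->|nl] := eqVneq l k; first by rewrite sck (negbTE nck) Dz_dec eqxx; lia.
  by rewrite /r1 Dz_dec (negbTE nl) addr0.
- move=> l lA hl; have [el|nl] := eqVneq l k; first by move: hl; rewrite el dk /dist leqnn subnn.
  by rewrite /clean Dz_dec (negbTE nl) addr0; apply: hc.
- have tk : k \notin tops (dec lam k) Lam e by rewrite inE Dz_dec eqxx; lia.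
  have ts : tops (dec lam k) Lam e = tops lam Lam e :\ k.
    apply/setP => l; have [->|nl] := eqVneq l k; first by rewrite (negbTE tk) !inE eqxx.
    by rewrite !inE nl Dz_dec (negbTE nl) addr0.
  rewrite ts; have := cardsD1 k (tops lam Lam e); rewrite inE kA dk eqxx /=.
  move: hn; case: (_ == 0) => /=; lia.
Qed.

(** Along a chain the labels stay on the current diagonal and drop by [a + 1], so they remain clean.
    The chain ends because the number of smaller labels decreases. *)
Lemma state_chain w j n Lam e : (forall lam, state w j.+1 n lam Lam e -> Claim lam) ->
  forall m lam k, (#|[set l in A | (lam l < lam k)%R]| < m)%N -> k \in A -> dn k = e ->
  clean lam Lam e k -> 0 <= Dz lam Lam e k ->
  state w j.+1 n (dec lam k) Lam e -> chain lam k.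
Proof.
move=> IH; elim=> [|m IHm] lam k hm kA; first by rewrite ltn0 in hm.
move=> dk ck ki sk; apply: Chain; first exact: IH sk.
move=> l lA [dl ll].
have ld : dn l = e by move: dl; rewrite !dnE; lia.
have Dk := Dz_dec lam Lam e k k; rewrite eqxx in Dk.
have Dl : Dz (dec lam k) Lam e l = Dz lam Lam e k + a.+1%:Z by move: Dk; rewrite /Dz ll ld dk; lia.
have cl : clean (dec lam k) Lam e l.
  rewrite /clean Dl; have -> : (`|(Dz lam Lam e k + a.+1%:Z)%R| = `|Dz lam Lam e k| + a.+1)%N by lia.
  by rewrite dvdn_addl.
apply: IHm => //; last 1 first.
- by apply: state_dec => //; rewrite Dl (_ : (_ == 0) = false) ?addn0 //; lia.
- move: hm; rewrite ltnS; apply: leq_trans; apply: proper_card; apply/properP.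
  have lk : (l == k) = false.
    by apply: contraTF isT => /eqP e'; move: ll; rewrite e'; lia.
  split.
    by apply/subsetP => i; rewrite !inE ll !ffunE eqxx => /andP[->] /=; case: (i == k); lia.
  by exists l; rewrite !inE lA /= ?ltxx //; move: ll; rewrite !ffunE lk eqxx; lia.
- by rewrite Dl; lia.
Qed.

Lemma claim_state (w j n : nat) lam Lam e : state w j n lam Lam e -> Claim lam.
Proof.
elim: w j n lam Lam e => [|w IHw] j n lam Lam e.
  (* [Wc] cannot be negative: a label that is discounted has distance at least one. *)
  case=> hi _ + _ _; rewrite ltNge sumr_ge0 // => l lA.
  have := hi l lA; case r: (r1 lam Lam e l) => /=; last by rewrite subr0.
  have [D0|] := eqVneq (Dz lam Lam e l) 0; last by lia.
  by move: r; rewrite /r1 D0 mod0n modn_small ?andbF ?ltnS.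
elim: j n lam Lam e => [|j IHj] n lam Lam e.
  case=> hi _ _ hc _ D f _; have := clean_dg hi (fun l lA => hc l lA (leq0n _)); lia.
elim: n lam => [|n IHn] lam; first by case; rewrite ltn0.
move=> S; have [hi he hw hc hn] := S.
(* A label standing at the clock is a top label and can be lowered. *)
have [/set0Pn[k]|] := boolP (tops lam Lam e != set0).
  rewrite inE => /and3P[kA /eqP dk /eqP Dk].
  have lk : lam k = Lam by move: Dk; rewrite /Dz dk ltnn; lia.
  apply: (@claim_step lam k).
    by split=> // l lA; have := hi l lA; rewrite /typ /Dz xpair_eqE !dnE; lia.
  move=> l lA [dl ll].
  have dl' : dn l = e by move: dl; rewrite !dnE; lia.
  have Dl : Dz lam Lam e l = 0 by rewrite /Dz ll lk dl' ltnn; lia.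
  have cl : clean lam Lam e l by rewrite /clean Dl dvdn0.
  apply: (state_chain IHn (ltnSn _)) => //; first by rewrite Dl.
  by apply: state_dec => //; rewrite Dl eqxx addn1.
rewrite negbK => /eqP t0.
have D1 l : l \in A -> dn l = e -> 0 < Dz lam Lam e l.
  move=> lA el; rewrite lt_def hi // andbT; apply/negP => D0.
  by have := in_set0 l; rewrite -t0 inE lA el eqxx D0.
(* No label stands at the clock any more, so it ticks; only distances on the content just left
   change, by one. *)
have [Lam' [e' [he' ne DE distE]]] : exists Lam' e', [/\ (e' < W)%N, e' != e,
    forall l, Dz lam Lam' e' l = Dz lam Lam e l - (dn l == e)%:Z &
    forall l, dn l != e -> dist e (dn l) = (dist e' (dn l)).+1].
  case: e {S hi hw hc hn t0 D1 IHn} he => [|e] he; [exists (Lam - 1), W.-1|exists Lam, e]; split; try lia.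
  - by move=> l; rewrite /Dz; have := dnW l; lia.
  - by move=> l; rewrite /dist; have := dnW l; do 2![case: ifP]; lia.
  - by move=> l; rewrite /Dz; lia.
  - by move=> l; rewrite /dist; have := dnW l; do 2![case: ifP]; lia.
have hi' : inv lam Lam' e'.
  by move=> l lA; rewrite DE; case: eqP => [/(D1 l lA)|_]; [|have := hi l lA]; lia.
have le l : l \in A -> 0 <= (Dz lam Lam e l - (r1 lam Lam e l)%:Z) - (Dz lam Lam' e' l - (r1 lam Lam' e' l)%:Z).
  move=> lA; rewrite DE /r1; case: (dn l =P e) => [->|_]; first by rewrite (eq_sym e e') (negbTE ne) /=; lia.
  by rewrite /=; lia.
have leW : 0 <= Wc lam Lam e - Wc lam Lam' e' by rewrite -sumrB; apply: sumr_ge0.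
have hn' : (#|tops lam Lam' e'| < #|A|.+1)%N.
  by rewrite ltnS subset_leq_card //; apply/subsetP => l; rewrite inE => /andP[].
have [ltW|] := boolP (Wc lam Lam' e' < Wc lam Lam e).
  apply: (IHw W #|A|.+1 lam Lam' e'); split=> //; first by lia.
  by move=> l _; rewrite /dist; have := dnW l; case: ifP; lia.
(* If [Wc] has not dropped, every label on the content just left had residue 1 before the tick and
   is clean after it. *)
move=> geW; have eqW : Wc lam Lam e - Wc lam Lam' e' = 0 by lia.
apply: (IHj #|A|.+1 lam Lam' e'); split=> //; first by lia.
move=> l lA hl; rewrite /clean DE.
have [el|nl] := eqVneq (dn l) e; last by rewrite subr0; apply: hc => //; rewrite distE.
move: eqW; rewrite -sumrB => /eqP; rewrite psumr_eq0 // => /allP/(_ l).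
rewrite mem_index_enum lA DE {2}/r1 el eqxx (eq_sym e e') (negbTE ne) /= => /(_ isT).
case r: (r1 lam Lam e l) => /=; last by lia.
move: r; rewrite /r1 el eqxx /= => /eqP r _.
have := D1 l lA el => D0; have -> : (`|(Dz lam Lam e l - 1)%R| = `|Dz lam Lam e l| - 1)%N by lia.
by rewrite -eqn_mod_dvd ?r //; lia.
Qed.
End Termination.

Theorem claimP : (forall e : int, `|\sum_(k in A) ((d k == e)%:Z - (d k == e + 1)%:Z) : int| <= 1) ->
  forall lam, Claim lam.
Proof.
move=> hst lam.
pose c0 : int := \sum_k `|d k|.
have dle k : `|d k| <= c0 by rewrite /c0 (bigD1 k) //= lerDl sumr_ge0.
pose L : int := 1 + \sum_k `|lam k|.
have lle k : lam k <= L - 1.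
  have h : `|lam k| <= \sum_k `|lam k| by rewrite (bigD1 k) //= lerDl sumr_ge0.
  by move: h; rewrite /L; move: (\sum_k _) => z; lia.
pose dn k : nat := `|(d k + c0)%R|%N.
pose W : nat := (2 * `|c0| + 2)%N.
have dnE k : d k = (dn k)%:Z - c0 by have := dle k; rewrite /dn; lia.
have dnW k : (dn k < W)%N by have := dle k; rewrite /dn /W; lia.
have W1 : (1 < W)%N by rewrite /W; lia.
pose S : int := \sum_(l in A) (Dz dn lam L 0 l -
  ((dn l == 0%N) && (`|Dz dn lam L 0 l| == 1 %[mod a.+1])%N)%:Z).
(* The clock starts above all labels, and [j = W] makes the cleanness condition vacuous because
   [dist] stays below [W]. *)
apply: (claim_state dnE dnW W1 hst (w := `|S|.+1%N) (j := W) (n := #|A|.+1) (Lam := L) (e := 0%N)); split=> //.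
- by move=> l _; rewrite /Dz; have := lle l; lia.
- by rewrite /W; lia.
- by have : S < `|S|.+1%:Z by lia.
- by move=> l _; have := dnW l; case: ifP; lia.
- by rewrite ltnS subset_leq_card //; apply/subsetP => l; rewrite inE => /andP[].
Qed.

End Kill.


(** * Expansions at the pole *)

Lemma wtT (K : fieldType) (I : finType) (d x : I -> int) a lam t : wt K [set: I] d x a lam t =
  \prod_k \prod_l pf K a (d k - d l) (lam k - lam l) (X x t k - X x t l).
Proof.
by rewrite /wt (eq_bigl xpredT) => [|k]; [apply: eq_bigr => k _; apply: eq_bigl => l|]; rewrite inE.
Qed.

Lemma dgT (I : finType) (d : I -> int) a lam :
  dg [set: I] d a lam = \sum_k \sum_l pd a (d k - d l) (lam k - lam l).
Proof.
by rewrite /dg (eq_bigl xpredT) => [|k]; [apply: eq_bigr => k _; apply: eq_bigl => l|]; rewrite inE.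
Qed.

Section Expand.
Variable K : fieldType.
Hypothesis K0 : forall n : nat, n.+1%:R != 0 :> K.
(** [reg] stands for the local ring of functions regular at [u = 0], given by its closure
    properties; [reg_1uV] expresses locality. *)
Variables (reg : K -> Prop) (u : K).
Hypothesis reg_int : forall z : int, reg z%:~R.
Hypothesis regV_int : forall z : int, reg (z%:~R)^-1.
Hypothesis regD : forall f g, reg f -> reg g -> reg (f + g).
Hypothesis regM : forall f g, reg f -> reg g -> reg (f * g).
Hypothesis regu : reg u.
Hypothesis reg_1uV : forall f, reg f -> 1 + u * f != 0 /\ reg (1 + u * f)^-1.

Lemma reg0 : reg 0. Proof. exact: (reg_int 0). Qed.
Lemma reg1 : reg 1. Proof. exact: (reg_int 1). Qed.
Lemma regN f : reg f -> reg (- f).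
Proof. by move=> h; rewrite -mulN1r; apply: regM h; apply: (reg_int (-1)). Qed.
Lemma reg_sum (J : Type) (r : seq J) (P : pred J) F :
  (forall j, P j -> reg (F j)) -> reg (\sum_(j <- r | P j) F j).
Proof. by move=> h; elim/big_rec: _ => [|j z Pj hz]; [exact: reg0|apply: regD => //; apply: h]. Qed.
Lemma reg_prod (J : Type) (r : seq J) (P : pred J) F :
  (forall j, P j -> reg (F j)) -> reg (\prod_(j <- r | P j) F j).
Proof. by move=> h; elim/big_rec: _ => [|j z Pj hz]; [exact: reg1|apply: regM => //; apply: h]. Qed.
Lemma regX f n : reg f -> reg (f ^+ n).
Proof. by move=> h; elim: n => [|n IH]; rewrite ?expr0 ?exprS; [exact: reg1|apply: regM]. Qed.

Definition regp (P : {poly K}) := forall m, reg P`_m.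

Lemma regpM P Q : regp P -> regp Q -> regp (P * Q).
Proof. by move=> hP hQ m; rewrite coefM; apply: reg_sum => i _; apply: regM. Qed.
Lemma regp_sum (J : Type) (r : seq J) (p : pred J) F :
  (forall j, p j -> regp (F j)) -> regp (\sum_(j <- r | p j) F j).
Proof. by move=> h m; rewrite coef_sum; apply: reg_sum => j pj; apply: h. Qed.
Lemma regpX P n : regp P -> regp (P ^+ n).
Proof.
move=> h; elim: n => [|n IH]; last by rewrite exprS; apply: regpM.
by move=> m; rewrite expr0 coef1; apply: (reg_int (m == 0)%N).
Qed.
Lemma regp_horner P : regp P -> reg P.[u].
Proof. by move=> h; rewrite horner_coef; apply: reg_sum => i _; apply: regM => //; apply: regX. Qed.
Lemma regp_horner0 P : regp P -> exists2 r, reg r & P.[u] = P`_0 + u * r.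
Proof.
move=> h; exists (\sum_(i < size P) P`_i.+1 * u ^+ i).
  by apply: reg_sum => i _; apply: regM => //; apply: regX.
rewrite (horner_coef_wide u (leqnSn (size P))) big_ord_recl expr0 mulr1; congr (_ + _).
by rewrite mulr_sumr; apply: eq_bigr => i _; rewrite /= /bump /= add1n exprS; ring.
Qed.

Variables (I : finType) (d x : I -> int) (lam : {ffun I -> int}) (a : nat).
Hypothesis a0 : (0 < a)%N.

Local Notation PSs := (PS (K := K) [set: I] d x lam).
Local Notation ty k := (typ d lam k).
Local Notation Xr t k := ((X x t k)%:~R : K).

Implicit Types t : {perm I}.

(** Degree in [u] bounds degree in the positions, a condition stable under products. It holds
    because a position always comes multiplied by [u]. *)
Definition PSpol (P : {perm I} -> {poly K}) := forall m, PSs m (fun t => (P t)`_m).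

Lemma PSpM P Q : PSpol P -> PSpol Q -> PSpol (fun t => P t * Q t).
Proof.
move=> hP hQ m; have h : PSs m (fun t => \sum_(i < m.+1) (P t)`_i * (Q t)`_(m - i)).
  by apply: PSsum => i _; apply: PSmul (hP _) (hQ _); have := ltn_ord i; lia.
by apply: PSext h => t; rewrite coefM.
Qed.
Lemma PSp_sum (J : Type) (r : seq J) (p : pred J) (F : J -> {perm I} -> {poly K}) :
  (forall j, p j -> PSpol (F j)) -> PSpol (fun t => \sum_(j <- r | p j) F j t).
Proof. by move=> h m; apply: PSext (PSsum r (fun j pj => h j pj m)) => t; rewrite coef_sum. Qed.
Lemma PSpC c : PSpol (fun=> c%:P).
Proof. by move=> m; apply: PSc. Qed.
Lemma PSpX P n : PSpol P -> PSpol (fun t => P t ^+ n).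
Proof.
move=> h; elim: n => [|n IH].
  by move=> m; apply: PSext (PSpC 1 m) => t; rewrite expr0.
by move=> m; apply: PSext (PSpM h IH m) => t; rewrite exprS.
Qed.
Lemma PSpN P : PSpol P -> PSpol (fun t => - P t).
Proof. by move=> h m; apply: PSext (PSopp (h m)) => t; rewrite coefN. Qed.
Lemma PSpD P Q : PSpol P -> PSpol Q -> PSpol (fun t => P t + Q t).
Proof. by move=> hP hQ m; apply: PSext (PSadd (hP m) (hQ m)) => t; rewrite coefD. Qed.

Variable M : nat.

(* [f t] agrees modulo [u ^+ M] with a polynomial in [u] whose coefficient of
   degree [m] has degree at most [m] in the power sums of the positions. *)
Definition expn (f : {perm I} -> K) := exists P : {perm I} -> {poly K},
  [/\ PSpol P, forall t, regp (P t) & forall t, exists2 r, reg r & f t = (P t).[u] + u ^+ M * r].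

Lemma expn_ext f g : f =1 g -> expn f -> expn g.
Proof. by move=> e [P [h1 h2 h3]]; exists P; split=> // t; rewrite -e. Qed.

Lemma expn_poly P : PSpol P -> (forall t, regp (P t)) -> expn (fun t => (P t).[u]).
Proof. by exists P; split=> // t; exists 0; rewrite ?mulr0 ?addr0 //; apply: reg0. Qed.

Lemma expn_cst c : reg c -> expn (fun=> c).
Proof.
move=> hc; apply: expn_ext (expn_poly (PSpC c) _) => [t|_ m]; first by rewrite hornerC.
by rewrite coefC; case: ifP => // _; apply: reg0.
Qed.

Lemma expnM f g : expn f -> expn g -> expn (fun t => f t * g t).
Proof.
move=> [P [P1 P2 P3]] [Q [Q1 Q2 Q3]]; exists (fun t => P t * Q t); split.
- exact: PSpM.
- by move=> t; apply: regpM.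
move=> t; have [r hr ->] := P3 t; have [s hs ->] := Q3 t.
exists ((P t).[u] * s + r * (Q t).[u] + u ^+ M * (r * s)); last by rewrite hornerM; ring.
have := regp_horner (P2 t); have := regp_horner (Q2 t) => q p.
by do !apply: regD; do ?apply: regM => //; apply: regX.
Qed.

Lemma expnD f g : expn f -> expn g -> expn (fun t => f t + g t).
Proof.
move=> [P [P1 P2 P3]] [Q [Q1 Q2 Q3]]; exists (fun t => P t + Q t); split.
- exact: PSpD.
- by move=> t m; rewrite coefD; apply: regD; [apply: P2|apply: Q2].
move=> t; have [r hr ->] := P3 t; have [s hs ->] := Q3 t.
by exists (r + s); [apply: regD|rewrite hornerD; ring].
Qed.

Lemma expn_prod (J : Type) (r : seq J) (f : J -> {perm I} -> K) :
  (forall j, expn (f j)) -> expn (fun t => \prod_(j <- r) f j t).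
Proof.
move=> h; elim: r => [|j r IH]; first by apply: expn_ext (expn_cst reg1) => t; rewrite big_nil.
by apply: expn_ext (expnM (h j) IH) => t; rewrite big_cons.
Qed.

Lemma coef_prod_hser (y : seq K) m :
  (\prod_(c <- y) (1 + c%:P * 'X))`_m = hser [seq - c | c <- y] [::] m.
Proof.
elim: y m => [|c y IH] m; first by rewrite big_nil coef1.
rewrite big_cons mulrDl mul1r coefD -mulrA coefCM coefXM IH /=.
by case: m => [|m] /=; rewrite ?mulr0 ?addr0 // IH; ring.
Qed.

Lemma PSp_prod (J : Type) (r : seq J) (y : J -> {perm I} -> K) :
  (forall n, PSs n (fun t => \sum_(j <- r) y j t ^+ n)) ->
  PSpol (fun t => \prod_(j <- r) (1 + (y j t)%:P * 'X)).
Proof.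
move=> hy m; pose N t := [seq - c | c <- [seq y j t | j <- r]].
have h : PSs m (fun t => hser (N t) [::] m).
  apply: (PSnewton K0 a0 (q := fun t => psum (N t) [::]) (H := fun t => hser (N t) [::])) => [t|t|i].
  - exact: hser_newton.
  - exact: hser0.
  apply: PSext (PSscale (- (-1) ^+ i.+1) (hy i.+1)) => t.
  rewrite /psum big_nil add0r /N !big_map mulNr mulr_sumr; congr (- _).
  by apply: eq_bigr => j _; rewrite -exprMn mulN1r.
by apply: PSext h => t; rewrite -coef_prod_hser /= big_map.
Qed.

Lemma regp_lin c : reg c -> regp (1 + c%:P * 'X).
Proof.
move=> h m; rewrite coefD coef1 coefCM coefX.
by apply: regD; [apply: (reg_int (m == 0)%N)|apply: regM => //; apply: (reg_int (m == 1)%N)].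
Qed.

Lemma regp_prod (J : eqType) (r : seq J) (y : J -> K) :
  {in r, forall j, reg (y j)} -> regp (\prod_(j <- r) (1 + (y j)%:P * 'X)).
Proof.
move=> h; rewrite big_seq; elim/big_rec: _ => [m|j P jr hP].
  2: by apply: regpM => //; apply: regp_lin; apply: h.
by rewrite coef1; apply: (reg_int (m == 0)%N).
Qed.

Lemma horner_prod_lin (J : Type) (r : seq J) (y : J -> K) :
  (\prod_(j <- r) (1 + (y j)%:P * 'X)).[u] = \prod_(j <- r) (1 + y j * u).
Proof. by rewrite horner_prod; apply: eq_bigr => j _; rewrite !hornerE. Qed.

Lemma expn_fac (J : eqType) (r : seq J) (y : J -> {perm I} -> K) :
  (forall n, PSs n (fun t => \sum_(j <- r) y j t ^+ n)) -> (forall t, {in r, forall j, reg (y j t)}) ->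
  expn (fun t => \prod_(j <- r) (1 + y j t * u)) /\
  expn (fun t => \prod_(j <- r) (1 + y j t * u)^-1).
Proof.
move=> hy hr; pose P t := \prod_(j <- r) (1 + (y j t)%:P * 'X).
have P1 : PSpol P by apply: PSp_prod.
have P2 t : regp (P t) by apply: regp_prod.
have E t : (P t).[u] = \prod_(j <- r) (1 + y j t * u) by rewrite horner_prod_lin.
split; first by apply: expn_ext (expn_poly P1 P2) => t; rewrite E.
(* The truncated geometric series for [1 / P]. As [P] has constant coefficient 1, the error is
   divisible by [u ^+ M]. *)
exists (fun t => \sum_(i < M) (1 - P t) ^+ i); split.
- apply: PSp_sum => i _; apply: PSpX; apply: PSpD; last exact: PSpN.
  exact: PSpC.
- move=> t; apply: regp_sum => i _; apply: regpX => m; rewrite coefB coef1.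
  by apply: regD; [apply: (reg_int (m == 0)%N)|apply: regN; apply: P2].
move=> t; have [s hs es] := regp_horner0 (P2 t).
have c0 : (P t)`_0 = 1 by rewrite /P -(big_map (y^~ t) xpredT (fun c => 1 + c%:P * 'X)) coef_prod_hser hser0.
have [n0 hV] := reg_1uV hs; rewrite -c0 -es in n0 hV.
exists (s ^+ M * ((-1) ^+ M * (P t).[u]^-1)).
  by do ?apply: regM => //; apply: regX => //; apply: (reg_int (-1)).
rewrite prodfV -E horner_sum.
have -> : \sum_(i < M) ((1 - P t) ^+ i).[u] = \sum_(i < M) (1 - (P t).[u]) ^+ i.
  by apply: eq_bigr => i _; rewrite horner_exp !hornerE.
apply: (mulfI n0); rewrite mulfV // mulrDr.
have e1 : (P t).[u] * \sum_(i < M) (1 - (P t).[u]) ^+ i = 1 - (1 - (P t).[u]) ^+ M.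
  by rewrite -[RHS]opprB subrX1; move: (\sum_(_ < _) _) => z; ring.
rewrite e1 es c0 (_ : 1 - (1 + u * s) = (-1) * (u * s)); last by ring.
rewrite !exprMn; move: n0; rewrite es c0 => n0; by field.
Qed.

Lemma ps_sum T n t : ps K [set: I] d x lam T n t = \sum_(l | ty l == T) Xr t l ^+ n.
Proof. by apply: eq_bigl => l; rewrite inE. Qed.

Lemma PS_wsum2 (F : int * int -> int * int -> K) p q :
  PSs (p + q) (fun t => \sum_k \sum_l F (ty k) (ty l) * (Xr t k ^+ p * Xr t l ^+ q)).
Proof.
(* Products of power sums are indexed by types, the sum by cells; dividing by the multiplicity of
   the type corrects the overcount. *)
pose c k : K := #|[pred l | ty l == ty k]|%:R^-1.
have h : PSs (p + q) (fun t => \sum_k \sum_l (c k * c l * F (ty k) (ty l)) *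
     (ps K [set: I] d x lam (ty k) p t * ps K [set: I] d x lam (ty l) q t)).
  by do 2!apply: PSsum => ? _; apply: PSscale; apply: (PSmul (leqnn _)); apply: PSp.
have cE (G : int * int -> K) (Y : I -> K) :
    \sum_k c k * G (ty k) * \sum_(l | ty l == ty k) Y l = \sum_l G (ty l) * Y l.
  under eq_bigr do rewrite mulr_sumr.
  rewrite (exchange_big_dep xpredT) //=; apply: eq_bigr => l _.
  rewrite (eq_bigr (fun=> #|[pred l' | ty l' == ty l]|%:R^-1 * G (ty l) * Y l)); last first.
    by move=> k /eqP e; rewrite /c e.
  rewrite sumr_const (eq_card (B := [pred l' | ty l' == ty l])); last first.
    by move=> k; rewrite !inE eq_sym.
  rewrite -[LHS]mulr_natl !mulrA mulfV ?mul1r //.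
  have : (0 < #|[pred l' | ty l' == ty l]|)%N by apply/card_gt0P; exists l; rewrite inE.
  by case: #|_|.
apply: PSext h => t.
transitivity (\sum_k c k * (fun T => \sum_l F T (ty l) * Xr t l ^+ q) (ty k) *
    \sum_(l | ty l == ty k) Xr t l ^+ p).
  apply: eq_bigr => k _; rewrite /= -(cE (F (ty k))) mulr_sumr mulr_suml.
  by apply: eq_bigr => l _; rewrite !ps_sum; ring.
rewrite (cE (fun T => \sum_l F T (ty l) * Xr t l ^+ q)); apply: eq_bigr => k _.
by rewrite mulr_suml; apply: eq_bigr => l _; rewrite mulrCA; ring.
Qed.

Lemma PS_wsum (F : int * int -> K) n : PSs n (fun t => \sum_k F (ty k) * Xr t k ^+ n).
Proof.
have h := PS_wsum2 (fun T _ => F T / #|I|%:R) n 0; rewrite addn0 in h.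
apply: PSext h => t; apply: eq_bigr => k _.
rewrite (eq_bigr (fun=> F (ty k) / #|I|%:R * Xr t k ^+ n)) => [|l _]; last by rewrite expr0 mulr1.
rewrite sumr_const -[LHS]mulr_natl.
have n0 : #|I|%:R != 0 :> K.
  by have : (0 < #|I|)%N by [apply/card_gt0P; exists k]; case: #|I|.
by rewrite /=; field.
Qed.

Definition unt v := [/\ v != 0, reg v & reg v^-1].

Lemma PS_pair (F : int * int -> int * int -> K) (c : int) n :
  PSs n (fun t => \sum_k \sum_l F (ty k) (ty l) * (X x t k - X x t l + c)%:~R ^+ n).
Proof.
have h : PSs n (fun t => \sum_(i < n.+1) \sum_(j < i.+1) \sum_k \sum_l
    (F (ty k) (ty l) * (c%:~R ^+ (i - j) * (-1) ^+ j *+ 'C(i, j) *+ 'C(n, i))) *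
      (Xr t k ^+ (n - i) * Xr t l ^+ j)).
  apply: PSsum => i _; apply: PSsum => j _.
  apply: (@PSle _ _ _ _ _ _ (n - i + j)); first by have := ltn_ord i; have := ltn_ord j; lia.
  exact: (PS_wsum2 (fun T T' => F T T' * (c%:~R ^+ (i - j) * (-1) ^+ j *+ 'C(i, j) *+ 'C(n, i)))).
apply: PSext h => t.
under eq_bigr do rewrite exchange_big /=.
rewrite exchange_big /=; apply: eq_bigr => k _.
under eq_bigr do rewrite exchange_big /=.
rewrite exchange_big /=; apply: eq_bigr => l _.
rewrite -addrA rmorphD /= exprDn mulr_sumr; apply: eq_bigr => i _.
rewrite (_ : (- X x t l + c)%:~R = c%:~R + -1 * Xr t l); last by rewrite rmorphD rmorphN /=; ring.
rewrite exprDn.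
rewrite -[in RHS]mulr_natr mulr_sumr mulr_suml mulr_sumr; apply: eq_bigr => j _.
by rewrite exprMn; ring.
Qed.

Lemma PS_single (F : int * int -> K) (al c : int) n :
  PSs n (fun t => \sum_k F (ty k) * (al * X x t k + c)%:~R ^+ n).
Proof.
have h : PSs n (fun t => \sum_(i < n.+1) \sum_k
    (F (ty k) * (c%:~R ^+ (n - i) * al%:~R ^+ i *+ 'C(n, i))) * Xr t k ^+ i).
  apply: PSsum => i _; apply: (@PSle _ _ _ _ _ _ i); first by have := ltn_ord i; lia.
  exact: (PS_wsum (fun T => F T * (c%:~R ^+ (n - i) * al%:~R ^+ i *+ 'C(n, i)))).
apply: PSext h => t; rewrite exchange_big /=; apply: eq_bigr => k _.
rewrite addrC rmorphD /= exprDn mulr_sumr; apply: eq_bigr => i _.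
by rewrite rmorphM /= exprMn; ring.
Qed.

Lemma expn_unt (J : eqType) (r : seq J) (y : J -> {perm I} -> K) (v : J -> K) :
  (forall n, PSs n (fun t => \sum_(j <- r) (y j t / v j) ^+ n)) ->
  (forall t, {in r, forall j, reg (y j t)}) -> {in r, forall j, unt (v j)} ->
  expn (fun t => \prod_(j <- r) (v j + y j t * u)) /\
  expn (fun t => \prod_(j <- r) (v j + y j t * u)^-1).
Proof.
move=> hy hr hv.
have [h1 h2] : expn (fun t => \prod_(j <- r) (1 + y j t / v j * u)) /\
  expn (fun t => \prod_(j <- r) (1 + y j t / v j * u)^-1).
  by apply: expn_fac => // t j jr; apply: regM; [apply: hr|case: (hv j jr)].
have c1 : reg (\prod_(j <- r) v j).
  by rewrite big_seq; apply: reg_prod => j jr; case: (hv j jr).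
have c2 : reg (\prod_(j <- r) (v j)^-1).
  by rewrite big_seq; apply: reg_prod => j jr; case: (hv j jr).
split; [apply: expn_ext (expnM (expn_cst c1) h1)|apply: expn_ext (expnM (expn_cst c2) h2)] => t;
  rewrite -big_split /= big_seq [RHS]big_seq; apply: eq_bigr => j jr; have [v0 _ _] := hv j jr.
- by field.
- by rewrite -invfM; congr (_^-1); field.
Qed.

Lemma expn_pair (vs : int * int -> int * int -> seq K) (c : int) :
  (forall T T', {in vs T T', forall v, unt v}) ->
  expn (fun t => \prod_k \prod_l \prod_(v <- vs (ty k) (ty l)) (v + (X x t k - X x t l + c)%:~R * u)) /\
  expn (fun t => \prod_k \prod_l \prod_(v <- vs (ty k) (ty l)) (v + (X x t k - X x t l + c)%:~R * u)^-1).
Proof.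
move=> hv; pose r := [seq (p, v) | p <- index_enum (I * I)%type, v <- vs (ty p.1) (ty p.2)].
have flat (G : I * I * K -> K) : \prod_k \prod_l \prod_(v <- vs (ty k) (ty l)) G (k, l, v) = \prod_(j <- r) G j.
  by rewrite big_allpairs_dep pair_bigA /=; apply: eq_bigr => -[k l].
pose y (j : I * I * K) t : K := (X x t j.1.1 - X x t j.1.2 + c)%:~R.
have hA n : PSs n (fun t => \sum_(j <- r) (y j t / j.2) ^+ n).
   apply: PSext (PS_pair (fun T T' => \sum_(v <- vs T T') v^-1 ^+ n) c n) => t.
  rewrite /r big_allpairs_dep pair_bigA /=; apply: eq_bigr => -[k l] _ /=.
  by rewrite mulr_suml; apply: eq_bigr => v _; rewrite mulrC exprMn.
have hB t : {in r, forall j, reg (y j t)} by move=> j _; apply: reg_int.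
have hC : {in r, forall j, unt j.2} by move=> j /allpairsPdep[p [v [_ hin ->]]]; apply: hv hin.
have [h1 h2] := expn_unt hA hB hC.
by split; [apply: expn_ext h1|apply: expn_ext h2] => t; rewrite -flat.
Qed.

Lemma expn_single (vs : int * int -> seq K) (al c : int) :
  (forall T, {in vs T, forall v, unt v}) ->
  expn (fun t => \prod_k \prod_(v <- vs (ty k)) (v + (al * X x t k + c)%:~R * u)) /\
  expn (fun t => \prod_k \prod_(v <- vs (ty k)) (v + (al * X x t k + c)%:~R * u)^-1).
Proof.
move=> hv; pose r := [seq (p, v) | p <- index_enum I, v <- vs (ty p)].
have flat (G : I * K -> K) : \prod_k \prod_(v <- vs (ty k)) G (k, v) = \prod_(j <- r) G j.
  by rewrite big_allpairs_dep.
pose y (j : I * K) t : K := (al * X x t j.1 + c)%:~R.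
have hA n : PSs n (fun t => \sum_(j <- r) (y j t / j.2) ^+ n).
   apply: PSext (PS_single (fun T => \sum_(v <- vs T) v^-1 ^+ n) al c n) => t.
  rewrite /r big_allpairs_dep /=; apply: eq_bigr => k _ /=.
  by rewrite mulr_suml; apply: eq_bigr => v _; rewrite mulrC exprMn.
have hB t : {in r, forall j, reg (y j t)} by move=> j _; apply: reg_int.
have hC : {in r, forall j, unt j.2} by move=> j /allpairsPdep[p [v [_ hin ->]]]; apply: hv hin.
have [h1 h2] := expn_unt hA hB hC.
by split; [apply: expn_ext h1|apply: expn_ext h2] => t; rewrite -flat.
Qed.

Lemma expn_pow (w v : int * int -> K) m : (forall T, reg (w T)) -> (forall T, reg (v T)) ->
  expn (fun t => \sum_k w (ty k) * ((X x t k)%:~R * u + v (ty k)) ^+ m).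
Proof.
move=> hw hv.
pose P t : {poly K} := \sum_(i < m.+1) (\sum_k (w (ty k) * v (ty k) ^+ (m - i) *+ 'C(m, i)) * Xr t k ^+ i)%:P * 'X^i.
have cP t j : (P t)`_j = if (j < m.+1)%N then
    \sum_k (w (ty k) * v (ty k) ^+ (m - j) *+ 'C(m, j)) * Xr t k ^+ j else 0.
  rewrite /P coef_sum; under eq_bigr do rewrite coefCM coefXn.
  case: ltnP => hj.
    rewrite (bigD1 (Ordinal hj)) //= eqxx mulr1 [Z in _ + Z]big1 ?addr0 // => i ne.
    by rewrite (_ : (j == i) = false) ?mulr0 //; apply: contraNF ne => /eqP e; apply/eqP/val_inj.
  rewrite big1 // => i _; rewrite (_ : (j == i) = false) ?mulr0 //.
  by have := ltn_ord i; case: (j =P i) => // e; lia.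
apply: expn_ext (expn_poly (P := P) _ _) => [t|j|t j].
- rewrite /P horner_sum.
  under eq_bigr do rewrite hornerM hornerXn hornerC mulr_suml.
  rewrite exchange_big /=; apply: eq_bigr => k _; rewrite addrC exprDn mulr_sumr.
  by apply: eq_bigr => i _; rewrite exprMn; ring.
- have := PS_wsum (fun T => w T * v T ^+ (m - j) *+ 'C(m, j)) j.
  case: (ltnP j m.+1) => hj h.
    by apply: PSext h => t; rewrite cP hj.
  by apply: PSext (PSc _ _ _ _ _ 0) => t; rewrite cP ltnNge hj.
- rewrite cP; case: ifP => _; last exact: reg0.
  apply: reg_sum => k _; rewrite -mulr_natr.
  by do !apply: regM => //; do ?apply: regX => //; apply: (reg_int (_ : nat)).
Qed.

End Expand.


(** * Diagonals of partitions *)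

Section Cells.
Variables (I : finType) (d x : I -> int).
Hypothesis dx_inj : forall k l, d k = d l -> x k = x l -> k = l.
Hypothesis x_ge0 : forall k, 0 <= x k.
Hypothesis y_ge0 : forall k, d k <= x k.
Hypothesis cell_up : forall k, 0 < x k -> exists m, x m = x k - 1 /\ d m = d k - 1.
Hypothesis cell_left : forall k, d k < x k -> exists m, x m = x k /\ d m = d k + 1.

Implicit Types (lam : {ffun I -> int}) (t : {perm I}) (S L : {set I}).

Definition lower L := forall k m, k \in L ->
  (x m = x k - 1 /\ d m = d k - 1) \/ (x m = x k /\ d m = d k + 1) -> m \in L.
Definition upper S := [forall k in S, forall m,
  ((x m == x k + 1) && (d m == d k + 1)) || ((x m == x k) && (d m == d k - 1)) ==> (m \in S)].

Lemma upperP S : reflect (forall k m, k \in S ->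
  (x m = x k + 1 /\ d m = d k + 1) \/ (x m = x k /\ d m = d k - 1) -> m \in S) (upper S).
Proof.
apply: (iffP forall_inP) => h k.
  move=> m kS hm; have /forallP/(_ m)/implyP := h k kS; apply.
  by case: hm => -[-> ->]; rewrite !eqxx ?orbT.
move=> kS; apply/forallP => m; apply/implyP => /orP hm; apply: h kS _.
by case: hm => /andP[/eqP ? /eqP ?]; [left|right].
Qed.

Lemma upper_lower S : upper S -> lower (~: S).
Proof.
move=> /upperP h k m; rewrite !inE => kS hm; apply: contra kS => mS.
by apply: h mS _; case: hm => -[-> ->]; [left|right]; split; ring.
Qed.

Lemma lowerT : lower [set: I]. Proof. by move=> *; rewrite inE. Qed.

Definition diag L (e : int) : nat := #|[set k in L | d k == e]|.

Lemma diagE L e : (diag L e)%:Z = \sum_(k in L) (d k == e)%:Z.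
Proof.
rewrite /diag -sum1_card -[LHS]natz natr_sum big_mkcond [RHS]big_mkcond /=.
by apply: eq_bigr => k _; rewrite inE; case: (k \in L) => //=; case: (d k == e).
Qed.

Lemma shift_card (B C : {set I}) (c e : int) :
  (forall k, k \in B -> exists2 m, m \in C & x m = x k + c /\ d m = d k + e) -> (#|B| <= #|C|)%N.
Proof.
move=> h; pose f k := odflt k [pick m in C | (x m == x k + c) && (d m == d k + e)].
have fP k : k \in B -> [/\ f k \in C, x (f k) = x k + c & d (f k) = d k + e].
  move=> kB; rewrite /f; case: pickP => [m /and3P[? /eqP ? /eqP ?] //|hn].
  by have [m mC [h1 h2]] := h k kB; have := hn m; rewrite mC h1 h2 !eqxx.
rewrite -(card_in_imset (f := f) (D := mem B)); last first.
  move=> k l kB lB e'; have [_ x1 d1] := fP k kB; have [_ x2 d2] := fP l lB.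
  by apply: dx_inj; move: x1 d1; rewrite e' x2 d2; lia.
by apply: subset_leq_card; apply/subsetP => _ /imsetP[k kB ->]; have [] := fP k kB.
Qed.

(** Moving up injects diagonal [e + 1] into diagonal [e]. Moving left goes back and fails only in
    the first column, hence for at most one cell. *)
Lemma diag_pos L e : lower L -> 0 <= e -> (diag L (e + 1) <= diag L e <= (diag L (e + 1)).+1)%N.
Proof.
move=> hL e0; apply/andP; split.
  apply: (shift_card (c := -1) (e := -1)) => k; rewrite inE => /andP[kL /eqP dk].
  have [m [xm dm]] : exists m, x m = x k - 1 /\ d m = d k - 1.
    by apply: cell_up; have := y_ge0 k; lia.
  exists m => //; rewrite inE dm (hL k m kL) /=; [lia|by left].
pose Z := [set k in L | (d k == e) && (x k == e)].
have hZ : (#|Z| <= 1)%N.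
  apply/card_le1_eqP => k l; rewrite !inE => /and3P[_ /eqP dk /eqP xk] /and3P[_ /eqP dl /eqP xl].
  by apply: dx_inj; lia.
rewrite [leqLHS]/diag -(cardsID Z [set k in L | d k == e]) -addn1 addnC.
apply: leq_add; last by apply: leq_trans hZ; apply: subset_leq_card; apply: subsetIr.
apply: (shift_card (c := 0) (e := 1)) => k; rewrite !inE => /andP[+ /andP[kL dk]].
rewrite kL dk /= => xk; have [m [xm dm]] : exists m, x m = x k /\ d m = d k + 1.
  by apply: cell_left; have := y_ge0 k; lia.
exists m; last by rewrite addr0.
by rewrite inE dm (hL k m kL) /=; [lia|right].
Qed.

Lemma diag_neg L e : lower L -> e < 0 -> (diag L e <= diag L (e + 1) <= (diag L e).+1)%N.
Proof.
move=> hL e0; apply/andP; split.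
  apply: (shift_card (c := 0) (e := 1)) => k; rewrite inE => /andP[kL /eqP dk].
  have [m [xm dm]] : exists m, x m = x k /\ d m = d k + 1.
    by apply: cell_left; have := x_ge0 k; lia.
  exists m; last by rewrite addr0.
  by rewrite inE dm (hL k m kL) /=; [lia|right].
pose Z := [set k in L | (d k == e + 1) && (x k == 0)].
have hZ : (#|Z| <= 1)%N.
  apply/card_le1_eqP => k l; rewrite !inE => /and3P[_ /eqP dk /eqP xk] /and3P[_ /eqP dl /eqP xl].
  by apply: dx_inj; lia.
rewrite [leqLHS]/diag -(cardsID Z [set k in L | d k == e + 1]) -addn1 addnC.
apply: leq_add; last by apply: leq_trans hZ; apply: subset_leq_card; apply: subsetIr.
apply: (shift_card (c := -1) (e := -1)) => k; rewrite !inE => /andP[+ /andP[kL dk]].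
rewrite kL dk /= => xk; have [m [xm dm]] : exists m, x m = x k - 1 /\ d m = d k - 1.
  by apply: cell_up; have := x_ge0 k; lia.
exists m => //; rewrite inE dm (hL k m kL) /=; [lia|by left].
Qed.

Lemma diagD S e : ((diag S e)%:Z + (diag (~: S) e)%:Z = (diag [set: I] e)%:Z).
Proof.
rewrite !diagE [RHS](big_setID S) /=; congr (_ + _).
  by apply: eq_bigl => k; rewrite !inE.
by apply: eq_bigl => k; rewrite !inE andbT.
Qed.

(** The whole shape and the complement of [S] both have steps of size 0 or 1 in the same direction,
    so their difference has steps of absolute value at most 1. *)
Lemma diag_step S e : upper S -> `|(diag S e)%:Z - (diag S (e + 1))%:Z| <= 1.
Proof.
move=> /upper_lower h; have h1 := diagD S e; have h2 := diagD S (e + 1).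
have [e0|e0] := lerP 0 e.
  have := diag_pos lowerT e0; have := diag_pos h e0; move: h1 h2.
  by move: (diag _ _) (diag _ _) (diag _ _) (diag _ _) (diag _ _) (diag _ _) => *; lia.
have := diag_neg lowerT e0; have := diag_neg h e0; move: h1 h2.
by move: (diag _ _) (diag _ _) (diag _ _) (diag _ _) (diag _ _) (diag _ _) => *; lia.
Qed.

(** * Separating an upper set from its complement *)

Definition cmax : int := \sum_k `|d k|.

Lemma le_cmax k : `|d k| <= cmax.
Proof. by rewrite /cmax (bigD1 k) //= lerDl sumr_ge0. Qed.

Lemma diag_far L e : cmax < `|e| -> diag L e = 0%N.
Proof.
move=> h; apply/eqP; rewrite cards_eq0; apply/eqP/setP => k; rewrite !inE.
by have := le_cmax k; case: eqP => [->|]; rewrite ?andbF //; lia.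
Qed.

(** Contents differ by at most [2 * cmax], so the shifted contents are at least 3 away from the
    others, out of reach of every pair factor. *)
Definition gapw : int := 2 * cmax + 3.

(* Moving the contents of the cells of [S] away from the others makes the
   weights of [S] and of its complement independent. *)
Definition dsh S k : int := d k + (k \in S)%:Z * gapw.
(** Types record shifted contents, but the unit factors still depend on the true ones. *)
Definition undo (e : int) : int := if e <= cmax then e else e - gapw.

Lemma undo_dsh S k : undo (dsh S k) = d k.
Proof.
have c0 : 0 <= cmax by apply: sumr_ge0.
by rewrite /undo /dsh /gapw; have := le_cmax k; case: (k \in S); case: ifP; lia.
Qed.

Lemma dsh_near S k l : `|dsh S k - dsh S l| <= 2 -> (k \in S) = (l \in S).
Proof.
have c0 : 0 <= cmax by apply: sumr_ge0.
by rewrite /dsh /gapw; have := le_cmax k; have := le_cmax l; case: (k \in S); case: (l \in S); lia.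
Qed.

Lemma dsh_sub S k l : (k \in S) = (l \in S) -> dsh S k - dsh S l = d k - d l.
Proof. by rewrite /dsh => ->; ring. Qed.

Lemma dsh_eq S k l : (dsh S k == dsh S l) = (d k == d l) && ((k \in S) == (l \in S)).
Proof.
apply/eqP/andP => [e|[/eqP e /eqP e']]; last by rewrite /dsh e e'.
have e1 : (k \in S) = (l \in S) by apply: dsh_near; rewrite e subrr.
by have := dsh_sub e1; rewrite e e1; split => //; lia.
Qed.

Lemma dshx_inj S k l : dsh S k = dsh S l -> x k = x l -> k = l.
Proof. by move=> /eqP; rewrite dsh_eq => /andP[/eqP e _]; apply: dx_inj. Qed.

Lemma dsh_convex S : upper S -> forall k l, k \in [set: I] -> l \in [set: I] ->
  dsh S k = dsh S l -> x l = x k + 1 ->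
  (exists2 m, m \in [set: I] & dsh S m = dsh S k + 1 /\ x m = x k + 1) /\
  (exists2 m, m \in [set: I] & dsh S m = dsh S k - 1 /\ x m = x k).
Proof.
move=> hS k l _ _ /eqP; rewrite dsh_eq => /andP[/eqP dkl /eqP skl] xl.
have hL := upper_lower hS; move/upperP: hS => hS.
have [m1 [xm1 dm1]] : exists m, x m = x l /\ d m = d l + 1.
  by apply: cell_left; have := y_ge0 k; lia.
have [m2 [xm2 dm2]] : exists m, x m = x l - 1 /\ d m = d l - 1.
  by apply: cell_up; have := x_ge0 k; lia.
have s1 : (m1 \in S) = (k \in S).
  case kS: (k \in S); first by apply: hS kS _; left; split; lia.
  have lS : l \in ~: S by rewrite inE -skl kS.
  by apply/negbTE; have := hL l m1 lS; rewrite inE; apply; right.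
have s2 : (m2 \in S) = (k \in S).
  case kS: (k \in S); first by apply: hS kS _; right; split; lia.
  have lS : l \in ~: S by rewrite inE -skl kS.
  by apply/negbTE; have := hL l m2 lS; rewrite inE; apply; left.
split; [exists m1|exists m2]; rewrite ?inE // /dsh ?s1 ?s2; lia.
Qed.

Lemma dsh_step S : upper S -> forall e : int,
  `|\sum_(k in [set: I]) ((dsh S k == e)%:Z - (dsh S k == e + 1)%:Z) : int| <= 1.
Proof.
move=> hS e; have hL := upper_lower hS.
have c0 : 0 <= cmax by apply: sumr_ge0.
have sh (f : int) : \sum_(k in [set: I]) (dsh S k == f)%:Z =
    (diag S (f - gapw))%:Z + (diag (~: S) f)%:Z :> int.
  rewrite !diagE (big_setID S) /=; congr (_ + _).
    apply: eq_big => [k|k]; rewrite !inE //= => kS.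
    by rewrite /dsh kS mul1r; congr (Posz (nat_of_bool _)); lia.
  apply: eq_big => [k|k]; rewrite !inE ?andbT //= => /negbTE kS.
  by rewrite /dsh kS mul0r addr0.
rewrite sumrB !sh.
have [h|h] := lerP e cmax.
  rewrite !(@diag_far S); [|rewrite /gapw; lia|rewrite /gapw; lia].
  have [e0|e0] := lerP 0 e.
    by have := diag_pos hL e0; move: (diag _ _) (diag _ _) => *; lia.
  by have := diag_neg hL e0; move: (diag _ _) (diag _ _) => *; lia.
rewrite !(@diag_far (~: S)); [|lia|lia].
by have := diag_step (e - gapw) hS; rewrite (_ : e - gapw + 1 = e + 1 - gapw) ?addr0 //; ring.
Qed.

Lemma cell_below k (r c : int) : 0 <= r <= x k -> 0 <= c <= x k - d k ->
  exists m, x m = r /\ d m = r - c.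
Proof.
have [n] := ubnP `|((x k - r) + (x k - d k - c))%R|%N; elim: n k => // n IH k hn hr hc.
have [lt|ge] := ltrP r (x k).
  have [m [xm dm]] : exists m, x m = x k - 1 /\ d m = d k - 1 by apply: cell_up; lia.
  by apply: (IH m); lia.
have [lt|ge'] := ltrP c (x k - d k).
  have [m [xm dm]] : exists m, x m = x k /\ d m = d k + 1 by apply: cell_left; lia.
  by apply: (IH m); lia.
by exists k; split; lia.
Qed.

Lemma count_below (e r : int) :
  (forall r', Num.max 0 e <= r' < r -> exists m, x m = r' /\ d m = e) ->
  \sum_l ((d l == e) && (x l < r))%:Z = Num.max 0 (r - Num.max 0 e) :> int.
Proof.
move=> h; have [hr|hr] := lerP (r - Num.max 0 e) 0.
  by rewrite big1 // => l _; have := x_ge0 l; have := y_ge0 l; lia.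
have [n en] : exists n : nat, r = Num.max 0 e + n%:Z by exists `|(r - Num.max 0 e)%R|%N; lia.
rewrite {hr}en in h *; rewrite (_ : Num.max 0 e + n%:Z - Num.max 0 e = n%:Z); last by ring.
elim: n h => [|n IH] h.
  by rewrite big1 // => l _; have := x_ge0 l; have := y_ge0 l; lia.
have [m [xm dm]] : exists m, x m = Num.max 0 e + n%:Z /\ d m = e by apply: h; lia.
transitivity (\sum_l (((d l == e) && (x l < Num.max 0 e + n%:Z))%:Z + (l == m)%:Z) : int).
  apply: eq_bigr => l _; have [->|ne] := eqVneq l m; first by rewrite xm dm; lia.
  have : ~ (d l = e /\ x l = Num.max 0 e + n%:Z) by case=> dl xl; case/eqP: ne; apply: dx_inj; lia.
  by lia.
rewrite big_split /= IH; last by move=> r' hr'; apply: h; lia.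
by rewrite (bigD1 m) //= eqxx big1 ?addr0 => [|l /negbTE ->] //; lia.
Qed.

Variable a : nat.
Hypothesis a0 : (0 < a)%N.

(** * The quadratic form of the diagonal lengths *)

Definition beta (e : int) : int := 2 * (e == 0)%:Z - (e == 1)%:Z - (e == -1)%:Z.
Definition pairing (B C : {set I}) : int := \sum_(k in B) \sum_(l in C) beta (d k - d l).

Lemma pairing_sq L : exists2 W : nat, (2 * cmax + 1 < W%:Z) &
  pairing L L = \sum_(e < W.+1) ((diag L (e%:Z - 1 - cmax))%:Z - (diag L (e%:Z - cmax))%:Z) ^+ 2.
Proof.
pose dn k := `|(d k + cmax)%R|%N; pose W := (2 * `|cmax| + 2)%N.
have c0 : 0 <= cmax by apply: sumr_ge0.
have dnE k : d k = (dn k)%:Z - cmax by rewrite /dn; have := le_cmax k; lia.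
have dnW k : (dn k < W)%N by rewrite /dn /W; have := le_cmax k; lia.
have W1 : (1 < W)%N by rewrite /W; lia.
exists W; first by rewrite /W; lia.
transitivity (\sum_(k in L) \sum_(l in L) \sum_(e < W.+1)
   (((dn k).+1 == e)%:Z - (dn k == e)%:Z) * (((dn l).+1 == e)%:Z - (dn l == e)%:Z) : int).
  apply: eq_bigr => k _; apply: eq_bigr => l _.
  by rewrite (eps_sum a0 dnE dnW W1) /beta; lia.
under eq_bigr do rewrite exchange_big /=.
rewrite exchange_big /=; apply: eq_bigr => e _.
rewrite expr2 !diagE -sumrB mulr_suml; apply: eq_bigr => k _; rewrite mulr_sumr.
by apply: eq_bigr => l _; congr (_ * _); rewrite dnE; lia.
Qed.

(** Up to the main diagonal the lengths grow by 0 or 1, beyond it they fall by 0 or 1. Squares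
    therefore equal absolute values, and the sum telescopes on either side. *)
Lemma pairing_lower L : lower L -> pairing L L = 2 * (diag L 0)%:Z.
Proof.
move=> hL; have [W hW ->] := pairing_sq L.
have c0 : 0 <= cmax by apply: sumr_ge0.
pose f (e : nat) : int := (diag L (e%:Z - 1 - cmax))%:Z.
have fE (e : nat) : (diag L (e%:Z - cmax))%:Z = f e.+1 by rewrite /f; congr (Posz (diag L _)); lia.
pose c := `|cmax|%N.
transitivity (\sum_(0 <= e < c.+1) (f e.+1 - f e) + \sum_(c.+1 <= e < W.+1) (f e - f e.+1)).
  rewrite -(big_mkord xpredT (fun e => (f e - (diag L (e%:Z - cmax))%:Z) ^+ 2)).
  rewrite (big_cat_nat (n := c.+1)) //=; last by rewrite /c; lia.
  congr (_ + _); rewrite big_nat [RHS]big_nat; apply: eq_bigr => e he; rewrite fE.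
    have := @diag_neg L (e%:Z - 1 - cmax) hL.
    rewrite -/(f e) (_ : e%:Z - 1 - cmax + 1 = e%:Z - cmax); last by ring.
    by have := fE e; rewrite /f /c in he *; nia.
  have := @diag_pos L (e%:Z - 1 - cmax) hL.
  rewrite (_ : e%:Z - 1 - cmax + 1 = e%:Z - cmax); last by ring.
  by have := fE e; rewrite /f /c in he *; nia.
rewrite telescope_sumr // (eq_bigr (fun e => - (f e.+1 - f e))); last by move=> e _; ring.
rewrite sumrN telescope_sumr; last by rewrite /c; lia.
have -> : f 0%N = 0 by rewrite /f diag_far //; lia.
have -> : f W.+1 = 0 by rewrite /f diag_far //; lia.
have -> : f c.+1 = (diag L 0)%:Z by rewrite -fE /c gez0_abs // subrr.
ring.
Qed.

(* Additional order of vanishing when the labels of [S] are far above the others. *)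
Definition cross (S : {set I}) : int :=
  \sum_(k in ~: S) \sum_(l in S) - beta (d k - d l) + \sum_(l in S) (d l == 0)%:Z.

Lemma pairingD S : pairing [set: I] [set: I] = pairing S S + pairing (~: S) (~: S) + 2 * pairing (~: S) S.
Proof.
have spl (F : I -> int) : \sum_(k in [set: I]) F k = \sum_(k in S) F k + \sum_(k in ~: S) F k.
  by rewrite (big_setID S) /=; congr (_ + _); apply: eq_bigl => k; rewrite !inE ?andbT.
have sym : pairing S (~: S) = pairing (~: S) S.
  rewrite /pairing exchange_big /=; apply: eq_bigr => k _; apply: eq_bigr => l _.
  by rewrite /beta; lia.
rewrite {1}/pairing spl.
under eq_bigr do rewrite spl.
under [Z in _ + Z]eq_bigr do rewrite spl.
by rewrite !big_split /= -!/(pairing _ _) sym; ring.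
Qed.

(** Expanding the form on the whole shape and using [pairing_lower] for it and for the complement
    gives [2 * cross S = pairing S S]. This sum of squares vanishes only if all diagonals of [S]
    have equal length, hence are empty. *)
Lemma cross_ge S : upper S -> ((S != set0)%:Z <= cross S).
Proof.
move=> hS; have hL := upper_lower hS.
have h := pairingD S; rewrite (pairing_lower lowerT) (pairing_lower hL) in h.
have hD := diagD S 0.
have e1 : cross S = - pairing (~: S) S + (diag S 0)%:Z.
  rewrite /cross diagE /pairing -sumrN; congr (_ + _).
  by apply: eq_bigr => k _; rewrite sumrN.
have e2 : 2 * cross S = pairing S S by rewrite e1; lia.
have [W hW eW] := pairing_sq S; rewrite eW in e2.
have p0 : 0 <= 2 * cross S by rewrite e2; apply: sumr_ge0 => e _; apply: sqr_ge0.
have [_|/set0Pn[k kS]] := eqVneq S set0; first by rewrite /=; lia.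
suff : 0 < 2 * cross S by lia.
rewrite lt_def p0 andbT e2 psumr_eq0; last by move=> e _; apply: sqr_ge0.
apply/negP => /allP hz.
have hz' (e : nat) : (e < W.+1)%N -> diag S (e%:Z - 1 - cmax) = diag S (e%:Z - cmax).
  move=> he; have := hz (Ordinal he); rewrite mem_index_enum => /(_ isT).
  by rewrite /= sqrf_eq0 subr_eq0 => /eqP[].
have z0 (e : nat) : (e <= W.+1)%N -> diag S (e%:Z - 1 - cmax) = 0%N.
  elim: e => [|e IH] he; first by apply: diag_far; have : 0 <= cmax by [apply: sumr_ge0]; lia.
  by rewrite (_ : e.+1%:Z - 1 - cmax = e%:Z - cmax) -?hz' ?IH; lia.
have hk := le_cmax k; have : diag S (d k) = 0%N.
  have := z0 `|(d k + 1 + cmax)%R|%N; rewrite (_ : `|(d k + 1 + cmax)%R|%N%:Z - 1 - cmax = d k); last by lia.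
  by apply; lia.
by move=> /eqP; rewrite cards_eq0 => /eqP/setP/(_ k); rewrite !inE kS eqxx.
Qed.

(** These are the labels of the zero submodule. The cells in smaller rows on three neighbouring
    diagonals are counted, and the counts cancel for each [k] separately. *)
Lemma dg_lam0 : let lam := [ffun k => - (a%:Z * x k)] in
  dg [set: I] d a lam + \sum_k ((d k == 0) && (lam k < 0))%:Z = 0.
Proof.
move=> lam; rewrite dgT -big_split big1 //= => k _.
transitivity (\sum_l (- ((d l == d k) && (x l < x k))%:Z - ((d l == d k) && (x l < x k - 1))%:Z
   + ((d l == d k - 1) && (x l < x k - 1))%:Z + ((d l == d k + 1) && (x l < x k))%:Z)
   + ((d k == 0) && (0 < x k))%:Z : int).
  congr (_ + _); last by rewrite /lam ffunE oppr_lt0 pmulr_rgt0.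
  apply: eq_bigr => l _; rewrite /lam !ffunE /pd.
  have -> : (- (a%:Z * x k) - - (a%:Z * x l) < 0) = (x l < x k).
    by rewrite opprK addrC subr_lt0 ltr_pM2l.
  have -> : (- (a%:Z * x k) - - (a%:Z * x l) < - a%:Z) = (x l < x k - 1).
    by rewrite -[RHS](ltr_pM2l (x := a%:Z)) // mulrBr mulr1; lia.
  by lia.
rewrite !big_split /= !sumrN.
have hx := x_ge0 k; have hy := y_ge0 k.
rewrite !count_below; first by lia.
all: move=> r hr.
- by have [||m [xm dm]] := @cell_below k r (r - (d k + 1)); [lia..|exists m; split=> //; lia].
- by have [||m [xm dm]] := @cell_below k r (r - (d k - 1)); [lia..|exists m; split=> //; lia].
- by have [||m [xm dm]] := @cell_below k r (r - d k); [lia..|exists m; split=> //; lia].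
- by have [||m [xm dm]] := @cell_below k r (r - d k); [lia..|exists m; split=> //; lia].
Qed.

End Cells.


(** * The weight of a configuration *)

Section Weights.
Variable K : fieldType.
Hypothesis K0 : forall n : nat, n.+1%:R != 0 :> K.
Variables (reg : K -> Prop) (u : K).
Hypothesis reg_int : forall z : int, reg z%:~R.
Hypothesis regV_int : forall z : int, reg (z%:~R)^-1.
Hypothesis regD : forall f g, reg f -> reg g -> reg (f + g).
Hypothesis regM : forall f g, reg f -> reg g -> reg (f * g).
Hypothesis regu : reg u.
Hypothesis reg_1uV : forall f, reg f -> 1 + u * f != 0 /\ reg (1 + u * f)^-1.
Hypothesis u0 : u != 0.
(* [s0], [s1], [s2] are the parameters s1, s2, s3 of the paper. *)
Variables s1 s2 : K.
(** The part free of [u] in a Chern class: a cell in row [i] with content [A] and label [B] has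
    class [i u + frm A B]. *)
Definition frm (A B : int) : K := - (A%:~R * s1 + B%:~R * s2).
Hypothesis frm_unt : forall A B, (A != 0) || (B != 0) -> unt reg (frm A B).

Variables (I : finType) (d x : I -> int) (a : nat).
Hypothesis a0 : (0 < a)%N.
Hypothesis dx_inj : forall k l, d k = d l -> x k = x l -> k = l.
Hypothesis x_ge0 : forall k, 0 <= x k.
Hypothesis y_ge0 : forall k, d k <= x k.
Hypothesis cell_up : forall k, 0 < x k -> exists m, x m = x k - 1 /\ d m = d k - 1.
Hypothesis cell_left : forall k, d k < x k -> exists m, x m = x k /\ d m = d k + 1.

Implicit Types (lam : {ffun I -> int}) (t : {perm I}) (S L : {set I}).

Lemma unt_shift v (c : int) : unt reg v -> v + c%:~R * u != 0.
Proof.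
case=> v0 rv rV; have [+ _] := reg_1uV (regM (reg_int c) rV).
have -> : 1 + u * (c%:~R / v) = (v + c%:~R * u) / v by field.
by apply: contraNneq => ->; rewrite mul0r.
Qed.

(* Vanishing factors are replaced by [1], which makes [Tp] multiplicative in [n]. *)
Definition e0 (w : K) := if w == 0 then 1 else w.
Lemma e0_neq0 w : e0 w != 0.
Proof. by rewrite /e0; case: (eqVneq w 0) => // _; apply: oner_neq0. Qed.

(** The contribution to [e(-V)] of the expansion of [t^w (t3^(-n) - 1) / (1 - t3)], where [z] is the
    Chern class of [t^w]. *)
Definition Tp (z : K) (n : int) : K := match n with
  | Posz n => \prod_(k < n) (e0 (z - k.+1%:R * s2))^-1
  | Negz n => \prod_(k < n.+1) e0 (z + k%:R * s2) end.

Lemma TpS z n : Tp z (n + 1) = Tp z n / e0 (z - (n + 1)%:~R * s2).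
Proof.
case: n => [n|[|n]] /=.
- by rewrite -PoszD addn1 /= big_ord_recr.
- rewrite big_ord0 big_ord1 (_ : z - _ = z + 0%:R * s2) ?divff ?e0_neq0 //.
  by rewrite (_ : Negz 0 + 1 = 0) //; ring.
have -> : Negz n.+1 + 1 = Negz n by lia.
rewrite [in RHS]big_ord_recr /=.
rewrite (_ : z - (Negz n)%:~R * s2 = z + n.+1%:R * s2); last by rewrite NegzE rmorphN; ring.
by rewrite mulfK ?e0_neq0 // subn1.
Qed.

Lemma Tp_add z n m : Tp z (n + m) = Tp z n * Tp (z - n%:~R * s2) m.
Proof.
elim/int_rec: m => [|m IH|m IH]; first by rewrite addr0 /= big_ord0 mulr1.
  rewrite -addn1 PoszD addrA !TpS IH -mulrA; congr (_ * (_ / e0 _)).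
  by rewrite !rmorphD /=; ring.
have h1 := TpS z (n - m.+1%:Z); rewrite (_ : _ + 1 = n - m%:Z) ?IH in h1; last by lia.
have h2 := TpS (z - n%:~R * s2) (- m.+1%:Z); rewrite (_ : _ + 1 = - m%:Z) in h2; last by lia.
apply: (mulIf (invr_neq0 (e0_neq0 (z - (n - m%:Z)%:~R * s2)))).
rewrite -h1 h2 -mulrA; congr (_ * (_ / e0 _)).
by rewrite !rmorphB /=; ring.
Qed.

(** The factors that are units at [u = 0]; the one left out, [frm 0 0], becomes the power of [u] in
    [Tp_split]. In [denv] nothing has to be left out as long as [0 <= B]. *)
Definition numv (A B n : int) : seq K := match n with
  | Posz _ => [::]
  | Negz n => [seq frm A (B - k%:Z) | k <- iota 0 n.+1 & (A != 0) || (B != k%:Z)] end.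
Definition denv (A B n : int) : seq K := match n with
  | Posz n => [seq frm A (B + k.+1%:Z) | k <- iota 0 n]
  | Negz _ => [::] end.
Definition NS (A B n c : int) : K :=
  \prod_(v <- numv A B n) (v + c%:~R * u) * \prod_(v <- denv A B n) (v + c%:~R * u)^-1.

Lemma numv_unt A B n : {in numv A B n, forall v, unt reg v}.
Proof.
case: n => n v; rewrite /numv ?in_nil // => /mapP[k]; rewrite mem_filter => /andP[h _] ->; apply: frm_unt; lia.
Qed.
Lemma denv_unt A B n : 0 <= B -> {in denv A B n, forall v, unt reg v}.
Proof. by case: n => n B0 v; rewrite /denv ?in_nil // => /mapP[k _ ->]; apply: frm_unt; lia. Qed.

Lemma e0_unt v (c : int) : unt reg v -> e0 (v + c%:~R * u) = v + c%:~R * u.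
Proof. by move=> h; rewrite /e0 (negbTE (unt_shift c h)). Qed.

(** A factor loses its unit part only for [A = 0] and [k = B], and this index occurs exactly when
    [B < - n]. *)
Lemma Tp_split (A B n c : int) : 0 <= B -> Tp (c%:~R * u + frm A B) n =
  (if (A == 0) && (B < - n) then e0 (c%:~R * u) else 1) * NS A B n c.
Proof.
move=> B0; have frmB (k : int) : c%:~R * u + frm A B + k%:~R * s2 = frm A (B - k) + c%:~R * u.
  by rewrite /frm rmorphB /=; ring.
case: n => n; rewrite /NS /Tp /numv /denv.
  rewrite (_ : (B < _) = false) ?andbF ?big_nil ?mul1r; last by lia.
  rewrite big_map -(big_mkord xpredT (fun k => (e0 (c%:~R * u + frm A B - k.+1%:R * s2))^-1)).
  rewrite /index_iota subn0; apply: eq_bigr => k _.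
  have := frmB (- k.+1%:Z); rewrite rmorphN mulNr /= opprK => ->.
  by rewrite e0_unt //; apply: frm_unt; lia.
rewrite big_nil mulr1 big_map big_filter -(big_mkord xpredT (fun k => e0 (c%:~R * u + frm A B + k%:R * s2))).
rewrite /index_iota subn0 (bigID (fun k : nat => (A != 0) || (B != k%:Z))) /= mulrC; congr (_ * _); last first.
  apply: eq_bigr => k hk; rewrite -[k%:R]/(k%:Z%:~R) frmB e0_unt //.
  by apply: frm_unt; lia.
have -> : - Negz n = n.+1%:Z by [].
have frm0 : frm 0 0 = 0 by rewrite /frm !mul0r addr0 oppr0.
rewrite -[0%N :: iota 1 n]/(iota 0 n.+1).
case: ifP => h; last by rewrite big_seq_cond big1 // => k; rewrite mem_iota; lia.
rewrite big_mkcond (bigD1_seq `|B|%N) ?iota_uniq ?mem_iota //=; last by lia.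
rewrite big1 => [|k hk]; last by case: ifP => //; lia.
rewrite mulr1 (_ : (A != 0) || _ = false) /=; last by lia.
rewrite -[`|B|%N%:R]/(`|B|%N%:Z%:~R) frmB (_ : A = 0); last by lia.
by rewrite (_ : B - _ = 0) ?frm0 ?add0r //; lia.
Qed.

(* [u ^ dgf] is the order of the weight [e(-V)] at [u = 0], [wt * IJ] its leading
   coefficient ([IJ] comes from the terms of [V] linear in the heights), and [R0]
   the unit that remains. *)
Definition dgf lam : int := dg [set: I] d a lam +
  \sum_k (((d k == 0) && (lam k < 0))%:Z + ((d k == 0) && (a%:Z < lam k))%:Z).
Definition IJ lam t : K := \prod_k ((if (d k == 0) && (lam k < 0) then (X x t k)%:~R else 1) *
  (if (d k == 0) && (a%:Z < lam k) then (- X x t k - 1)%:~R else 1)).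
Definition NSp (dd delta i : int) : K :=
  (NS dd 0 delta i)^-1 * (NS dd a delta (i - 1))^-1 * NS (dd - 1) a delta (i - 1) * NS (dd + 1) 0 delta i.
Definition NS1 (dd l i : int) : K := NS dd 0 l i * NS (- dd) a (- l) (- i - 1).
Definition R0 lam t : K := \prod_k \prod_l NSp (d k - d l) (lam k - lam l) (X x t k - X x t l)
  * \prod_k NS1 (d k) (lam k) (X x t k).
Definition Tpp (dd delta i : int) : K :=
  (Tp (i%:~R * u + frm dd 0) delta)^-1 * (Tp ((i - 1)%:~R * u + frm dd a) delta)^-1 *
  Tp ((i - 1)%:~R * u + frm (dd - 1) a) delta * Tp (i%:~R * u + frm (dd + 1) 0) delta.
Definition Tp1 (dd l i : int) : K :=
  Tp (i%:~R * u + frm dd 0) l * Tp ((- i - 1)%:~R * u + frm (- dd) a) (- l).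
(** The ratio of [e(-V)] at the heights [lam + a * row] and at the formal heights [a * row], see
    [Vprod_split]. *)
Definition Efull lam t : K := \prod_k \prod_l Tpp (d k - d l) (lam k - lam l) (X x t k - X x t l)
  * \prod_k Tp1 (d k) (lam k) (X x t k).

Lemma e0_pow (b : bool) (c : int) : (b -> c != 0) ->
  (if b then e0 (c%:~R * u) else 1) = u ^+ b * (if b then c%:~R else 1).
Proof.
case: b => [/(_ isT) c0|_]; last by rewrite expr0 mul1r.
by rewrite /e0 mulf_eq0 (intr_char0 K0) (negbTE c0) (negbTE u0) expr1 mulrC.
Qed.

Lemma Tpp_split (dd delta i : int) :
  (dd = 0 -> delta < 0 -> i != 0) -> (dd = 0 -> delta < - a%:Z -> i != 1) ->
  (dd = 1 -> delta < - a%:Z -> i != 1) -> (dd = -1 -> delta < 0 -> i != 0) ->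
  Tpp dd delta i = u ^ pd a dd delta * pf K a dd delta i * NSp dd delta i.
Proof.
move=> h1 h2 h3 h4; rewrite /Tpp !Tp_split //.
have -> : (0 < - delta) = (delta < 0) by lia.
have -> : (a%:Z < - delta) = (delta < - a%:Z) by lia.
have -> : (dd - 1 == 0) = (dd == 1) by lia.
have -> : (dd + 1 == 0) = (dd == -1) by lia.
rewrite !e0_pow; [|by case/andP=> /eqP e q; have := h4 e q; lia|by case/andP=> /eqP e q; have := h3 e q; lia
  |by case/andP=> /eqP e q; have := h2 e q; lia|by case/andP=> /eqP e q; have := h1 e q; lia].
have inv1 (b : bool) (c : K) : (if b then c^-1 else 1) = (if b then c else 1)^-1.
  by case: b => //; rewrite invr1.
rewrite /pf !inv1 /NSp !invfM.
have -> : u ^ pd a dd delta = (u ^+ ((dd == 0) && (delta < 0)))^-1 * (u ^+ ((dd == 0) && (delta < - a%:Z)))^-1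
   * u ^+ ((dd == 1) && (delta < - a%:Z)) * u ^+ ((dd == -1) && (delta < 0)).
  by rewrite /pd !expfzDr // -!exprnN.
by do 4!move: (if _ then _ else _) => ?; ring.
Qed.

Lemma Tp1_split (dd l i : int) : (dd = 0 -> l < 0 -> i != 0) -> (dd = 0 -> a%:Z < l -> i != -1) ->
  Tp1 dd l i = u ^ (((dd == 0) && (l < 0))%:Z + ((dd == 0) && (a%:Z < l))%:Z) *
   ((if (dd == 0) && (l < 0) then i%:~R else 1) *
    (if (dd == 0) && (a%:Z < l) then (- i - 1)%:~R else 1)) * NS1 dd l i.
Proof.
move=> h1 h2; rewrite /Tp1 !Tp_split //.
have -> : (0 < - l) = (l < 0) by lia.
have -> : (a%:Z < - - l) = (a%:Z < l) by lia.
have -> : (- dd == 0) = (dd == 0) by lia.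
rewrite !e0_pow; [|by case/andP=> /eqP e q; have := h2 e q; lia|by case/andP=> /eqP e q; have := h1 e q; lia].
rewrite /NS1 !expfzDr //.
by do 2!move: (if _ then _ else _) => ?; rewrite -!exprnP; ring.
Qed.

Lemma expz_sum (J : Type) (r : seq J) (F : J -> int) :
  \prod_(j <- r) u ^ F j = u ^ (\sum_(j <- r) F j).
Proof. by rewrite (big_morph (fun z => u ^ z) (id1 := 1) (op1 := *%R) (fun p q => expfzDr p q u0) (expr0z u)). Qed.

Lemma cells_convex k l : k \in [set: I] -> l \in [set: I] -> d k = d l -> x l = x k + 1 ->
  (exists2 m, m \in [set: I] & d m = d k + 1 /\ x m = x k + 1) /\
  (exists2 m, m \in [set: I] & d m = d k - 1 /\ x m = x k).
Proof.
move=> _ _ dkl xl.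
have [m1 [xm1 dm1]] : exists m, x m = x l /\ d m = d l + 1.
  by apply: cell_left; have := y_ge0 k; lia.
have [m2 [xm2 dm2]] : exists m, x m = x l - 1 /\ d m = d l - 1.
  by apply: cell_up; have := x_ge0 k; lia.
by split; [exists m1|exists m2]; rewrite ?inE //; lia.
Qed.

Let prod3 (F G H : I -> K) : \prod_k (F k * G k * H k) = \prod_k F k * \prod_k G k * \prod_k H k.
Proof. by rewrite !big_split. Qed.
Let prod33 (F G H : I -> I -> K) : \prod_k \prod_l (F k l * G k l * H k l) =
  \prod_k \prod_l F k l * \prod_k \prod_l G k l * \prod_k \prod_l H k l.
Proof. by rewrite -prod3; apply: eq_bigr => k _; rewrite prod3. Qed.

(** Because [e0] hides zeros, each integer split off must be shown nonzero. Distinctness of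
    positions, the monotone heights and the sign of the label at the corner provide this. *)
Lemma Efull_split lam t : good [set: I] d t -> okp [set: I] d x a lam t ->
  (forall k, d k = 0 -> X x t k = 0 -> 0 <= lam k) ->
  Efull lam t = u ^ dgf lam * (wt K [set: I] d x a lam t * IJ lam t) * R0 lam t.
Proof.
move=> gt /okP ok h0.
have kT k : k \in [set: I] by rewrite inE.
have Xp k : 0 <= X x t k by apply: x_ge0.
rewrite /Efull (eq_bigr (fun k => \prod_l (u ^ pd a (d k - d l) (lam k - lam l) *
   pf K a (d k - d l) (lam k - lam l) (X x t k - X x t l) *
   NSp (d k - d l) (lam k - lam l) (X x t k - X x t l)))); last first.
  move=> k _; apply: eq_bigr => l _; apply: Tpp_split => dd dl.
  - have dkl : d k = d l by lia.
    apply/eqP => e; have Xkl : X x t k = X x t l by lia.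
    by move: dl; rewrite (X_inj dx_inj gt dkl Xkl); lia.
  (* For neighbours on a diagonal, a corner of their square links the two heights and bounds the
     drop of the label by [a]. *)
  - have dkl : d l = d k by lia.
    apply/eqP => e; have Xkl : X x t k = X x t l + 1 by lia.
    have [[m _ [dm xm]] _] := X_convex cells_convex gt (kT l) (kT k) dkl Xkl.
    have [_ o1] := ok l m (kT _) (kT _); have [o2 _] := ok m k (kT _) (kT _).
    by have := o1 dm xm; have := o2 _ _; rewrite -?dkl ?dm ?Xkl ?xm; lia.
  - apply/eqP => e; have [_ o1] := ok l k (kT _) (kT _); have := o1 _ _; lia.
  - apply/eqP => e; have [o1 _] := ok l k (kT _) (kT _); have := o1 _ _; lia.
rewrite [Z in _ * Z](eq_bigr (fun k => u ^ (((d k == 0) && (lam k < 0))%:Z + ((d k == 0) && (a%:Z < lam k))%:Z) *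
   ((if (d k == 0) && (lam k < 0) then (X x t k)%:~R else 1) *
    (if (d k == 0) && (a%:Z < lam k) then (- X x t k - 1)%:~R else 1)) * NS1 (d k) (lam k) (X x t k))); last first.
  move=> k _; apply: Tp1_split => dk lk; last by have := Xp k; lia.
  by apply/eqP => e; have := h0 k dk e; lia.
rewrite (prod3 (fun k => u ^ _)) (prod33 (fun k l => u ^ _)) expz_sum.
under [\prod_k \prod_l u ^ _]eq_bigr do rewrite expz_sum.
rewrite expz_sum /dgf expfzDr // /R0 /IJ.
rewrite wtT dgT; ring.
Qed.

(** * Expansion of the unit factor *)

Section Expansion.
Variables (S : {set I}) (lam : {ffun I -> int}) (M : nat).
Local Notation ex := (expn reg u (dsh d S) x lam M).
Local Notation ty k := (typ (dsh d S) lam k).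

Let exM f g : ex f -> ex g -> ex (fun t => f t * g t).
Proof. exact: (expnM reg_int regD regM regu a0). Qed.

Lemma expn_NSpair (A n : int * int -> int * int -> int) (B c : int) : 0 <= B ->
  ex (fun t => \prod_k \prod_l NS (A (ty k) (ty l)) B (n (ty k) (ty l)) (X x t k - X x t l + c)) /\
  ex (fun t => \prod_k \prod_l (NS (A (ty k) (ty l)) B (n (ty k) (ty l)) (X x t k - X x t l + c))^-1).
Proof.
move=> B0.
have [n1 n2] := @expn_pair K K0 reg u reg_int regD regM regu reg_1uV I (dsh d S) x lam a a0 M
  (fun T T' => numv (A T T') B (n T T')) c (fun T T' => @numv_unt _ _ _).
have [d1 d2] := @expn_pair K K0 reg u reg_int regD regM regu reg_1uV I (dsh d S) x lam a a0 M
  (fun T T' => denv (A T T') B (n T T')) c (fun T T' => @denv_unt _ _ _ B0).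
split; [apply: expn_ext (exM n1 d2)|apply: expn_ext (exM n2 d1)] => t.
  by rewrite -big_split; apply: eq_bigr => k _; rewrite -big_split; apply: eq_bigr.
rewrite -big_split; apply: eq_bigr => k _; rewrite -big_split; apply: eq_bigr => l _ /=.
by rewrite /NS invfM !prodfV invrK.
Qed.

Lemma expn_NSsingle (A n : int * int -> int) (B al c : int) : 0 <= B ->
  ex (fun t => \prod_k NS (A (ty k)) B (n (ty k)) (al * X x t k + c)).
Proof.
move=> B0.
have [n1 _] := @expn_single K K0 reg u reg_int regD regM regu reg_1uV I (dsh d S) x lam a a0 M
  (fun T => numv (A T) B (n T)) al c (fun T => @numv_unt _ _ _).
have [_ d2] := @expn_single K K0 reg u reg_int regD regM regu reg_1uV I (dsh d S) x lam a a0 M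
  (fun T => denv (A T) B (n T)) al c (fun T => @denv_unt _ _ _ B0).
by apply: expn_ext (exM n1 d2) => t; rewrite -big_split; apply: eq_bigr.
Qed.

Lemma R0_expn : ex (R0 lam).
Proof.
pose A c (T T' : int * int) := undo d T.1 - undo d T'.1 + c.
pose n (T T' : int * int) := T.2 - T'.2.
have [_ h1] := @expn_NSpair (A 0) n 0 0 (lexx _).
have [_ h2] := @expn_NSpair (A 0) n a (-1) isT.
have [h3 _] := @expn_NSpair (A (-1)) n a (-1) isT.
have [h4 _] := @expn_NSpair (A 1) n 0 0 (lexx _).
have h5 := @expn_NSsingle (fun T => undo d T.1) (fun T => T.2) 0 1 0 (lexx _).
have h6 := @expn_NSsingle (fun T => - undo d T.1) (fun T => - T.2) a (-1) (-1) isT.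
apply: expn_ext (exM (exM (exM (exM h1 h2) h3) h4) (exM h5 h6)) => t.
rewrite /R0; congr (_ * _); rewrite -!big_split; apply: eq_bigr => k _ /=; last first.
  by rewrite /NS1 /typ undo_dsh mul1r addr0 mulN1r.
rewrite -!big_split; apply: eq_bigr => l _ /=.
by rewrite /NSp /A /n /typ !undo_dsh !addr0.
Qed.
End Expansion.

Lemma coef_top_prod (J : Type) (r : seq J) (y : J -> K) :
  (\prod_(j <- r) (1 + (y j)%:P * 'X))`_(size r) = \prod_(j <- r) y j.
Proof.
suff : (\prod_(j <- r) (1 + (y j)%:P * 'X))`_(size r) = \prod_(j <- r) y j /\
   forall m, (size r < m)%N -> (\prod_(j <- r) (1 + (y j)%:P * 'X))`_m = 0 by case.
elim: r => [|j r [IH1 IH2]].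
  by rewrite !big_nil coef1 /=; split=> // m; rewrite coef1; case: m.
have E m : (\prod_(i <- j :: r) (1 + (y i)%:P * 'X))`_m.+1 =
   (\prod_(i <- r) (1 + (y i)%:P * 'X))`_m.+1 + y j * (\prod_(i <- r) (1 + (y i)%:P * 'X))`_m.
  by rewrite big_cons mulrDl mul1r coefD -mulrA coefCM coefXM.
split; first by rewrite E IH1 IH2 // add0r big_cons.
by case=> // m hm; rewrite E !IH2 ?mulr0 ?addr0 // ltnW.
Qed.

Lemma sum_nat_card (P : pred I) : \sum_k (P k)%:Z = #|P|%:Z :> int.
Proof.
rewrite -sum1_card -[RHS]natz natr_sum [RHS]big_mkcond /=.
by apply: eq_bigr => k _; rewrite unfold_in; case: (P k).
Qed.

(** A product over the cells of certain types is a top elementary symmetric polynomial, of degree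
    the number of its factors. *)
Lemma PS_prodlin S lam (P : int * int -> bool) (al c : int) :
  PS [set: I] (dsh d S) x lam #|[pred k | P (typ (dsh d S) lam k)]|
    (fun t => \prod_k (if P (typ (dsh d S) lam k) then (al * X x t k + c)%:~R else 1) : K).
Proof.
pose r := [seq k <- index_enum I | P (typ (dsh d S) lam k)].
have hy n : PS [set: I] (dsh d S) x lam n (fun t => \sum_(k <- r) (al * X x t k + c)%:~R ^+ n : K).
  apply: PSext (PS_single K0 (dsh d S) x lam a0 (fun T => (P T)%:R) al c n) => t.
  rewrite /r big_filter [RHS]big_mkcond /=; apply: eq_bigr => k _.
  by case: (P _); rewrite ?mul1r ?mul0r.
have := PSp_prod K0 a0 hy #|[pred k | P (typ (dsh d S) lam k)]|.
apply: PSext => t; have -> : #|[pred k | P (typ (dsh d S) lam k)]| = size r.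
  by rewrite /r cardE /enum_mem; congr size; apply: eq_filter => k; rewrite !inE.
by rewrite coef_top_prod /r big_filter big_mkcond.
Qed.

(** * Cancellation for fixed labels with a gap *)

Section ClassSum.
Variables (S : {set I}) (lam : {ffun I -> int}).
Hypothesis gapS : forall k l, k \in S -> l \notin S -> lam l + a%:Z < lam k.
Hypothesis highS : forall k, k \in S -> a%:Z < lam k.

Lemma good_dsh t : good [set: I] (dsh d S) t ->
  (forall k, (t k \in S) = (k \in S)) /\ good [set: I] d t.
Proof.
move=> gt; have e k : (dsh d S (t k) == dsh d S k) by rewrite (goodd k gt).
split=> [k|]; first by have := e k; rewrite dsh_eq // => /andP[_ /eqP].
apply/andP; split; first by case/andP: gt.
by apply/forallP => k; have := e k; rewrite dsh_eq // => /andP[].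
Qed.

(** Across the gap the condition on heights holds automatically in one direction and fails in the
    other. It thus only says that the cells of [S], which [t] preserves, form an upper set. *)
Lemma okp_dsh t : good [set: I] (dsh d S) t ->
  okp [set: I] d x a lam t = upper d x S && okp [set: I] (dsh d S) x a lam t.
Proof.
move=> gt; have [tS gd] := good_dsh gt.
apply/okP/andP => [h|[/upperP hU /okP h] k l kT lT].
  split; last first.
    apply/okP => k l kT lT; have [h1 h2] := h k l kT lT.
    have near (e : int) : `|e| <= 1 -> dsh d S l = dsh d S k + e -> d l = d k + e.
      move=> he el; have n : (l \in S) = (k \in S) by apply: (@dsh_near I d S); rewrite el; lia.
      by have := dsh_sub d n; rewrite el; lia.
    by split=> e1 e2; [apply: h1|apply: h2] => //; apply: near.
  apply/upperP => k m kS hm; apply/negPn/negP => mS.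
  have kS' : t^-1%g k \in S by rewrite -tS permKV.
  have mS' : t^-1%g m \notin S by rewrite -tS permKV.
  have := gapS kS' mS'; have [h1 h2] := h (t^-1%g k) (t^-1%g m) (in_setT _) (in_setT _).
  have dV j : d (t^-1%g j) = d j by rewrite -(goodd (t^-1%g j) gd) permKV.
  move: h1 h2; rewrite /X !permKV !dV.
  by case: hm => -[-> ->] h1 h2; [have := h2 erefl erefl|have := h1 erefl erefl]; lia.
have near : (d l = d k - 1 /\ X x t l = X x t k) \/ (d l = d k + 1 /\ X x t l = X x t k + 1) ->
    (k \in S) = (l \in S) \/ (k \notin S /\ l \in S).
  case kS: (k \in S); case lS: (l \in S); [by left| |by right|by left].
  move=> hkl; have : t l \in S.
    apply: (hU (t k)); first by rewrite tS.
    by rewrite !(goodd _ gd) /X in hkl *; case: hkl => -[? ?]; [right|left].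
  by rewrite tS lS.
have [h1 h2] := h k l kT lT; split=> e1 e2.
  case: near => [|kl|[kS lS]]; [by left| |by have := gapS lS kS; lia].
  by apply: h1 => //; rewrite /dsh kl e1; ring.
case: near => [|kl|[kS lS]]; [by right| |by have := gapS lS kS; lia].
by apply: h2 => //; rewrite /dsh kl e1; ring.
Qed.

Let far k l := (k \notin S) && (l \in S).
(** The value [- a - 1] stands for any difference across the gap, since all comparisons in [pf] come
    out the same. *)
Let kap t : K := \prod_k \prod_l (if far k l then pf K a (d k - d l) (- a%:Z - 1) (X x t k - X x t l) else 1).
Let kapJ t : K := \prod_k (if (d k == 0) && (k \in S) then (- X x t k - 1)%:~R else 1).
Let P1 (T : int * int) := (undo d T.1 == 0) && (T.2 < 0).
(** Tested on the shifted content: this excludes the cells of [S], whose factors are collected in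
    [kapJ]. *)
Let P2 (T : int * int) := (T.1 == 0) && (a%:Z < T.2).
Local Notation ty k := (typ (dsh d S) lam k).
Let IJL t : K := \prod_k (if P1 (ty k) then (1 * X x t k + 0)%:~R else 1) *
  \prod_k (if P2 (ty k) then (-1 * X x t k + -1)%:~R else 1).
Let cL : nat := (#|[pred k | P1 (ty k)]| + #|[pred k | P2 (ty k)]|)%N.

Let dsh_far k l : (k \in S) != (l \in S) -> 2 < `|dsh d S k - dsh d S l|.
Proof.
by move=> h; rewrite ltNge; apply/negP => /dsh_near e; rewrite e eqxx in h.
Qed.

Let P2E k : P2 (ty k) = (k \notin S) && (d k == 0) && (a%:Z < lam k).
Proof.
rewrite /P2 /typ /dsh /gapw /=; have : 0 <= cmax d by apply: sumr_ge0.
have := le_cmax d k; case: (k \in S) => /=; lia.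
Qed.

(** The product depends only on the positions filled by [S] and by its complement, and [t] preserves
    both. *)
Lemma kap_cst t : good [set: I] (dsh d S) t -> kap t = kap 1%g.
Proof.
move=> gt; have [tS gd] := good_dsh gt.
rewrite [RHS](reindex_inj (@perm_inj _ t)); apply: eq_bigr => k _.
rewrite [RHS](reindex_inj (@perm_inj _ t)); apply: eq_bigr => l _.
by rewrite /far !tS !(goodd _ gd) /X !perm1.
Qed.

Lemma kapJ_cst t : good [set: I] (dsh d S) t -> kapJ t = kapJ 1%g.
Proof.
move=> gt; have [tS gd] := good_dsh gt.
rewrite [RHS](reindex_inj (@perm_inj _ t)); apply: eq_bigr => k _.
by rewrite tS (goodd _ gd) /X !perm1.
Qed.

Let pf_far (dd dl i : int) : 2 < `|dd| -> pf K a dd dl i = 1.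
Proof.
move=> h; rewrite /pf; have -> : (dd == 0) = false by lia.
have -> : (dd == 1) = false by lia.
have -> : (dd == -1) = false by lia.
by rewrite !mulr1.
Qed.

Let pd_far (dd dl : int) : 2 < `|dd| -> pd a dd dl = 0.
Proof.
move=> h; rewrite /pd; have -> : (dd == 0) = false by lia.
have -> : (dd == 1) = false by lia.
by have -> : (dd == -1) = false by lia.
Qed.

Lemma wt_kap t : wt K [set: I] d x a lam t = kap t * wt K [set: I] (dsh d S) x a lam t.
Proof.
rewrite !wtT /kap -big_split; apply: eq_bigr => k _; rewrite -big_split; apply: eq_bigr => l _ /=.
rewrite /far; case kS: (k \in S); case lS: (l \in S) => /=; rewrite ?mul1r.
- by rewrite dsh_sub ?kS ?lS.
- rewrite [RHS]pf_far; last by apply: dsh_far; rewrite kS lS.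
  have := gapS kS (negbT lS) => g.
  rewrite /pf; have -> : (lam k - lam l < 0) = false by lia.
  have -> : (lam k - lam l < - a%:Z) = false by lia.
  by rewrite !andbF !mulr1.
- rewrite [X in _ = _ * X]pf_far ?mulr1; last by apply: dsh_far; rewrite kS lS.
  have := gapS lS (negbT kS) => g.
  rewrite /pf; have -> : (lam k - lam l < 0) = true by lia.
  have -> : (lam k - lam l < - a%:Z) = true by lia.
  have -> : (- a%:Z - 1 < 0) = true by lia.
  by have -> : (- a%:Z - 1 < - a%:Z) = true by lia.
- by rewrite dsh_sub ?kS ?lS.
Qed.

Lemma IJ_kap t : IJ lam t = kapJ t * IJL t.
Proof.
rewrite /IJ /kapJ /IJL -!big_split; apply: eq_bigr => k _ /=.
rewrite P2E /P1 /typ /= undo_dsh mul1r addr0 mulN1r.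
case kS: (k \in S) => /=; rewrite ?andbT ?andbF ?mulr1 ?mul1r //.
have hk := highS kS; have -> : (lam k < 0) = false by lia.
by rewrite hk andbF andbT mul1r mulr1.
Qed.

Lemma IJL_PS : PS [set: I] (dsh d S) x lam cL IJL.
Proof. by apply: PSmul (leqnn _) (PS_prodlin _ _ P1 1 0) (PS_prodlin _ _ P2 (-1) (-1)). Qed.

Lemma dg_dsh : dg [set: I] d a lam = dg [set: I] (dsh d S) a lam +
  \sum_k \sum_l (if far k l then - beta (d k - d l) else 0).
Proof.
rewrite !dgT -big_split; apply: eq_bigr => k _; rewrite -big_split; apply: eq_bigr => l _ /=.
rewrite /far; case kS: (k \in S); case lS: (l \in S) => /=; rewrite ?addr0.
- by rewrite dsh_sub ?kS ?lS.
- rewrite [RHS]pd_far; last by apply: dsh_far; rewrite kS lS.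
  have := gapS kS (negbT lS) => g; rewrite /pd.
  have -> : (lam k - lam l < 0) = false by lia.
  have -> : (lam k - lam l < - a%:Z) = false by lia.
  by rewrite !andbF.
- rewrite [X in _ = X + _]pd_far ?add0r; last by apply: dsh_far; rewrite kS lS.
  have := gapS lS (negbT kS) => g; rewrite /pd.
  have -> : (lam k - lam l < 0) = true by lia.
  have -> : (lam k - lam l < - a%:Z) = true by lia.
  by rewrite !andbT /beta; move: (_ == 0) (_ == 1) (_ == -1) => b1 b2 b3; lia.
- by rewrite dsh_sub ?kS ?lS.
Qed.

Lemma cross_sum : cross d S = \sum_k \sum_l (if far k l then - beta (d k - d l) else 0) +
  \sum_k ((d k == 0) && (k \in S))%:Z.
Proof.
rewrite /cross; congr (_ + _); rewrite big_mkcond; apply: eq_bigr => k _.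
  by rewrite inE /far; case: (k \notin S) => /=; [rewrite big_mkcond|rewrite big1].
by case: (k \in S); rewrite ?andbT ?andbF.
Qed.

Lemma linear_exponent : \sum_k (((d k == 0) && (lam k < 0))%:Z + ((d k == 0) && (a%:Z < lam k))%:Z) =
  cL%:Z + \sum_k ((d k == 0) && (k \in S))%:Z.
Proof.
rewrite /cL PoszD -!sum_nat_card -!big_split; apply: eq_bigr => k _ /=.
rewrite P2E /P1 /typ /= undo_dsh.
by have := @highS k; case: (k \in S) => [/(_ isT)|_] /=; lia.
Qed.

Lemma dgf_cross : dgf lam = dg [set: I] (dsh d S) a lam + cL%:Z + cross d S.
Proof. by rewrite /dgf dg_dsh linear_exponent cross_sum addrACA. Qed.

Lemma reg_pf dd dl i : reg (pf K a dd dl i).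
Proof. by rewrite /pf; do !apply: regM; case: ifP => _ //; apply: (reg_int 1). Qed.

Lemma reg_wt D t : reg (wt K [set: I] D x a lam t).
Proof.
by apply: (reg_prod reg_int regM) => k _; apply: (reg_prod reg_int regM) => l _; apply: reg_pf.
Qed.

Lemma reg_IJL t : reg (IJL t).
Proof.
by apply: regM; apply: (reg_prod reg_int regM) => k _; case: ifP => _ //; apply: (reg_int 1).
Qed.

(** For each power of [u] there is an alternative: either the degree bound is negative and [claimP]
    kills the coefficient, or the remaining exponent is at least [cross d S]. *)
Lemma class_sum (ch : {perm I} -> K) : (forall M, expn reg u (dsh d S) x lam M ch) ->
  exists2 r, reg r & \sum_(t | good [set: I] (dsh d S) t && okp [set: I] d x a lam t)
    u ^ dgf lam * (wt K [set: I] d x a lam t * IJ lam t) * R0 lam t * ch t = u ^+ (S != set0) * r.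
Proof.
move=> hch; case hU: (upper d x S); last first.
  exists 0; first exact: (reg_int 0).
  by rewrite mulr0 big1 // => t /andP[/okp_dsh ->]; rewrite hU.
(* Chosen so that [M + dgf lam] is positive; the remainder of the expansion then contributes a
   multiple of [u]. *)
pose M := `|dgf lam|.+1.
have [P [Pps Preg Peq]] : expn reg u (dsh d S) x lam M (fun t => R0 lam t * ch t).
  by apply: (expnM reg_int regD regM regu a0) => //; apply: R0_expn.
pose G t := good [set: I] (dsh d S) t && okp [set: I] (dsh d S) x a lam t.
pose w t := wt K [set: I] (dsh d S) x a lam t.
pose B := \max_t size (P t).
have hc := cross_ge dx_inj x_ge0 y_ge0 cell_up cell_left a0 hU.
have powN (z : int) : (S != set0)%:Z <= z -> exists2 r, reg r & u ^ z = u ^+ (S != set0) * r.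
  move=> hz; exists (u ^+ `|(z - (S != set0)%:Z)%R|%N); first exact: (regX reg_int regM).
  by rewrite -exprD [RHS]exprnP; congr (_ ^ _); lia.
have main m : exists2 r, reg r & \sum_(t | G t) w t * (IJL t * (P t)`_m) * u ^ (dgf lam + m%:Z) = u ^+ (S != set0) * r.
  rewrite -mulr_suml.
  have [neg|pos] := ltrP ((cL + m)%N%:Z + dg [set: I] (dsh d S) a lam) 0.
    exists 0; first exact: (reg_int 0).
    rewrite mulr0 (claimP K0 a0 (dshx_inj dx_inj (S := S)) (dsh_convex x_ge0 y_ge0 cell_up cell_left hU)
      (dsh_step dx_inj x_ge0 y_ge0 cell_up cell_left hU) _ neg) ?mul0r //.
    by apply: PSmul (leqnn _) IJL_PS (Pps m).
  have [|r hr ->] := powN (dgf lam + m%:Z).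
    by rewrite dgf_cross; move: hc pos; rewrite PoszD; lia.
  exists ((\sum_(t | G t) w t * (IJL t * (P t)`_m)) * r); last by ring.
  apply: regM => //; apply: (reg_sum reg_int regD) => t _.
  by apply: regM; [apply: reg_wt|apply: regM; [apply: reg_IJL|apply: Preg]].
have rem t : exists2 r, reg r & (R0 lam t * ch t - (P t).[u]) * u ^ dgf lam = u ^+ (S != set0) * r.
  have [r hr ->] := Peq t; have [|r' hr' e] := powN (M%:Z + dgf lam).
    by rewrite /M; case: (S != set0); lia.
  exists (r' * r); first exact: regM.
  by rewrite mulrA -e expfzDr // -exprnP; ring.
have Pu t : (P t).[u] = \sum_(m < B) (P t)`_m * u ^+ m.
  by apply: horner_coef_wide; apply: leq_bigmax.
have kreg t : reg (kap t * kapJ t).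
  apply: regM; apply: (reg_prod reg_int regM) => k _.
    by apply: (reg_prod reg_int regM) => l _; case: ifP => _; [apply: reg_pf|apply: (reg_int 1)].
  by case: ifP => _ //; apply: (reg_int 1).
have split : \sum_(t | good [set: I] (dsh d S) t && okp [set: I] d x a lam t)
    u ^ dgf lam * (wt K [set: I] d x a lam t * IJ lam t) * R0 lam t * ch t =
  kap 1%g * kapJ 1%g * (\sum_(m < B) (\sum_(t | G t) w t * (IJL t * (P t)`_m) * u ^ (dgf lam + m%:Z))
   + \sum_(t | G t) w t * IJL t * ((R0 lam t * ch t - (P t).[u]) * u ^ dgf lam)).
  set c := kap 1%g * kapJ 1%g; rewrite [Z in _ * (Z + _)]exchange_big -big_split mulr_sumr /=; apply: eq_big => t.
    by rewrite /G; case gt: (good _ _ t) => //=; rewrite okp_dsh ?hU.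
  case/andP=> gt _; rewrite wt_kap IJ_kap kap_cst // kapJ_cst // -/(w t).
  have -> : u ^ dgf lam * (kap 1%g * w t * (kapJ 1%g * IJL t)) = u ^ dgf lam * c * (w t * IJL t) by rewrite /c; ring.
  have -> : \sum_(m < B) w t * (IJL t * (P t)`_m) * u ^ (dgf lam + m%:Z) = w t * IJL t * u ^ dgf lam * (P t).[u].
    rewrite Pu mulr_sumr; apply: eq_bigr => m _; rewrite expfzDr // -exprnP; ring.
  ring.
have sumu (J : finType) (Q : pred J) (F : J -> K) : (forall j, exists2 r, reg r & F j = u ^+ (S != set0) * r) ->
    exists2 r, reg r & \sum_(j | Q j) F j = u ^+ (S != set0) * r.
  move=> h; elim/big_rec: _ => [|j z _ [r hr ->]]; first by exists 0; [exact: (reg_int 0)|rewrite mulr0].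
  by have [s hs ->] := h j; exists (s + r); [apply: regD|ring].
have [r1 h1 e1] := sumu _ xpredT _ (fun m : 'I_B => main m).
have [|r2 h2 e2] := sumu _ G (fun t => w t * IJL t * ((R0 lam t * ch t - (P t).[u]) * u ^ dgf lam)).
  move=> t; have [r hr ->] := rem t; exists (w t * IJL t * r); last by ring.
  by apply: regM => //; apply: regM; [apply: reg_wt|apply: reg_IJL].
exists (kap 1%g * kapJ 1%g * (r1 + r2)); first by apply: regM => //; apply: regD.
by rewrite split e1 e2; ring.
Qed.
End ClassSum.

(** * Units and the normalising constant *)

Lemma unt_int (z : int) : z != 0 -> unt reg z%:~R.
Proof. by move=> z0; split=> //; rewrite (intr_char0 K0). Qed.
Lemma untM f g : unt reg f -> unt reg g -> unt reg (f * g).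
Proof.
case=> f0 f1 f2 [g0 g1 g2]; split; [by rewrite mulf_neq0|exact: regM|].
by rewrite invfM; apply: regM.
Qed.
Lemma untV f : unt reg f -> unt reg f^-1.
Proof. by case=> f0 f1 f2; split; rewrite ?invr_eq0 ?invrK. Qed.
Lemma unt1 : unt reg 1. Proof. exact: (@unt_int 1). Qed.
Lemma unt_prod (J : eqType) (r : seq J) (F : J -> K) :
  {in r, forall j, unt reg (F j)} -> unt reg (\prod_(j <- r) F j).
Proof.
by rewrite big_seq => h; elim/big_rec: _ => [|j z jr hz]; [apply: unt1|apply: untM => //; apply: h].
Qed.
Lemma unt_addu v (c : int) : unt reg v -> unt reg (v + c%:~R * u).
Proof.
move=> hv; have [v0 rv rV] := hv; split; first exact: unt_shift.
  by apply: regD => //; apply: regM.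
have [n0 h] := reg_1uV (regM (reg_int c) rV).
have -> : v + c%:~R * u = v * (1 + u * (c%:~R / v)) by field.
by rewrite invfM; apply: regM.
Qed.
Lemma unt_NS A B n c : 0 <= B -> unt reg (NS A B n c).
Proof.
move=> B0; apply: untM; apply: unt_prod => v hv.
  by apply: unt_addu; apply: numv_unt hv.
by apply: untV; apply: unt_addu; apply: denv_unt hv.
Qed.
Lemma unt_R0 lam t : unt reg (R0 lam t).
Proof.
apply: untM; apply: unt_prod => k _; last by apply: untM; apply: unt_NS.
apply: unt_prod => l _; rewrite /NSp.
by apply: untM; [apply: untM; [apply: untM; apply: untV|]|]; apply: unt_NS.
Qed.

Definition lam0 : {ffun I -> int} := [ffun k => - (a%:Z * x k)].

Lemma dgf_lam0 : dgf lam0 = 0.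
Proof.
rewrite /dgf -[RHS](dg_lam0 dx_inj x_ge0 y_ge0 cell_up cell_left a0); congr (_ + _).
apply: eq_bigr => k _; rewrite !ffunE; have hx := x_ge0 k.
have -> : (a%:Z < - (a%:Z * x k)) = false by nia.
by rewrite andbF addr0.
Qed.

(* The part of the weight that does not depend on [Q] is found from [Q = 0],
   where [V] vanishes. *)
Lemma normalisation_reg C : C * Efull lam0 1%g = 1 -> reg C.
Proof.
have Xk k : X x 1%g k = x k by rewrite /X perm1.
rewrite Efull_split; last first.
- by move=> k _; rewrite Xk ffunE => ->; rewrite mulr0.
- by apply/okP => k l _ _; rewrite !Xk !ffunE; split=> [_ ->|_ ->]; lia.
- by apply/andP; split; [apply: perm_on1|apply/forallP => k; rewrite perm1].
rewrite dgf_lam0 expr0z mul1r => h.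
have [_ _ hR] := unt_R0 lam0 1%g.
set f := wt _ _ _ _ _ _ _ * _ in h; set r := R0 _ _ in h hR.
have f0 : f != 0 by apply: contra_eq_neq h => ->; rewrite mul0r mulr0 eq_sym oner_neq0.
have r0 : r != 0 by apply: contra_eq_neq h => ->; rewrite !mulr0 eq_sym oner_neq0.
have -> : C = f^-1 * r^-1.
  by apply: (mulIf (mulf_neq0 f0 r0)); rewrite h; field; rewrite f0 r0.
apply: regM => //; rewrite /f invfM; apply: regM.
  rewrite /wt -prodfV; apply: (reg_prod reg_int regM) => k _; rewrite -prodfV.
  apply: (reg_prod reg_int regM) => l _; rewrite /pf !invfM.
  by do !apply: regM; case: ifP => _; rewrite ?invrK ?invr1 //; apply: (reg_int 1).
rewrite /IJ -prodfV; apply: (reg_prod reg_int regM) => k _; rewrite invfM.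
by apply: regM; case: ifP => _; rewrite ?invr1 //; apply: (reg_int 1).
Qed.

(** * Averaging over relabellings *)

Definition rl (J : Type) (f : {ffun I -> J}) t : {ffun I -> J} := [ffun k => f (t k)].

Lemma rlE (J : Type) (f : {ffun I -> J}) t k : rl f t k = f (t k). Proof. exact: ffunE. Qed.

Section Relabelling.
Variables (lam : {ffun I -> int}) (t : {perm I}).
Hypothesis gt : good [set: I] d t.

Let pair (F : I -> I -> K) : \prod_k \prod_l F (t k) (t l) = \prod_k \prod_l F k l.
Proof.
rewrite [RHS](reindex_inj (@perm_inj _ t)); apply: eq_bigr => k _.
by rewrite [RHS](reindex_inj (@perm_inj _ t)).
Qed.

Lemma okp_rl : okp [set: I] d x a (rl lam t) t = okp [set: I] d x a lam 1.
Proof.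
rewrite -{2}[t]mulg1; apply: ok_relabel => [|j|j]; rewrite ?rlE //; first by case/andP: gt.
exact: goodd gt.
Qed.

Lemma wt_rl : wt K [set: I] d x a (rl lam t) t = wt K [set: I] d x a lam 1.
Proof.
rewrite !wtT -[RHS]pair; apply: eq_bigr => k _; apply: eq_bigr => l _.
by rewrite !rlE !(goodd _ gt) /X !perm1.
Qed.

Lemma IJ_rl : IJ (rl lam t) t = IJ lam 1.
Proof.
rewrite /IJ [RHS](reindex_inj (@perm_inj _ t)); apply: eq_bigr => k _.
by rewrite !rlE !(goodd _ gt) /X !perm1.
Qed.

Lemma R0_rl : R0 (rl lam t) t = R0 lam 1.
Proof.
rewrite /R0 -[Z in _ = Z * _]pair [Z in _ = _ * Z](reindex_inj (@perm_inj _ t)); congr (_ * _); apply: eq_bigr => k _.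
  by apply: eq_bigr => l _; rewrite !rlE !(goodd _ gt) /X !perm1.
by rewrite !rlE !(goodd _ gt) /X !perm1.
Qed.

Lemma dgf_rl : dgf (rl lam t) = dgf lam.
Proof.
rewrite /dgf !dgT; congr (_ + _); rewrite [RHS](reindex_inj (@perm_inj _ t)); apply: eq_bigr => k _.
  rewrite [RHS](reindex_inj (@perm_inj _ t)); apply: eq_bigr => l _.
  by rewrite !rlE !(goodd _ gt).
by rewrite !rlE !(goodd _ gt).
Qed.
End Relabelling.

Variable ch : {ffun I -> int} -> {perm I} -> K.
Hypothesis ch_expn : forall S lam M, expn reg u (dsh d S) x lam M (ch lam).
Hypothesis ch_rl : forall lam t, good [set: I] d t -> ch (rl lam t) t = ch lam 1.

Definition term lam t : K := u ^ dgf lam * (wt K [set: I] d x a lam t * IJ lam t) * R0 lam t * ch lam t.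

(** Moving the labels by [t] amounts to moving the positions, so the sum over labellings at the
    identity equals the sum at any [t] preserving contents and [S]. Averaging over these [t] gives
    the sums of [class_sum]; the bound [B] keeps the set of labellings finite. *)
Lemma window_sum (B : nat) (z : int) S (Q : pred {ffun I -> 'I_B}) :
  let lamv (v : {ffun I -> 'I_B}) : {ffun I -> int} := [ffun k => (v k)%:Z - z] in
  (forall v k l, Q v -> k \in S -> l \notin S -> lamv v l + a%:Z < lamv v k) ->
  (forall v k, Q v -> k \in S -> a%:Z < lamv v k) ->
  (forall v t, good [set: I] (dsh d S) t -> Q (rl v t) = Q v) ->
  exists2 r, reg r & \sum_(v | Q v && okp [set: I] d x a (lamv v) 1) term (lamv v) 1 = u ^+ (S != set0) * r.
Proof.
move=> lamv gap high Qrl.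
pose G := [set t | good [set: I] (dsh d S) t].
have G0 : #|G|%:Z != 0.
  have : 1%g \in G by rewrite inE; apply/andP; split; [apply: perm_on1|apply/forallP => k; rewrite perm1].
  by rewrite (cardD1 1%g) => ->.
have rlv v t : lamv (rl v t) = rl (lamv v) t by apply/ffunP => k; rewrite !ffunE.
have inv t : t \in G -> \sum_(v | Q v && okp [set: I] d x a (lamv v) 1) term (lamv v) 1 =
    \sum_(v | Q v && okp [set: I] d x a (lamv v) t) term (lamv v) t.
  rewrite inE => gt; have [_ gd] := good_dsh gt.
  have rlK : injective (fun v : {ffun I -> 'I_B} => rl v t).
    by move=> v w /ffunP e; apply/ffunP => k; have := e (t^-1%g k); rewrite !rlE permKV.
  rewrite [RHS](reindex_inj rlK) /=; apply: eq_big => v.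
    by rewrite rlv okp_rl // Qrl.
  by rewrite rlv /term wt_rl // IJ_rl // R0_rl // dgf_rl // ch_rl.
have sumE : #|G|%:~R * \sum_(v | Q v && okp [set: I] d x a (lamv v) 1) term (lamv v) 1 =
   \sum_(v | Q v) \sum_(t | good [set: I] (dsh d S) t && okp [set: I] d x a (lamv v) t) term (lamv v) t.
  rewrite -[LHS]/(#|G|%:R * _) mulr_natl -sumr_const (eq_bigr _ inv) (exchange_big_dep Q) /=; last first.
    by move=> t v _ /andP[].
  by apply: eq_bigr => v Qv; apply: eq_bigl => t; rewrite inE Qv.
have [r hr er] : exists2 r, reg r & \sum_(v | Q v) \sum_(t | good [set: I] (dsh d S) t &&
    okp [set: I] d x a (lamv v) t) term (lamv v) t = u ^+ (S != set0) * r.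
  elim/big_rec: _ => [|v z' Qv [r hr ->]]; first by exists 0; [exact: (reg_int 0)|rewrite mulr0].
  have [s hs es] := class_sum (fun k l => gap v k l Qv) (fun k => high v k Qv) (ch_expn S (lamv v)).
  exists (s + r); first exact: regD.
  by rewrite mulrDr -es.
exists (#|G|%:~R^-1 * r); first exact: regM.
by rewrite mulrCA -er -sumE mulKf // (intr_char0 K0).
Qed.

Variable s0 : K.
Hypothesis uE : u = s0 + s1 - a%:R * s2.

Definition fr2 (A B : int) : K := A%:~R * s0 + B%:~R * s1.
Local Notation T A B n := (Tp (fr2 A B) n).

(** Equal to [e(-V_Q)] for the heights of a submodule, but meaningful for arbitrary integer heights;
    this permits the reference heights [a * row]. *)
Definition Vprod (cx cy h : I -> int) : K :=
  \prod_k (T (cx k) (cy k) (h k) * T (- cx k - 1) (- cy k - 1) (- h k)) *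
  \prod_k \prod_l ((T (cx k - cx l) (cy k - cy l) (h k - h l))^-1 *
    ((T (cx k - cx l - 1) (cy k - cy l - 1) (h k - h l))^-1 *
    (T (cx k - cx l - 1) (cy k - cy l) (h k - h l) * T (cx k - cx l) (cy k - cy l - 1) (h k - h l)))).

Let y k := x k - d k.

(** [Tp] is multiplicative in its length. Splitting off the part [a * row] shifts the base point by
    a multiple of s3, which turns [fr2] into a multiple of [u] plus a form [frm]. *)
Lemma Vprod_split lam : Vprod x y (fun k => lam k + a%:Z * x k) =
  Vprod x y (fun k => a%:Z * x k) * Efull lam 1%g.
Proof.
have TA (A B n m C D : int) (c : int) : fr2 A B - n%:~R * s2 = c%:~R * u + frm C D ->
    T A B (m + n) = T A B n * Tp (c%:~R * u + frm C D) m.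
  by move=> <-; rewrite addrC Tp_add.
have an (n : int) : a%:R * n%:~R = (a%:Z * n)%:~R :> K by rewrite rmorphM.
rewrite /Vprod /Efull [Z in _ = _ * Z]mulrC [RHS]mulrACA; congr (_ * _); rewrite -[RHS]big_split.
  apply: eq_bigr => k _ /=; rewrite /Tp1 /X perm1.
  rewrite (TA _ _ (a%:Z * x k) (lam k) (d k) 0 (x k)); last first.
    by rewrite /fr2 /frm /y uE !(rmorphB, rmorphM, rmorphN) /=; ring.
  rewrite (opprD (lam k)) (TA _ _ (- (a%:Z * x k)) (- lam k) (- d k) a (- x k - 1)); last first.
    by rewrite /fr2 /frm /y uE !(rmorphB, rmorphM, rmorphN, rmorphD) /=; ring.
  by do 4!move: (Tp _ _) => ?; ring.
apply: eq_bigr => k _ /=; rewrite -[RHS]big_split; apply: eq_bigr => l _ /=.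
rewrite /Tpp /X !perm1.
have -> : lam k + a%:Z * x k - (lam l + a%:Z * x l) = (lam k - lam l) + a%:Z * (x k - x l) by ring.
have -> : a%:Z * x k - a%:Z * x l = a%:Z * (x k - x l) by ring.
rewrite (TA (x k - x l) (y k - y l) _ (lam k - lam l) (d k - d l) 0 (x k - x l)); last first.
  by rewrite /fr2 /frm /y uE !(rmorphB, rmorphM, rmorphN, rmorphD) /=; ring.
rewrite (TA (x k - x l - 1) (y k - y l - 1) _ (lam k - lam l) (d k - d l) a (x k - x l - 1)); last first.
  by rewrite /fr2 /frm /y uE !(rmorphB, rmorphM, rmorphN, rmorphD) /=; ring.
rewrite (TA (x k - x l - 1) (y k - y l) _ (lam k - lam l) (d k - d l - 1) a (x k - x l - 1)); last first.
  by rewrite /fr2 /frm /y uE !(rmorphB, rmorphM, rmorphN, rmorphD) /=; ring.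
rewrite (TA (x k - x l) (y k - y l - 1) _ (lam k - lam l) (d k - d l + 1) 0 (x k - x l)); last first.
  by rewrite /fr2 /frm /y uE !(rmorphB, rmorphM, rmorphN, rmorphD) /=; ring.
by rewrite !invfM; do 8!move: (Tp _ _) => ?; ring.
Qed.

Lemma Vprod0 (cx cy : I -> int) : Vprod cx cy (fun=> 0) = 1.
Proof.
have T0 A B : T A B 0 = 1 by rewrite /= big_ord0.
rewrite /Vprod !big1 ?mulr1 // => k _; last by rewrite oppr0 !T0 mulr1.
by rewrite big1 // => l _; rewrite subrr !T0 invr1 !mulr1.
Qed.

Lemma Vprod_reg : reg (Vprod x y (fun k => a%:Z * x k)).
Proof.
apply: normalisation_reg; rewrite -Vprod_split -(Vprod0 x y) /Vprod.
congr (_ * _); apply: eq_bigr => k _; first by rewrite ffunE addNr.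
by apply: eq_bigr => l _; rewrite !ffunE !addNr.
Qed.

(** * Descendent factors *)

Hypothesis reg_s0 : reg s0.

Lemma reg_frm A B : reg (frm A B).
Proof.
have [h|] := boolP ((A != 0) || (B != 0)); first by case: (frm_unt h).
by rewrite negb_or !negbK => /andP[/eqP -> /eqP ->]; rewrite /frm !mul0r addr0 oppr0; apply: (reg_int 0).
Qed.

Lemma reg_s1 : reg s1.
Proof.
have -> : s1 = frm (-1) 0 by rewrite /frm rmorphN mul0r addr0 mulN1r opprK.
exact: reg_frm.
Qed.

(** [ch_m] of [t^w (1 - t1)(1 - t2)], with [z] the Chern class of [t^w]. *)
Definition chz (m : nat) (z : K) : K :=
  (z ^+ m - (z + s0) ^+ m - (z + s1) ^+ m + (z + s0 + s1) ^+ m) / m`!%:R.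
Definition chs (ms : seq nat) lam t : K :=
  \prod_(m <- ms) \sum_k chz m ((X x t k)%:~R * u + frm (d k) (lam k)).

Lemma chs_rl ms lam t : good [set: I] d t -> chs ms (rl lam t) t = chs ms lam 1%g.
Proof.
move=> gt; apply: eq_bigr => m _; rewrite [RHS](reindex_inj (@perm_inj _ t)); apply: eq_bigr => k _.
by rewrite !rlE !(goodd _ gt) /X !perm1.
Qed.

Lemma chs_expn ms S lam M : expn reg u (dsh d S) x lam M (chs ms lam).
Proof.
apply: (expn_prod reg_int regD regM regu a0) => m.
pose f (c : int) (s : K) t := \sum_k (c%:~R / m`!%:R) *
   ((X x t k)%:~R * u + (frm (undo d (typ (dsh d S) lam k).1) (typ (dsh d S) lam k).2 + s)) ^+ m.
have hf c s : reg s -> expn reg u (dsh d S) x lam M (f c s).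
  move=> hs; apply: (expn_pow K0 u reg_int regD regM (dsh d S) x lam a0 M (w := fun=> c%:~R / m`!%:R)
    (v := fun T => frm (undo d T.1) T.2 + s)) => T; first by apply: regM => //; apply: (regV_int (_ : nat)).
  by apply: regD => //; apply: reg_frm.
have D g1 g2 : expn reg u (dsh d S) x lam M g1 -> expn reg u (dsh d S) x lam M g2 ->
  expn reg u (dsh d S) x lam M (fun t => g1 t + g2 t) by exact: expnD.
have h := D _ _ (D _ _ (D _ _ (hf 1 _ (reg_int 0)) (hf (-1) _ reg_s0)) (hf (-1) _ reg_s1)) (hf 1 _ (regD reg_s0 reg_s1)).
apply: expn_ext h => t; rewrite /f -!big_split; apply: eq_bigr => k _ /=.
by rewrite undo_dsh /chz addr0 !addrA rmorphN /=; move: (m`!%:R^-1) => q; ring.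
Qed.
End Weights.


(** * Evaluation of rational functions *)

Lemma add1_frac (K : fieldType) (d w p : K) : d != 0 -> 1 + w * (p / d) = (d + w * p) / d.
Proof. by move=> d0; field. Qed.

Section Regular.
Variable a : nat.
Hypothesis a0 : (0 < a)%N.

Lemma spec0 : spec a 0 = 0. Proof. exact: rmorph0. Qed.
Lemma spec1 : spec a 1 = 1. Proof. exact: rmorph1. Qed.
Lemma specD P Q : spec a (P + Q) = spec a P + spec a Q. Proof. exact: rmorphD. Qed.
Lemma specM P Q : spec a (P * Q) = spec a P * spec a Q. Proof. exact: rmorphM. Qed.
Lemma spec_int (z : int) : spec a z%:~R = z%:~R. Proof. exact: rmorph_int. Qed.

(** The local ring at the prime ideal [s1 + s2 = a s3], the kernel of [spec]. *)
Definition regular (f : RF3) := exists P D : Poly3, f = P%:F / D%:F /\ spec a D != 0.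

Lemma spec_neq0 D : spec a D != 0 -> D%:F != 0 :> RF3.
Proof.
apply: contraNneq => /eqP; rewrite tofrac_eq0 => /eqP ->.
by rewrite spec0.
Qed.

Lemma regular_poly P : regular P%:F.
Proof. by exists P, 1; rewrite spec1 oner_neq0 tofrac1 divr1. Qed.

Lemma regularD f g : regular f -> regular g -> regular (f + g).
Proof.
move=> [P [D [-> hD]]] [Q [E [-> hE]]]; exists (P * E + Q * D), (D * E).
split; last by rewrite specM mulf_neq0.
have := spec_neq0 hD; have := spec_neq0 hE => e d; rewrite tofracD !tofracM.
exact: (addf_div _ _ d e).
Qed.

Lemma regularM f g : regular f -> regular g -> regular (f * g).
Proof.
move=> [P [D [-> hD]]] [Q [E [-> hE]]]; exists (P * Q), (D * E).
split; last by rewrite specM mulf_neq0.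
by rewrite !tofracM; apply: mulf_div.
Qed.

Lemma charRF n : n.+1%:R != 0 :> RF3.
Proof.
by rewrite -(rmorph_nat (@FracField.tofrac Poly3)) tofrac_eq0 -mpolyC_nat mpolyC_eq0 pnatr_eq0.
Qed.

Lemma regular_int (z : int) : regular z%:~R.
Proof. by rewrite -(rmorph_int (@FracField.tofrac Poly3)); apply: regular_poly. Qed.

Lemma regular_intV (z : int) : regular z%:~R^-1.
Proof.
have [->|z0] := eqVneq z 0; first by rewrite invr0; apply: (regular_int 0).
exists 1, z%:~R; rewrite spec_int tofrac1 rmorph_int div1r; split=> //.
rewrite (_ : z%:~R = (z%:~R : rat)%:MP :> Poly2); last by rewrite rmorph_int.
by rewrite mpolyC_eq0 intr_eq0.
Qed.

Definition linp (A B C : int) : Poly3 := A%:~R * 'X_0 + B%:~R * 'X_1 + C%:~R * 'X_2%R.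

Lemma linpE A B C : (linp A B C)%:F = A%:~R * sv 0 + B%:~R * sv 1 + C%:~R * sv 2 :> RF3.
Proof. by rewrite /linp !tofracD !tofracM !(rmorph_int (@FracField.tofrac Poly3)). Qed.

Lemma spec_linp A B C : spec a (linp A B C) =
  A%:~R * 'X_0 + B%:~R * 'X_1 + C%:~R * ((a%:R : rat)^-1 *: ('X_0 + 'X_1)).
Proof. by rewrite /linp !specD !specM !spec_int /spec !comp_mpolyXU. Qed.

(** The two numbers are the coefficients of the specialised form, multiplied by [a]; evaluation at
    the unit vectors detects them. *)
Lemma spec_linp_neq0 A B C : (A * a%:Z + C != 0) || (B * a%:Z + C != 0) -> spec a (linp A B C) != 0.
Proof.
move=> h; apply/negP => /eqP e.
have an0 : (a%:R : rat) != 0 by rewrite pnatr_eq0 -lt0n.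
have ev (p q : rat) : (spec a (linp A B C)).@[fun j => if j == 0 then p else q] =
    A%:~R * p + B%:~R * q + C%:~R / a%:R * (p + q).
  have mint (z : int) : (z%:~R : Poly2).@[fun j => if j == 0 then p else q] = z%:~R by rewrite rmorph_int.
  by rewrite spec_linp !mevalD !mevalM mevalZ !mevalD !mevalXU !mint mulrA.
have h1 := ev 1 0; rewrite e meval0 !(mulr0, mulr1, addr0, add0r) in h1.
have h2 := ev 0 1; rewrite e meval0 !(mulr0, mulr1, addr0, add0r) in h2.
have mula (z : int) : 0 = z%:~R + C%:~R / a%:R :> rat -> z * a%:Z + C = 0.
  move=> h3; apply/eqP; rewrite -(intr_eq0 rat) rmorphD rmorphM /=.
  by rewrite -[C%:~R](divfK an0) -mulrDl -h3 mul0r.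
by move: h; rewrite (mula A) // (mula B).
Qed.

Definition upol : Poly3 := linp 1 1 (- a%:Z).
Definition uval : RF3 := upol%:F.

Lemma spec_u : spec a upol = 0.
Proof.
have e : a%:R^-1 *: ('X_0 + 'X_1) = (a%:R^-1 : rat)%:MP * ('X_0 + 'X_1) :> Poly2 by rewrite mul_mpolyC.
have an0 : (a%:R : rat) != 0 by rewrite pnatr_eq0 -lt0n.
have e2 : (- a%:Z)%:~R * (a%:R^-1 : rat)%:MP = -1 :> Poly2.
  by rewrite rmorphN /= -[a%:~R]/(a%:R) -mpolyC_nat mulNr -mpolyCM divff.
by rewrite spec_linp e mulrA e2 mulN1r !mul1r subrr.
Qed.

Lemma regular_1uV f : regular f -> 1 + uval * f != 0 /\ regular (1 + uval * f)^-1.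
Proof.
rewrite /uval; move: upol spec_u => U hU [P [D [-> hD]]]; have d := spec_neq0 hD.
have hE : spec a (D + U * P) != 0 by rewrite specD specM hU mul0r addr0.
have e := spec_neq0 hE; have eE : 1 + U%:F * (P%:F / D%:F) = (D + U * P)%:F / D%:F.
  by rewrite tofracD tofracM; apply: (add1_frac _ _ d).
rewrite eE; split; first exact: (mulf_neq0 e (invr_neq0 d)).
by exists D, (D + U * P); split; [exact: invf_div|].
Qed.

Lemma linp_neq0 A B C : (A != 0) || (B != 0) || (C != 0) -> linp A B C != 0.
Proof.
move=> h; apply/negP => /eqP e.
have ev (p q r : rat) : (linp A B C).@[fun j => if j == 0 then p else if j == 1 then q else r] =
    A%:~R * p + B%:~R * q + C%:~R * r.
  have mint (z : int) : (z%:~R : Poly3).@[fun j => if j == 0 then p else if j == 1 then q else r] = z%:~R by rewrite rmorph_int.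
  by rewrite /linp !mevalD !mevalM !mevalXU !mint.
have h1 := ev 1 0 0; rewrite e meval0 !(mulr0, mulr1, addr0, add0r) in h1.
have h2 := ev 0 1 0; rewrite e meval0 !(mulr0, mulr1, addr0, add0r) in h2.
have h3 := ev 0 0 1; rewrite e meval0 !(mulr0, mulr1, addr0, add0r) in h3.
move: h; rewrite -(intr_eq0 rat) -h1 -[B == 0](intr_eq0 rat) -h2 -[C == 0](intr_eq0 rat) -h3.
by rewrite eqxx.
Qed.

Lemma uval_neq0 : uval != 0.
Proof. by rewrite tofrac_eq0; apply: linp_neq0. Qed.

Lemma regular_frm (A B : int) : (A != 0) || (B != 0) -> unt regular (frm (sv 1) (sv 2) A B).
Proof.
move=> h; have e : frm (sv 1) (sv 2) A B = (linp 0 (- A) (- B))%:F.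
  by rewrite linpE !rmorphN /= mul0r add0r /frm opprD !mulNr.
have hs : spec a (linp 0 (- A) (- B)) != 0 by apply: spec_linp_neq0; nia.
rewrite e; split; first exact: spec_neq0.
  exact: regular_poly.
by exists 1, (linp 0 (- A) (- B)); rewrite tofrac1 div1r.
Qed.

Lemma regular_sv i : regular (sv i). Proof. exact: regular_poly. Qed.

Lemma regular_svV : regular (1 / (sv 0 * sv 1)).
Proof.
exists 1, (linp 1 0 0 * linp 0 1 0); split; last first.
  by rewrite specM; apply: mulf_neq0; apply: spec_linp_neq0; lia.
by rewrite tofrac1 tofracM !linpE !mul1r !mul0r !addr0 add0r.
Qed.

Lemma regular_vanish (b : bool) r : regular r ->
  exists P D, [/\ uval ^+ b * r = P%:F / D%:F, spec a D != 0 & b -> spec a P = 0].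
Proof.
move=> [P [D [-> hD]]]; case: b; last by exists P, D; split; rewrite ?expr0 ?mul1r.
rewrite /uval; move: upol spec_u => U hU.
exists (U * P), D; split=> //; first by rewrite expr1 tofracM mulrA.
by rewrite specM hU mul0r.
Qed.
End Regular.

(** * Laurent polynomials *)

Lemma tv_neq0 i : tv i != 0.
Proof. by rewrite tofrac_eq0; apply/negP => /eqP /(congr1 (fun p : Poly3 => p@_(U_(i)%MM))); rewrite mcoeffX eqxx mcoeff0 => /eqP; rewrite oner_eq0. Qed.

Lemma mul6 (R : comRingType) (p q r p' q' r' : R) : p * p' * (q * q') * (r * r') = p * q * r * (p' * q' * r').
Proof. ring. Qed.

Definition wadd (v w : weight) : weight := (w1 v + w1 w, w2 v + w2 w, w3 v + w3 w).

Lemma tmonD v w : tmon (wadd v w) = tmon v * tmon w.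
Proof.
rewrite /tmon /w1 /w2 /w3 /= !expfzDr ?tv_neq0 //.
exact: mul6.
Qed.

Definition negL (L : laurent) : laurent := [seq (p.1, - p.2) | p <- L].

Lemma lemb_cat L L' : lemb (L ++ L') = lemb L + lemb L'.
Proof. exact: big_cat. Qed.
Lemma lemb_neg L : lemb (negL L) = - lemb L.
Proof. by rewrite /lemb big_map -sumrN; apply: eq_bigr => p _; rewrite rmorphN mulNr. Qed.

Lemma lcoef_cat L L' w : lcoef (L ++ L') w = lcoef L w + lcoef L' w.
Proof. exact: big_cat. Qed.
Lemma lcoef_neg L w : lcoef (negL L) w = - lcoef L w.
Proof. by rewrite /lcoef big_map -sumrN. Qed.

(** Multiplication by a high power of [t1 t2 t3] makes all exponents nonnegative and reduces the
    claim to linear independence of monomials of polynomials. *)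
Lemma lemb0_lcoef L w : lemb L = 0 -> lcoef L w = 0.
Proof.
move=> h0.
pose sz (v : weight) : nat := (`|w1 v| + `|w2 v| + `|w3 v|)%N.
have [N hw hL] : exists2 N, (sz w <= N)%N & forall p, p \in L -> (sz p.1 <= N)%N.
  exists (sz w + \max_(p <- L) sz p.1)%N => [|p pL]; first exact: leq_addr.
  by apply: leq_trans (leq_addl _ _); rewrite (big_rem p pL) /=; apply: leq_maxl.
pose sh (z : int) : nat := `|(z + N%:Z)%R|%N.
pose mn (v : weight) : 'X_{1..3} := [multinom nth 0%N [:: sh (w1 v); sh (w2 v); sh (w3 v)] i | i < 3].
have shE z : (`|z| <= N)%N -> (sh z)%:Z = z + N%:Z by rewrite /sh; lia.
have sh_inj z z' : sh z = sh z' -> (`|z| <= N)%N -> (`|z'| <= N)%N -> z = z' by rewrite /sh; lia.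
have mnE (v : weight) : (sz v <= N)%N -> ('X_[mn v] : Poly3)%:F = tmon v * tmon (N%:Z, N%:Z, N%:Z).
  move=> hv; rewrite -tmonD mpolyXE_id !big_ord_recl big_ord0 !mnmE /=.
  rewrite !tofracM !tofracXn tofrac1 mulr1 mulrA /tmon /wadd /w1 /w2 /w3 /=.
  rewrite -!shE; [|rewrite /sz /w1 /w2 /w3 in hv; lia..].
  by congr (_ * _ * _); congr ((_%:F) ^+ _); congr mpolyX; congr mnm1; apply: val_inj.
pose P : Poly3 := \sum_(p <- L) p.2%:~R * 'X_[mn p.1].
have P0 : P = 0.
  apply/eqP; rewrite -tofrac_eq0 /P rmorph_sum /= big_seq.
  rewrite (eq_bigr (fun p => p.2%:~R * tmon p.1 * tmon (N%:Z, N%:Z, N%:Z))).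
    by rewrite -mulr_suml -big_seq -/(lemb L) h0 mul0r.
  by move=> p pL; rewrite tofracM mnE ?hL // mulrA (rmorph_int (@FracField.tofrac Poly3)).
have := congr1 (fun p : Poly3 => p@_(mn w)) P0; rewrite mcoeff0 /P raddf_sum /=.
rewrite (eq_big_seq (fun p => (if p.1 == w then p.2 else 0)%:~R)).
  by rewrite -(rmorph_sum (intmul 1)) /= -big_mkcond => /eqP; rewrite intr_eq0 => /eqP.
move=> p pL; rewrite (_ : p.2%:~R = (p.2%:~R : rat)%:MP); last by rewrite rmorph_int.
rewrite mul_mpolyC mcoeffZ mcoeffX.
have -> : (mn p.1 == mn w) = (p.1 == w).
  apply/eqP/eqP => [e|->] //; have hp := hL p pL.
  have c (i : 'I_3) : mn p.1 i = mn w i by rewrite e.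
  have := c 0; have := c 1; have := c 2%R; rewrite !mnmE /= => /sh_inj c3 /sh_inj c2 /sh_inj c1.
  move: hp hw c1 c2 c3 {e c}; rewrite /sz; case: (p.1) => -[? ?] ?; case: (w) => -[? ?] ?; rewrite /w1 /w2 /w3 /=.
  by move=> hp hw' c1 c2 c3; congr (_, _, _); [apply: c1|apply: c2|apply: c3]; lia.
by case: (p.1 == w); rewrite ?mulr1 ?mulr0.
Qed.

Lemma lemb_lcoef L L' : lemb L = lemb L' -> lcoef L =1 lcoef L'.
Proof.
move=> e w; apply/eqP; rewrite -subr_eq0 -lcoef_neg -lcoef_cat.
by apply/eqP/lemb0_lcoef; rewrite lemb_cat lemb_neg e subrr.
Qed.

Definition supp (L : laurent) : seq weight := undup (map fst L).

Lemma lcoef_supp L w : w \notin supp L -> lcoef L w = 0.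
Proof.
rewrite /supp mem_undup => h; rewrite /lcoef big_seq_cond big1 // => p /andP[pL /eqP e].
by case/negP: h; rewrite -e map_f.
Qed.

Lemma big_by_weight (R : Type) (idx : R) (op : Monoid.com_law idx) (F : weight * int -> R) L s :
  uniq s -> {subset supp L <= s} ->
  \big[op/idx]_(p <- L) F p = \big[op/idx]_(w <- s) \big[op/idx]_(p <- L | p.1 == w) F p.
Proof.
move=> us sub; rewrite (exchange_big_dep xpredT) //= big_seq [RHS]big_seq.
apply: eq_bigr => p pL; rewrite -big_filter.
have -> : [seq w <- s | p.1 == w] = [:: p.1].
  rewrite (eq_filter (a2 := pred1 p.1)) => [|w]; last by rewrite /= eq_sym.
  by apply: filter_pred1_uniq => //; apply: sub; rewrite /supp mem_undup map_f.
by rewrite big_seq1.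
Qed.

Lemma eneg_uniq L s : uniq s -> {subset supp L <= s} -> eneg L = \prod_(w <- s) c1w w ^ (- lcoef L w).
Proof.
move=> us sub; rewrite /eneg -/(supp L) [RHS](bigID (mem (supp L))) /= [X in _ * X]big1 => [|w hw].
  rewrite mulr1 -[RHS]big_filter; apply: perm_big; apply: uniq_perm => [||w].
  - exact: undup_uniq.
  - exact: filter_uniq.
  - by rewrite mem_filter; case wL: (w \in supp L) => //=; rewrite sub.
by rewrite lcoef_supp ?oppr0 ?expr0z.
Qed.

Lemma eneg_ext L L' : lcoef L =1 lcoef L' -> eneg L = eneg L'.
Proof.
move=> e; pose s := undup (supp L ++ supp L').
have us : uniq s by apply: undup_uniq.
have s1 : {subset supp L <= s} by move=> w wL; rewrite /s mem_undup mem_cat wL.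
have s2 : {subset supp L' <= s} by move=> w wL; rewrite /s mem_undup mem_cat wL orbT.
rewrite (eneg_uniq us s1) (eneg_uniq us s2).
by apply: eq_bigr => w _; rewrite e.
Qed.

Definition eprod (L : laurent) : RF3 := \prod_(p <- L) c1w p.1 ^ (- p.2).

(** At a zero weight exponents cannot be added, as [0 * 0^-1 = 0] whereas [0 ^ 0 = 1]; hence the
    hypothesis. *)
Lemma eneg_eprod L : {in L, forall p, c1w p.1 != 0} -> eneg L = eprod L.
Proof.
move=> n0; have us : uniq (supp L) by apply: undup_uniq.
rewrite /eprod (big_by_weight _ _ us) // (eneg_uniq us) // big_seq [RHS]big_seq; apply: eq_bigr => w.
rewrite mem_undup => /mapP[p0 pL ->].
rewrite (eq_bigr (fun p => c1w p0.1 ^ (- p.2))) => [|p /eqP -> //].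
rewrite -big_filter (expz_sum (n0 _ pL)) big_filter; congr (_ ^ _).
by rewrite sumrN.
Qed.

Lemma chm_ext m L L' : lcoef L =1 lcoef L' -> chm m L = chm m L'.
Proof.
move=> e; pose s := undup (supp L ++ supp L').
have us : uniq s by apply: undup_uniq.
have E M : {subset supp M <= s} -> chm m M = \sum_(w <- s) (lcoef M w)%:~R * (c1w w ^+ m / m`!%:R).
  move=> sub; rewrite /chm (big_by_weight _ _ us sub); apply: eq_bigr => w _.
  rewrite /lcoef rmorph_sum /= mulr_suml; apply: eq_bigr => p /eqP ->.
  by rewrite mulrA.
have s1 : {subset supp L <= s} by move=> w wL; rewrite /s mem_undup mem_cat wL.
have s2 : {subset supp L' <= s} by move=> w wL; rewrite /s mem_undup mem_cat wL orbT.
by rewrite (E _ s1) (E _ s2); apply: eq_bigr => w _; rewrite e.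
Qed.

Definition lsum (J : finType) (F : J -> laurent) : laurent := flatten [seq F j | j <- index_enum J].

Lemma lemb_lsum (J : finType) (F : J -> laurent) : lemb (lsum F) = \sum_j lemb (F j).
Proof. by rewrite /lemb big_flatten big_map. Qed.
Lemma eprod_lsum (J : finType) (F : J -> laurent) : eprod (lsum F) = \prod_j eprod (F j).
Proof. by rewrite /eprod big_flatten big_map. Qed.
Lemma chm_lsum m (J : finType) (F : J -> laurent) : chm m (lsum F) = \sum_j chm m (F j).
Proof. by rewrite /chm big_flatten big_map. Qed.
Lemma eprod_cat L L' : eprod (L ++ L') = eprod L * eprod L'.
Proof. exact: big_cat. Qed.
Lemma eprod_neg L : eprod (negL L) = (eprod L)^-1.
Proof.
rewrite /eprod big_map -prodfV; apply: eq_bigr => p _.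
by rewrite /= invr_expz.
Qed.

(* The expansion of [t1^A t2^B (t3^(-n) - 1) / (1 - t3)]. *)
Definition strip (A B n : int) : laurent := match n with
  | Posz n => [seq ((A, B, - k.+1%:Z), 1%:Z) | k <- iota 0 n]
  | Negz n => [seq ((A, B, k%:Z), -1%:Z) | k <- iota 0 n.+1] end.

Local Notation frm2 := (fr2 (sv 1) (sv 0)).

Lemma c1w_neq0 w : w != (0, 0, 0) -> c1w w != 0.
Proof.
case: w => -[A B] C h; rewrite /c1w -linpE tofrac_eq0; apply: linp_neq0.
by move: h; rewrite !xpair_eqE /w1 /w2 /w3 /=; lia.
Qed.

Lemma eprod_strip A B n : {in strip A B n, forall p, c1w p.1 != 0} ->
  eprod (strip A B n) = Tp (sv 2) (frm2 A B) n.
Proof.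
case: n => n h; rewrite /eprod /strip big_map /Tp.
  rewrite -[RHS](big_mkord xpredT (fun k => (e0 (frm2 A B - k.+1%:R * sv 2))^-1)) /index_iota subn0.
  rewrite big_seq [RHS]big_seq; apply: eq_bigr => k hk.
  have cE : c1w (A, B, - k.+1%:Z) = frm2 A B - k.+1%:R * sv 2.
    by rewrite /c1w /fr2 /= rmorphN mulNr.
  have := h _ (map_f _ hk); rewrite /= cE => n0.
  by rewrite /e0 (negbTE n0).
rewrite -[RHS](big_mkord xpredT (fun k => (e0 (frm2 A B + k%:R * sv 2)))) /index_iota subn0.
rewrite big_seq [RHS]big_seq; apply: eq_bigr => k hk.
have cE : c1w (A, B, k%:Z) = frm2 A B + k%:R * sv 2 by [].
have := h _ (map_f _ hk); rewrite /= cE => n0.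
by rewrite /e0 (negbTE n0).
Qed.

Lemma geom_neg (K : fieldType) (t : K) n : t != 0 ->
  (\sum_(0 <= k < n) t ^ (- k.+1%:Z)) * (1 - t) = t ^ (- n%:Z) - 1.
Proof.
move=> t0; elim: n => [|n IH]; first by rewrite big_geq // mul0r oppr0 expr0z subrr.
rewrite big_nat_recr //= mulrDl IH.
have -> : t ^ (- n%:Z) = t ^ (- n.+1%:Z) * t.
  by rewrite -[X in _ * X]expr1z -expfzDr //; congr (_ ^ _); lia.
by ring.
Qed.

Lemma geom_pos (K : fieldType) (t : K) n :
  (\sum_(0 <= k < n) - t ^ k%:Z) * (1 - t) = t ^ n%:Z - 1.
Proof.
elim: n => [|n IH]; first by rewrite big_geq // mul0r expr0z subrr.
by rewrite big_nat_recr //= mulrDl IH -!exprnP exprS; ring.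
Qed.

Lemma lemb_strip A B n : lemb (strip A B n) * (1 - tv 2) = tmon (A, B, 0) * (tv 2 ^ (- n) - 1).
Proof.
have mE (z : int) : tmon (A, B, z) = tmon (A, B, 0) * tv 2 ^ z.
  by rewrite /tmon /w1 /w2 /w3 /= expr0z mulr1.
case: n => n; rewrite /lemb /strip big_map.
  rewrite -geom_neg ?tv_neq0 // mulrA mulr_sumr /index_iota subn0; congr (_ * _).
  by apply: eq_bigr => k _; rewrite /= mE mul1r.
rewrite (_ : - Negz n = n.+1%:Z) // -geom_pos mulrA mulr_sumr /index_iota subn0; congr (_ * _).
by apply: eq_bigr => k _; rewrite /= mE mulN1r mulrN.
Qed.

Section VertexCharacter.
Variables (I : finType) (cx cy : I -> int) (h : I -> int).

Definition Fchar (g : I -> int) : RF3 := \sum_k tmon (cx k, cy k, - g k).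
Definition Fbar (g : I -> int) : RF3 := \sum_k tmon (- cx k, - cy k, g k).

(* [V] is [(A(f) - A(F_mu)) / (1 - t3)] with [f] the sum of [t1^i t2^j t3^(-h)] and
   [A(f) = f + f^- / (t1 t2) - f f^- (1 - 1/t1) (1 - 1/t2)]. *)
Definition Vlist : laurent :=
  lsum (fun k => strip (cx k) (cy k) (h k) ++ strip (- cx k - 1) (- cy k - 1) (- h k)) ++
  lsum (fun k => lsum (fun l =>
    negL (strip (cx k - cx l) (cy k - cy l) (h k - h l)) ++
    negL (strip (cx k - cx l - 1) (cy k - cy l - 1) (h k - h l)) ++
    strip (cx k - cx l - 1) (cy k - cy l) (h k - h l) ++
    strip (cx k - cx l) (cy k - cy l - 1) (h k - h l))).

Lemma tmon3 A B C : tmon (A, B, C) = tv 0 ^ A * tv 1 ^ B * tv 2 ^ C.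
Proof. by []. Qed.

Lemma tv2_neq1 : 1 - tv 2 != 0.
Proof.
rewrite -tofrac1 -tofracB tofrac_eq0; apply/negP => /eqP /(congr1 (meval (fun=> 0%:R : rat))).
by rewrite mevalB meval1 mevalXU meval0 subr0 => /eqP; rewrite oner_eq0.
Qed.

Lemma tmon_x A B C : tmon (A - 1, B, C) = (tv 0)^-1 * tmon (A, B, C).
Proof. by rewrite !tmon3 expfzDr ?tv_neq0 // [_ * tv 0 ^ (-1)]mulrC !mulrA. Qed.
Lemma tmon_y A B C : tmon (A, B - 1, C) = (tv 1)^-1 * tmon (A, B, C).
Proof. by rewrite !tmon3 expfzDr ?tv_neq0 // [_ * tv 1 ^ (-1)]mulrC !mulrA [(tv 1)^-1 * _]mulrC. Qed.
Lemma tmon_z A B n : tmon (A, B, 0) * (tv 2 ^ n - 1) = tmon (A, B, n) - tmon (A, B, 0).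
Proof. by rewrite mulrBr mulr1 !tmon3 expr0z mulr1. Qed.

Lemma strip1 A B n : lemb (strip A B n) * (1 - tv 2) = tmon (A, B, - n) - tmon (A, B, 0).
Proof. by rewrite lemb_strip tmon_z. Qed.

Lemma comb4 (R : comRingType) (p q x y : R) :
  - (p - q) - (x * (y * p) - x * (y * q)) + x * p - x * q + y * p - y * q =
  - (p * (1 + x * y - x - y) - q * (1 + x * y - x - y)).
Proof. ring. Qed.

Lemma lemb_Vlist : lemb Vlist * (1 - tv 2) =
  (Fchar h - Fchar (fun=> 0)) + (tv 0)^-1 * (tv 1)^-1 * (Fbar h - Fbar (fun=> 0))
  - (Fchar h * Fbar h - Fchar (fun=> 0) * Fbar (fun=> 0)) * (1 + (tv 0)^-1 * (tv 1)^-1 - (tv 0)^-1 - (tv 1)^-1).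
Proof.
rewrite /Vlist lemb_cat mulrDl; congr (_ + _).
  rewrite lemb_lsum mulr_suml.
  rewrite (eq_bigr (fun k => (tmon (cx k, cy k, - h k) - tmon (cx k, cy k, - 0)) +
    (tv 0)^-1 * (tv 1)^-1 * (tmon (- cx k, - cy k, h k) - tmon (- cx k, - cy k, 0)))).
    by rewrite big_split /= -mulr_sumr !sumrB.
  move=> k _; rewrite lemb_cat mulrDl !strip1 opprK oppr0; congr (_ + _).
  by rewrite !tmon_x !tmon_y !mulrBr !mulrA.
have pairE (g : I -> int) : Fchar g * Fbar g = \sum_k \sum_l tmon (cx k - cx l, cy k - cy l, - (g k - g l)).
  rewrite /Fchar mulr_suml; apply: eq_bigr => k _; rewrite /Fbar mulr_sumr; apply: eq_bigr => l _.
  by rewrite -tmonD /wadd /w1 /w2 /w3 /=; congr (tmon (_, _, _)); ring.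
rewrite lemb_lsum [LHS]mulr_suml !pairE -sumrB [in RHS]mulr_suml -sumrN; apply: eq_bigr => k _.
rewrite lemb_lsum [LHS]mulr_suml -sumrB [in RHS]mulr_suml -sumrN; apply: eq_bigr => l _.
rewrite !lemb_cat !mulrDl !lemb_neg !mulNr !strip1 !tmon_x !tmon_y subrr oppr0 !addrA.
exact: comb4.
Qed.
End VertexCharacter.

Definition nonzero (L : laurent) := all (fun p => c1w p.1 != 0) L.

Lemma nonzero_lsum (J : finType) (F : J -> laurent) : (forall j, nonzero (F j)) -> nonzero (lsum F).
Proof. by move=> h; apply/allP => p /flatten_mapP[j _]; move: p; apply/allP; apply: h. Qed.
Lemma nonzero_neg L : nonzero (negL L) = nonzero L.
Proof. by rewrite /nonzero all_map. Qed.
(** The zero weight can occur only as the initial term of a strip of negative length based at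
    [(0, 0)]. *)
Lemma nonzero_strip A B n : (A = 0 -> B = 0 -> 0 <= n) -> nonzero (strip A B n).
Proof.
move=> hn; apply/allP => p; case: n hn => n hn /mapP[k _ ->]; apply: c1w_neq0; rewrite !xpair_eqE; first by lia.
by have := hn; lia.
Qed.

Section VertexProduct.
Variables (I : finType) (cx cy : I -> int).

Variable h : I -> int.
Hypothesis h_ge0 : forall k, 0 <= h k.
Hypothesis c_ge0 : forall k, 0 <= cx k /\ 0 <= cy k.
Hypothesis h_mono : forall k l, (cx l <= cx k <= cx l + 1) -> (cy l <= cy k <= cy l + 1) -> h l <= h k.

(** Monotone nonnegative heights rule out strips of negative length based at [(0, 0)], so no zero
    weight is listed and the guards [e0] have no effect. *)
Lemma eneg_Vlist : eneg (Vlist cx cy h) = Vprod (sv 1) (sv 2) (sv 0) cx cy h.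
Proof.
have s1 k : nonzero (strip (cx k) (cy k) (h k)) by apply: nonzero_strip => *; apply: h_ge0.
have s2 k : nonzero (strip (- cx k - 1) (- cy k - 1) (- h k)).
  by apply: nonzero_strip; have := c_ge0 k; lia.
have sp k l i j : 0 <= i <= 1 -> 0 <= j <= 1 -> nonzero (strip (cx k - cx l - i) (cy k - cy l - j) (h k - h l)).
  by move=> hi hj; apply: nonzero_strip => e1 e2; have := @h_mono k l; lia.
have sp00 k l := sp k l 0 0 isT isT; have sp11 k l := sp k l 1 1 isT isT.
have sp10 k l := sp k l 1 0 isT isT; have sp01 k l := sp k l 0 1 isT isT.
rewrite eneg_eprod; last first.
  apply/allP; rewrite -[all _ _]/(nonzero _) /Vlist /nonzero all_cat; apply/andP; split.
    by apply: nonzero_lsum => k; rewrite /nonzero all_cat; apply/andP; split; [apply: s1|apply: s2].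
  apply: nonzero_lsum => k; apply: nonzero_lsum => l; rewrite /nonzero !all_cat -!/(nonzero _) !nonzero_neg.
  have := sp00 k l; have := sp11 k l; have := sp10 k l; have := sp01 k l.
  by rewrite !subr0 => -> -> -> ->.
rewrite /Vlist eprod_cat; congr (_ * _).
  rewrite eprod_lsum; apply: eq_bigr => k _; rewrite eprod_cat !eprod_strip //.
    by apply/allP; apply: s2.
  by apply/allP; apply: s1.
rewrite eprod_lsum; apply: eq_bigr => k _; rewrite eprod_lsum; apply: eq_bigr => l _.
have := sp00 k l; have := sp11 k l; have := sp10 k l; have := sp01 k l; rewrite !subr0 => /allP t1 /allP t2 /allP t3 /allP t4.
by rewrite !eprod_cat !eprod_neg !eprod_strip.
Qed.
End VertexProduct.

(** * Submodules and heights *)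

Section Enumeration.
Variable mu : seq (nat * nat).
Hypothesis ymu : young mu.

Local Notation I := 'I_(size mu).
Definition cell (k : I) : nat * nat := tnth (in_tuple mu) k.
Definition row (k : I) : int := (cell k).1%:Z.
Definition content (k : I) : int := (cell k).1%:Z - (cell k).2%:Z.

Lemma mu_uniq : uniq mu. Proof. by case/andP: ymu. Qed.

Lemma cell_inj : injective cell.
Proof. by apply/tuple_uniqP; apply: mu_uniq. Qed.

Lemma cell_mem k : cell k \in mu. Proof. exact: mem_tnth. Qed.

Lemma cellP p : p \in mu -> exists k, cell k = p.
Proof. by move=> /(@tnthP _ _ (in_tuple mu)) [k ->]; exists k. Qed.

Lemma content_inj k l : content k = content l -> row k = row l -> k = l.
Proof.
rewrite /content /row => e1 e2; apply: cell_inj; move: e1 e2.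
by case: (cell k) (cell l) => [i j] [i' j'] /= *; congr (_, _); lia.
Qed.

Lemma row_ge0 k : 0 <= row k. Proof. by []. Qed.
Lemma content_le_row k : content k <= row k. Proof. by rewrite /content /row; lia. Qed.

Lemma row_up k : 0 < row k -> exists m, row m = row k - 1 /\ content m = content k - 1.
Proof.
move=> h; have /andP[_ /allP/(_ _ (cell_mem k))/andP[/implyP h1 _]] := ymu.
have [m em] := cellP (h1 h); exists m; rewrite /content /row em /=; rewrite /row in h; lia.
Qed.

Lemma row_left k : content k < row k -> exists m, row m = row k /\ content m = content k + 1.
Proof.
move=> h; have /andP[_ /allP/(_ _ (cell_mem k))/andP[_ /implyP h2]] := ymu.
have h3 : (0 < (cell k).2)%N by rewrite /content /row in h; lia.
have [m em] := cellP (h2 h3); exists m; rewrite /content /row em /=; lia.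
Qed.

Definition extend (g : I -> nat) (p : nat * nat) : nat := \sum_(k | cell k == p) g k.

Lemma extend_cell g k : extend g (cell k) = g k.
Proof.
rewrite /extend (eq_bigl (pred1 k)) ?big_pred1_eq // => l.
by rewrite /= (inj_eq cell_inj).
Qed.

Definition Qof m (g : I -> nat) : seq (nat * nat * int) := [seq q <- box mu m | (`|q.2| <= extend g q.1)%N].

Lemma boxP m q : reflect (exists k r, (r < m)%N /\ q = (cell k, - r.+1%:Z)) (q \in box mu m).
Proof.
apply: (iffP allpairsP) => [[[p r] [/= pmu + ->]]|[k [r [hr ->]]]].
  by rewrite mem_iota => hr; have [k ek] := cellP pmu; exists k, r; rewrite ek; case: (p).
exists (cell k, r); split=> /=; [exact: cell_mem|by rewrite mem_iota|by case: (cell k)].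
Qed.

Lemma box_uniq m : uniq (box mu m).
Proof.
apply: allpairs_uniq; [exact: mu_uniq|exact: iota_uniq|].
move=> [[i j] r] [[i' j'] r'] _ _ /= [-> -> e].
by congr (_, _); lia.
Qed.

Lemma mem_Qof m g k (z : int) : ((cell k, z) \in Qof m g) = [&& z < 0, (`|z| <= m)%N & (`|z| <= g k)%N].
Proof.
rewrite mem_filter /= extend_cell andbC andbA; congr (_ && _).
apply/boxP/andP => [[k' [r [hr [_ ->]]]]|[z0 zm]]; first by split; lia.
exists k, `|z|.-1; split; first by lia.
by congr (_, _); lia.
Qed.

Lemma Qof_cells m g q : q \in Qof m g -> exists k r, q = (cell k, - r.+1%:Z) /\ (r < g k)%N.
Proof.
move=> hq; have : q \in box mu m by move: hq; rewrite mem_filter => /andP[].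
move=> /boxP[k [r [hr e]]]; exists k, r; split=> //.
by move: hq; rewrite e mem_Qof; lia.
Qed.

Lemma big_Qof (R : Type) (idx : R) (op : Monoid.com_law idx) m g (F : nat * nat * int -> R) :
  (forall k, (g k <= m)%N) ->
  \big[op/idx]_(q <- Qof m g) F q = \big[op/idx]_k \big[op/idx]_(0 <= r < g k) F (cell k, - r.+1%:Z).
Proof.
move=> hg; rewrite big_filter big_mkcond big_allpairs_dep /= big_tnth; apply: eq_bigr => k _.
rewrite -/(cell k) (big_nat_widen _ _ _ _ _ (hg k)) [RHS]big_mkcond /index_iota subn0.
apply: eq_bigr => r _ /=; rewrite -surjective_pairing extend_cell.
by [].
Qed.

Lemma mem_subseqs (T : eqType) (s Q : seq T) : (Q \in subseqs s) = subseq Q s.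
Proof.
elim: s Q => [|p s IH] Q /=; first by rewrite inE.
rewrite mem_cat IH; case: Q => [|q Q] /=; first by rewrite sub0seq.
case: eqP => [->|ne].
  have -> : (p :: Q \in [seq p :: i | i <- subseqs s]) = (Q \in subseqs s).
    by apply: mem_map => ? ? [].
  rewrite IH; apply/orP/idP => [[h|//]|h]; last by right.
  by apply: subseq_trans h; apply: subseq_cons.
rewrite (_ : (q :: Q \in [seq p :: i | i <- subseqs s]) = false) ?orbF //.
by apply/mapP => -[Q' _ [/ne]].
Qed.

Lemma subseqs_uniq (T : eqType) (s : seq T) : uniq s -> uniq (subseqs s).
Proof.
elim: s => [|p s IH] //= /andP[ps us]; rewrite cat_uniq; apply/and3P; split; first exact: IH.
  apply/hasPn => _ /mapP[Q _ ->]; rewrite mem_subseqs; apply: contra ps => /mem_subseq/(_ p).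
  by rewrite inE eqxx; apply.
by rewrite map_inj_uniq ?IH // => ? ? [].
Qed.

Definition monotone (g : I -> nat) := forall k l,
  (row l = row k /\ content l = content k - 1) \/ (row l = row k + 1 /\ content l = content k + 1) ->
  (g k <= g l)%N.

Lemma Qof_submod m g : (forall k, (g k <= m)%N) -> monotone g -> (\sum_k g k = m)%N ->
  Qof m g \in submods mu m.
Proof.
move=> hg mg sg; rewrite mem_filter mem_subseqs filter_subseq andbT; apply/andP; split.
  rewrite -sum1_size (@big_Qof _ _ _ m g (fun=> 1%N)) // -[X in _ == X]sg; apply/eqP.
  by apply: eq_bigr => k _; rewrite sum_nat_const_nat subn0 muln1.
apply/andP; split; first exact: filter_uniq (box_uniq m).
apply/allP => q /Qof_cells[k [r [-> hr]]]; have hm := hg k.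
apply/and5P; split; rewrite /= -?surjective_pairing ?cell_mem //.
- apply/implyP => /cellP[l el]; rewrite -el mem_Qof; have hl := hg l.
  have : (g k <= g l)%N by apply: mg; right; rewrite /row /content el /=; lia.
  by lia.
- apply/implyP => /cellP[l el]; rewrite -el mem_Qof; have hl := hg l.
  have : (g k <= g l)%N by apply: mg; left; rewrite /row /content el /=; lia.
  by lia.
- by apply/implyP => h; rewrite mem_Qof; lia.
Qed.

Lemma initial_segment (P : nat -> bool) m : (forall r, P r.+1 -> P r) ->
  forall r, (r < m)%N -> P r = (r < \sum_(0 <= i < m) P i)%N.
Proof.
move=> hP; have dn r s : (r <= s)%N -> P s -> P r.
  by move=> /subnK <-; elim: (s - r)%N => [|n IH] //; rewrite addSn => /hP.
have le m' : (\sum_(0 <= i < m') P i <= m')%N.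
  elim: m' => [|n IH]; first by rewrite big_geq.
  by rewrite big_nat_recr //=; case: (P n); lia.
elim: m => [|m IH] r; first by rewrite ltn0.
rewrite ltnS big_nat_recr //= => hr.
case Pm: (P m).
  rewrite (dn _ _ hr Pm).
  have -> : (\sum_(0 <= i < m) P i)%N = m.
    rewrite (eq_big_nat _ _ (F2 := fun=> 1%N)) ?sum_nat_const_nat ?subn0 ?muln1 //.
    by move=> i /andP[_ hi]; rewrite (dn _ _ (ltnW hi) Pm).
  lia.
rewrite addn0; move: hr; rewrite leq_eqVlt => /orP[/eqP ->|]; last exact: IH.
by rewrite Pm ltnNge le.
Qed.

(** Stability under [x3] makes the exponents of [x3] over a cell an initial segment below zero,
    whose length is the height; stability under [x1] and [x2] makes the heights increase. *)
Lemma submodP m Q : Q \in submods mu m -> exists2 g : I -> nat,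
  [/\ forall k, (g k <= m)%N, monotone g & (\sum_k g k = m)%N] & Q = Qof m g.
Proof.
rewrite mem_filter mem_subseqs => /andP[/andP[/eqP sQ /andP[uQ /allP aQ]] sub].
pose P k (r : nat) := (cell k, - r.+1%:Z) \in Q.
pose g k := (\sum_(0 <= r < m) P k r)%N.
have gm k : (g k <= m)%N.
  rewrite /g -[leqRHS]subn0 -[leqRHS]muln1 -sum_nat_const_nat.
  by apply: leq_sum => i _; case: (P k i).
have Pdn k r : P k r.+1 -> P k r.
  move=> /aQ /and5P[_ _ _ _ /implyP] /=; rewrite -surjective_pairing.
  by rewrite /P (_ : - r.+2%:Z + 1 = - r.+1%:Z) => [->|] //; lia.
have Pg k r : (r < m)%N -> P k r = (r < g k)%N by apply: initial_segment; apply: Pdn.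
have EQ : Q = Qof m g.
  have /subseq_uniqP := sub => /(_ (box_uniq m)) {1}->; apply: eq_in_filter => q /boxP[k [r [hr ->]]].
  by rewrite /= extend_cell -[_ \in Q]/(P k r) Pg.
exists g => //; split=> //; last first.
  transitivity (size (Qof m g)); last by rewrite -EQ.
  rewrite -(sum1_size (Qof m g)) (@big_Qof _ _ _ m g (fun=> 1%N)) //.
  by apply: eq_bigr => k _; rewrite sum_nat_const_nat subn0 muln1.
move=> k l hkl; case gk: (g k) => [//|r]; have gkm := gm k.
have hr : (r < m)%N by rewrite gk in gkm.
rewrite -Pg //; have : P k r by rewrite Pg // gk.
move=> /aQ /and5P[_ _ /implyP h1 /implyP h2 _] /=.
have ecell (i j : nat) : row l = i%:Z -> content l = i%:Z - j%:Z -> cell l = (i, j).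
  by rewrite /row /content; case: (cell l) => i' j' /= e1 e2; congr (_, _); lia.
case: hkl => -[e1 e2].
  rewrite /P (ecell (cell k).1 (cell k).2.+1); [apply: h2| |].
  - by rewrite -(ecell (cell k).1 (cell k).2.+1) ?cell_mem // e2 /content; lia.
  - by rewrite e1.
  - by rewrite e2 /content; lia.
rewrite /P (ecell (cell k).1.+1 (cell k).2); [apply: h1| |].
- by rewrite -(ecell (cell k).1.+1 (cell k).2) ?cell_mem // ?e1 ?e2 /content /row; lia.
- by rewrite e1 /row; lia.
- by rewrite e2 /content; lia.
Qed.

Lemma Qof_inj m g g' : (forall k, (g k <= m)%N) -> (forall k, (g' k <= m)%N) -> Qof m g = Qof m g' -> g =1 g'.
Proof.
move=> hg hg' e k; have hk := hg k; have hk' := hg' k.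
have e1 z : ((cell k, z) \in Qof m g) = ((cell k, z) \in Qof m g') by rewrite e.
have := e1 (- (g k)%:Z); have := e1 (- (g' k)%:Z); rewrite !mem_Qof; lia.
Qed.

Local Notation cy := (fun k : I => row k - content k).
Local Notation Fc := (Fchar row cy).
Local Notation Fb := (Fbar row cy).

Lemma colE k : row k - content k = (cell k).2%:Z. Proof. by rewrite /row /content; ring. Qed.

Lemma lemb_Fmu : lemb (Fmu mu) = Fc (fun=> 0).
Proof.
rewrite /lemb /Fmu big_map big_tnth; apply: eq_bigr => k _.
by rewrite -/(cell k) /= mul1r colE oppr0.
Qed.

Lemma lemb_bar_Fmu : lemb (barL (Fmu mu)) = Fb (fun=> 0).
Proof.
rewrite /lemb /Fmu !big_map big_tnth; apply: eq_bigr => k _.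
by rewrite -/(cell k) /= mul1r colE oppr0.
Qed.

(** * The character of a submodule with given heights *)

Section Character.
Variables (m : nat) (g : I -> nat).
Hypothesis gm : forall k, (g k <= m)%N.
Local Notation h := (fun k => (g k)%:Z).

Lemma lemb_charQ : lemb (charQ (Qof m g)) * (1 - tv 2) = Fc h - Fc (fun=> 0).
Proof.
rewrite /lemb /charQ big_map big_Qof // mulr_suml -sumrB; apply: eq_bigr => k _.
rewrite oppr0 -strip1; congr (_ * _); rewrite /lemb big_map /index_iota subn0.
by apply: eq_bigr => r _; rewrite colE.
Qed.

Lemma tmon_inv A B C : tmon (- A, - B, C) = tmon (- A, - B, 0) * (tv 2)^-1 ^ (- C).
Proof. by rewrite !tmon3 expr0z mulr1 exprz_inv opprK. Qed.

Lemma lemb_bar_charQ : lemb (barL (charQ (Qof m g))) * (1 - (tv 2)^-1) = Fb h - Fb (fun=> 0).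
Proof.
rewrite /lemb /charQ !big_map big_Qof // mulr_suml -sumrB; apply: eq_bigr => k _.
rewrite [tmon (_, _, (g k)%:Z)]tmon_inv -[Z in _ = _ - Z]mulr1 -mulrBr.
rewrite -geom_neg ?invr_eq0 ?tv_neq0 // mulrA mulr_sumr; congr (_ * _).
by apply: eq_bigr => r _; rewrite /= mul1r /w1 /w2 /w3 /= -colE tmon_inv opprK.
Qed.

Lemma VQ_algebra (K : fieldType) (t0 t1 t f fb G Gb : K) : t0 != 0 -> t1 != 0 -> t != 0 -> 1 - t != 0 ->
  (f / (1 - t) - fb / (1 - t^-1) / (t0 * t1 * t)
   + f / (1 - t) * (fb / (1 - t^-1)) * (1 - t0) * (1 - t1) * (1 - t) / (t0 * t1 * t)
   + (- G - Gb / (t0 * t1) + G * Gb * (1 - t0) * (1 - t1) / (t0 * t1)) / (1 - t)) * (1 - t) =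
  (f - G) + t0^-1 * t1^-1 * (fb - Gb) - (f * fb - G * Gb) * (1 + t0^-1 * t1^-1 - t0^-1 - t1^-1).
Proof.
move=> n0 n1 n2 n3; have n4 : 1 - t^-1 != 0.
  have -> : 1 - t^-1 = - ((1 - t) / t) by field.
  by rewrite oppr_eq0 mulf_neq0 ?invr_eq0.
by field; rewrite n0 n1 n2 n3 -opprB oppr_eq0.
Qed.

Lemma add_div (K : fieldType) (p q r s : K) : s != 0 -> p * s = q - r -> r / s + p = q / s.
Proof. by move=> s0 e; rewrite -[p](mulfK s0) e -mulrDl addrC subrK. Qed.

Lemma FQE : FQ mu (Qof m g) = Fc h / (1 - tv 2).
Proof. by rewrite /FQ lemb_Fmu; apply: add_div; [apply: tv2_neq1|apply: lemb_charQ]. Qed.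

Lemma tvV_neq1 : 1 - (tv 2)^-1 != 0.
Proof.
have n2 := tv_neq0 2; apply: contra tv2_neq1; rewrite !subr_eq0 => /eqP e.
by rewrite -[tv 2]invrK -e invr1.
Qed.

Lemma FQbarE : FQbar mu (Qof m g) = Fb h / (1 - (tv 2)^-1).
Proof. by rewrite /FQbar lemb_bar_Fmu; apply: add_div; [apply: tvV_neq1|apply: lemb_bar_charQ]. Qed.

Lemma VQexprE : VQexpr mu (Qof m g) = lemb (Vlist row cy h).
Proof.
apply: (mulIf tv2_neq1); rewrite lemb_Vlist /VQexpr FQE FQbarE /Gmu lemb_Fmu lemb_bar_Fmu.
exact: (VQ_algebra _ _ _ _ (tv_neq0 0) (tv_neq0 1) (tv_neq0 2) tv2_neq1).
Qed.

Lemma VQE : lemb (VQ mu (Qof m g)) = lemb (Vlist row cy h).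
Proof.
rewrite -VQexprE; apply: (epsilon_spec (inhabits [::]) (fun L : laurent => lemb L = VQexpr mu (Qof m g))).
by exists (Vlist row cy h); rewrite VQexprE.
Qed.

Definition Dlist : laurent := lsum (fun k => [:: ((row k, cy k, - h k), 1%:Z); ((row k + 1, cy k, - h k), -1%:Z);
  ((row k, cy k + 1, - h k), -1%:Z); ((row k + 1, cy k + 1, - h k), 1%:Z)]).

Lemma expand4 (R : comRingType) (p q r v w : R) :
  1%:~R * (p * q * r) + ((-1)%:~R * (p * v * q * r) + ((-1)%:~R * (p * (q * w) * r) +
  (1%:~R * (p * v * (q * w) * r) + 0))) = p * q * r * ((1 - v) * (1 - w)).
Proof. ring. Qed.

Lemma lemb_Dlist : lemb Dlist = Fc h * ((1 - tv 0) * (1 - tv 1)).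
Proof.
rewrite lemb_lsum mulr_suml; apply: eq_bigr => k _.
by rewrite /lemb !big_cons big_nil !tmon3 !(expfzDr _ _ (tv_neq0 _)) !expr1z; apply: expand4.
Qed.
End Character.

(** * From submodules to labels *)

Variables (a : nat) (ii : seq nat).
Hypothesis a0 : (0 < a)%N.

Local Notation u := (uval a).
Local Notation one := (1%g : {perm I}).
Local Notation okc := (okp [set: I] content row a).
Local Notation ht lam k := (lam k + a%:Z * row k).

Lemma uvalE : u = sv 0 + sv 1 - a%:R * sv 2.
Proof. by rewrite /uval /upol linpE !mul1r rmorphN mulNr. Qed.

Definition vch : {ffun I -> int} -> {perm I} -> RF3 :=
  chs u (sv 1) (sv 2) content row (sv 0) [seq (2 + i)%N | i <- ii].
Definition vterm (lam : {ffun I -> int}) : RF3 := term u (sv 1) (sv 2) content row a vch lam one.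
Definition vconst : RF3 := Vprod (sv 1) (sv 2) (sv 0) row cy (fun k => a%:Z * row k).

Let le_up (p q r s : int) : (p + r <= q + (r + s)) = (p <= q + s).
Proof. by apply/idP/idP; lia. Qed.

Lemma okc_monotone (lam : {ffun I -> int}) : okc lam one <->
  forall k l, (row l = row k /\ content l = content k - 1) \/ (row l = row k + 1 /\ content l = content k + 1) ->
  ht lam k <= ht lam l.
Proof.
have Xk k : X row one k = row k by rewrite /X perm1.
split=> [/okP h k l|h].
  have [h1 h2] := h k l (in_setT _) (in_setT _); rewrite !Xk in h1 h2.
  case=> -[e1 e2]; rewrite e1; first by rewrite lerD2r; apply: h1.
  by rewrite mulrDr mulr1 le_up; apply: h2.
apply/okP => k l _ _; rewrite !Xk; split=> e1 e2.
  by have := h k l (or_introl (conj e2 e1)); rewrite e2 lerD2r.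
by have := h k l (or_intror (conj e2 e1)); rewrite e2 mulrDr mulr1 le_up.
Qed.

Lemma desc_algebra (K : fieldType) (f p q t : K) : 1 - t != 0 ->
  f * ((1 - p) * (1 - q)) = f / (1 - t) * (1 - p) * (1 - q) * (1 - t).
Proof. by move=> n; field. Qed.

Lemma c1w_ring (R : comRingType) (r c l e s t w : R) :
  r * s + (r - c) * t + - (l + e * r) * w = r * (s + t - e * w) + - (c * t + l * w).
Proof. ring. Qed.

Lemma add_ring (R : comRingType) (p q r s t w : R) :
  ((p + 1) * s + q * t + r * w = p * s + q * t + r * w + s) *
  (p * s + (q + 1) * t + r * w = p * s + q * t + r * w + t).
Proof. by split; ring. Qed.

Lemma c1w_x A B C : c1w (A + 1, B, C) = c1w (A, B, C) + sv 0.
Proof. by rewrite /c1w /w1 /w2 /w3 /= rmorphD; apply: (add_ring _ _ _ _ _ _).1. Qed.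
Lemma c1w_y A B C : c1w (A, B + 1, C) = c1w (A, B, C) + sv 1.
Proof. by rewrite /c1w /w1 /w2 /w3 /= rmorphD; apply: (add_ring _ _ _ _ _ _).2. Qed.

Lemma chz_ring (K : fieldType) (s t z : K) m :
  1%:~R * z ^+ m / m`!%:R + ((-1)%:~R * (z + s) ^+ m / m`!%:R +
   ((-1)%:~R * (z + t) ^+ m / m`!%:R + (1%:~R * (z + t + s) ^+ m / m`!%:R + 0))) = chz t s m z.
Proof. by rewrite /chz [z + s + t]addrAC; ring. Qed.

Lemma wQ_term m g (lam : {ffun I -> int}) : (forall k, (g k <= m)%N) -> (forall k, (g k)%:Z = ht lam k) ->
  okc lam one -> wQ mu ii (Qof m g) = vconst * vterm lam.
Proof.
move=> gm gE ok; have /okc_monotone mon := ok.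
have gmono k l : (row l = row k /\ content l = content k - 1) \/ (row l = row k + 1 /\ content l = content k + 1) ->
    (g k)%:Z <= (g l)%:Z.
  by move=> hkl; rewrite !gE; apply: mon.
have hm k l : row l <= row k <= row l + 1 -> cy l <= cy k <= cy l + 1 -> (g l)%:Z <= (g k)%:Z.
  move=> hr hc; have [e1|e1] : row k = row l \/ row k = row l + 1 by lia.
    have [e2|e2] : content k = content l \/ content k = content l - 1 by lia.
      by rewrite (content_inj e2 e1).
    by apply: gmono; left.
  have [e2|e2] : content k = content l + 1 \/ content k = content l by lia.
    by apply: gmono; right.
  (* A diagonal step is composed of two elementary steps through the left neighbour of [k]. *)
  have [j [rj cj]] : exists j, row j = row k /\ content j = content k + 1.
    by apply: row_left; have := content_le_row l; lia.
  by apply: le_trans (gmono l j _) (gmono j k _); [right|left]; split; lia.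
have -> : wQ mu ii (Qof m g) = Vprod (sv 1) (sv 2) (sv 0) row cy (fun k => (g k)%:Z) * vch lam one.
  rewrite /wQ (eneg_ext (lemb_lcoef (VQE gm))) eneg_Vlist //; last first.
    by move=> k; rewrite colE.
  congr (_ * _); rewrite /vch /chs big_map; apply: eq_bigr => i _.
  have eD : lemb (FQdesc mu (Qof m g)) = lemb (Dlist g).
    have e : lemb (Dlist g) = FQ mu (Qof m g) * (1 - tv 0) * (1 - tv 1) * (1 - tv 2).
      by rewrite lemb_Dlist FQE //; apply: desc_algebra tv2_neq1.
    rewrite e; apply: (epsilon_spec (inhabits [::]) (fun L : laurent => lemb L = FQ mu (Qof m g) * (1 - tv 0) * (1 - tv 1) * (1 - tv 2))).
    by exists (Dlist g).
  rewrite (chm_ext _ (lemb_lcoef eD)) /Dlist chm_lsum; apply: eq_bigr => k _.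
  have c1E : c1w (row k, cy k, - (g k)%:Z) = (X row one k)%:~R * u + frm (sv 1) (sv 2) (content k) (lam k).
    rewrite /X perm1 gE uvalE; move: (content k) (row k) (lam k) => c r l; rewrite /c1w /w1 /w2 /w3 /frm /= rmorphN !rmorphD rmorphN rmorphM /=.
    exact: c1w_ring.
  by rewrite -c1E /chm !big_cons big_nil /= !c1w_x !c1w_y; apply: chz_ring.
have -> : Vprod (sv 1) (sv 2) (sv 0) row cy (fun k => (g k)%:Z) = Vprod (sv 1) (sv 2) (sv 0) row cy (fun k => ht lam k).
  by congr (_ * _); apply: eq_bigr => k _; [rewrite !gE|apply: eq_bigr => l _; rewrite !gE].
rewrite (Vprod_split (uval_neq0 a) content row a0 uvalE lam) -mulrA; congr (_ * _).
rewrite (Efull_split charRF (regular_int a) (@regularM a) (@regular_1uV a a0) (uval_neq0 a) (@regular_frm a a0) a0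
  content_inj row_ge0 content_le_row row_up row_left _ ok) //.
  by apply/andP; split; [apply: perm_on1|apply/forallP => k; rewrite perm1].
move=> k _; rewrite /X perm1 => rk.
by have := gE k; rewrite rk mulr0 addr0 => <-.
Qed.

(** A bound for [a * row]: the labels of a submodule of length [m] lie between [- shift] and [m]. *)
Definition shift : nat := (a * \sum_k (cell k).1)%N.

Lemma row_shift k : a%:Z * row k <= shift%:Z.
Proof. by rewrite /row -PoszM lez_nat leq_mul2l (bigD1 k) //= leq_addr orbT. Qed.

(** The height is least at the corner, where it equals the label. A negative label there contributes
    the row 0 as a factor of [IJ]. The sum may therefore run over all increasing labellings, a set
    suited to averaging. *)
Lemma vterm_neg (lam : {ffun I -> int}) : okc lam one -> ~~ [forall k, 0 <= ht lam k] -> vterm lam = 0.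
Proof.
move=> /okc_monotone mon; rewrite negb_forall => /existsP[j]; rewrite -ltNge => hj.
have [k0 [r0 c0]] : exists k0, row k0 = 0 /\ content k0 = 0 - 0.
  by apply: (cell_below row_up row_left (k := j)); have := content_le_row j; rewrite lexx ?row_ge0 //=; lia.
have h0 k : ht lam k0 <= ht lam k.
  have [n] := ubnP `|(row k + (row k - content k))%R|%N; elim: n k => // n IH k hn.
  have [lt|ge] := ltrP 0 (row k).
    have [m [rm cm]] := row_up lt; apply: le_trans (IH m _) (mon m k _); last by right; lia.
    by have := content_le_row m; lia.
  have [lt|ge'] := ltrP (content k) (row k).
    have [m [rm cm]] := row_left lt; apply: le_trans (IH m _) (mon m k _); last by left; lia.
    by have := content_le_row m; have := row_ge0 m; lia.
  have r0k : row k = 0 by have := row_ge0 k; lia.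
  have c0k : content k = 0 by have := content_le_row k; lia.
  by rewrite (_ : k0 = k) //; apply: content_inj; rewrite ?r0 ?c0 ?r0k ?c0k ?subr0.
have neg : lam k0 < 0 by have := le_lt_trans (h0 j) hj; rewrite r0 mulr0 addr0.
rewrite /vterm /term (_ : IJ _ _ _ _ _ _ = 0) ?mulr0 ?mul0r //.
by rewrite /IJ (bigD1 k0) //= c0 neg /X perm1 r0 !mul0r.
Qed.

Section Window.
Variable m : nat.
Local Notation Bm := (m + shift).+1.
Local Notation lamv v := ([ffun k => (v k)%:Z - shift%:Z] : {ffun I -> int}).

Definition total (v : {ffun I -> 'I_Bm}) := \sum_k ht (lamv v) k == m%:Z.
Definition valid (v : {ffun I -> 'I_Bm}) := [&& total v, okc (lamv v) one & [forall k, 0 <= ht (lamv v) k]].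
Definition gv (v : {ffun I -> 'I_Bm}) k : nat := `|ht (lamv v) k|%N.

Lemma gvE v k : valid v -> (gv v k)%:Z = ht (lamv v) k.
Proof. by case/and3P=> _ _ /forallP/(_ k) h; rewrite /gv gez0_abs. Qed.

Lemma gv_sum v : valid v -> (\sum_k gv v k = m)%N.
Proof.
move=> hv; case/and3P: (hv) => /eqP hm _ _; apply/eqP; rewrite -eqz_nat -hm -[X in X == _]natz natr_sum.
by apply/eqP; apply: eq_bigr => k _; rewrite -gvE // natz.
Qed.

Lemma gv_le v k : valid v -> (gv v k <= m)%N.
Proof. by move=> hv; rewrite -(gv_sum hv) (bigD1 k) //= leq_addr. Qed.

Lemma submods_perm : perm_eq (submods mu m) [seq Qof m (gv v) | v <- enum valid].
Proof.
apply: uniq_perm => [||Q].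
- by apply: filter_uniq; apply: subseqs_uniq; apply: box_uniq.
- rewrite map_inj_in_uniq ?enum_uniq // => v w; rewrite !mem_enum => hv hw e.
  have gE := Qof_inj (fun k => gv_le k hv) (fun k => gv_le k hw) e.
  apply/ffunP => k; apply: val_inj; have := congr1 Posz (gE k); rewrite !gvE // !ffunE => /addIr/addIr[].
  by [].
apply/idP/mapP => [/submodP[g [gm gmono gs] ->]|[v]].
  have vb k : (g k + (shift - a * (cell k).1) < Bm)%N.
    by have := gm k; rewrite ltnS => h; apply: leq_add => //; apply: leq_subr.
  pose v : {ffun I -> 'I_Bm} := [ffun k => Ordinal (vb k)].
  have hE k : ht (lamv v) k = (g k)%:Z.
    rewrite !ffunE /= PoszD -subzn; last by have := row_shift k; rewrite /row -PoszM.
    by rewrite PoszM /row; ring.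
  have hv : valid v.
    apply/and3P; split.
    - rewrite /total (eq_bigr (fun k => (g k)%:Z)) => [|k _]; last exact: hE.
      by rewrite -gs -[X in _ == X]natz natr_sum; apply/eqP; apply: eq_bigr => k _; rewrite natz.
    - by apply/okc_monotone => k l hkl; rewrite !hE; apply: gmono.
    - by apply/forallP => k; rewrite hE.
  exists v; first by rewrite mem_enum.
  rewrite /Qof; apply: eq_filter => q; congr (_ <= _)%N; apply: eq_bigr => k _.
  by apply/eqP; rewrite -eqz_nat gvE // hE.
rewrite mem_enum => hv ->; apply: Qof_submod (gv_sum hv) => [k|k l hkl]; first exact: gv_le.
by rewrite -lez_nat !gvE //; case/and3P: hv => _ /okc_monotone h _; apply: h.
Qed.

Lemma submods_sum : \sum_(Q <- submods mu m) wQ mu ii Q =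
  vconst * \sum_(v | total v && okc (lamv v) one) vterm (lamv v).
Proof.
rewrite (perm_big _ submods_perm) big_map big_enum /= mulr_sumr.
rewrite [RHS](bigID (fun v : {ffun I -> 'I_Bm} => [forall k, 0 <= ht (lamv v) k])) /= [Z in _ = _ + Z]big1 ?addr0.
  apply: eq_big => v; first by rewrite unfold_in /valid andbA.
  move=> hv; rewrite (@wQ_term m (gv v) (lamv v)) //.
  - by move=> k; apply: gv_le.
  - by move=> k; apply: gvE.
  - by case/and3P: hv.
by move=> v /andP[/andP[_ ok] neg]; rewrite vterm_neg // mulr0.
Qed.
End Window.

Lemma vconst_regular : regular a vconst.
Proof.
exact: (Vprod_reg charRF (regular_int a) (regular_intV a) (@regularD a) (@regularM a)
  (regular_poly a (upol a)) (@regular_1uV a a0) (uval_neq0 a) (@regular_frm a a0) a0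
  content_inj row_ge0 content_le_row row_up row_left uvalE).
Qed.

(** * Regularity and vanishing of the coefficients *)

Section Evaluation.
Variable m : nat.
Local Notation Bm := (m + shift).+1.
Local Notation lamv v := ([ffun k => (v k)%:Z - shift%:Z] : {ffun I -> int}).

Lemma class_vterm (S : {set I}) (Q : pred {ffun I -> 'I_Bm}) :
  (forall v k l, Q v -> k \in S -> l \notin S -> lamv v l + a%:Z < lamv v k) ->
  (forall v k, Q v -> k \in S -> a%:Z < lamv v k) ->
  (forall v t, good [set: I] (dsh content S) t -> Q (rl v t) = Q v) ->
  exists2 r, regular a r & \sum_(v | Q v && okc (lamv v) one) vterm (lamv v) = u ^+ (S != set0) * r.
Proof.
apply: (window_sum charRF (regular_int a) (regular_intV a) (@regularD a) (@regularM a)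
  (regular_poly a (upol a)) (@regular_1uV a a0) (uval_neq0 a) (@regular_frm a a0) a0
  content_inj row_ge0 content_le_row row_up row_left).
- exact: (chs_expn charRF (regular_int a) (regular_intV a) (@regularD a) (@regularM a)
  (regular_poly a (upol a)) (@regular_frm a a0) content row a0 (regular_sv a 0)).
- exact: chs_rl.
Qed.

Lemma lamv_rl (v : {ffun I -> 'I_Bm}) t k : lamv (rl v t) k = lamv v (t k).
Proof. by rewrite !ffunE. Qed.

Lemma total_rl (v : {ffun I -> 'I_Bm}) t : total (rl v t) = total v.
Proof.
rewrite /total !big_split /=; congr (_ + _ == _); rewrite [RHS](reindex_inj (@perm_inj _ t)).
by apply: eq_bigr => k _; rewrite lamv_rl.
Qed.

Lemma sum_regular : exists2 r, regular a r &
  \sum_(v : {ffun I -> 'I_Bm} | total v && okc (lamv v) one) vterm (lamv v) = r.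
Proof.
have [|||r hr e] := @class_vterm set0 (@total m); try by move=> v k; rewrite ?inE // => l; rewrite inE.
  by move=> v t _; apply: total_rl.
by exists r => //; rewrite e eqxx expr0 mul1r.
Qed.

(** An empty interval of length [a] below some label gives the separation that [class_sum] demands;
    the intervals start at 0, so the labels above also exceed [a]. *)
Definition gap (v : {ffun I -> 'I_Bm}) (i : 'I_(size mu).+1) :=
  [forall k, ~~ ((i * a)%N%:Z < lamv v k <= (i.+1 * a)%N%:Z)] && [exists k, (i.+1 * a)%N%:Z < lamv v k].
Definition level v : option 'I_(size mu).+1 := [pick i | gap v i].
Definition high v : {set I} :=
  if level v is Some i then [set k | (i.+1 * a)%N%:Z < lamv v k] else set0.

Lemma level_rl v t : level (rl v t) = level v.
Proof.
apply: eq_pick => i; congr (_ && _).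
  apply/forallP/forallP => h k; last by rewrite lamv_rl.
  by have := h (t^-1%g k); rewrite lamv_rl permKV.
apply/existsP/existsP => -[k hk]; first by exists (t k); rewrite -lamv_rl.
by exists (t^-1%g k); rewrite lamv_rl permKV.
Qed.

Lemma high_rl v t k : (k \in high (rl v t)) = (t k \in high v).
Proof. by rewrite /high level_rl; case: (level v) => [i|]; rewrite !inE ?lamv_rl. Qed.

(** A large total forces a label above all [size mu + 1] disjoint intervals. By the pigeonhole
    principle the [size mu] cells leave one of the intervals empty. *)
Lemma level_some v : total v -> ((size mu) * ((size mu).+1 * a + shift) < m)%N ->
  exists2 i, level v = Some i & high v != set0.
Proof.
move=> /eqP tv hm.
have [j hj] : exists j, ((size mu).+1 * a)%N%:Z < lamv v j.
  apply/existsP; apply: contraTT hm; rewrite negb_exists => /forallP h.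
  rewrite -leqNgt -lez_nat -tv; apply: (@le_trans _ _ (\sum_(k : I) (((size mu).+1 * a)%N%:Z + shift%:Z))).
    by apply: ler_sum => k _; apply: lerD (row_shift k); have := h k; rewrite -leNgt.
  by rewrite sumr_const card_ord -PoszD -mulr_natl natz -PoszM lexx.
have [i gi] : exists i, gap v i.
  apply/existsP; apply: contraT; rewrite negb_exists => /forallP h.
  have f (i : 'I_(size mu).+1) : exists k, (i * a)%N%:Z < lamv v k <= (i.+1 * a)%N%:Z.
    have := h i; rewrite negb_and => /orP[|].
      by rewrite negb_forall => /existsP[k]; rewrite negbK; exists k.
    rewrite negb_exists => /forallP/(_ j)/negP[]; apply: le_lt_trans hj.
    by rewrite lez_nat leq_mul2r ltn_ord orbT.
  pose g i := xchoose (f i); have gP i := xchooseP (f i).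
  have ginj : injective g.
    move=> i i' e; have := gP i; have := gP i'; rewrite -/(g i) -/(g i') e; move: (lamv v _) => z.
    move=> /andP[p1 p2] /andP[q1 q2]; apply: val_inj => /=.
    have := lt_le_trans p1 q2; have := lt_le_trans q1 p2; rewrite !ltz_nat !ltn_mul2r a0 /=; lia.
  by have := leq_card g ginj; rewrite !card_ord ltnn.
have : level v by rewrite /level; case: pickP => // /(_ i); rewrite gi.
rewrite /high; case e: (level v) => [i'|] // _; exists i' => //.
move: e; rewrite /level; case: pickP => // i2 /andP[_ /existsP[k hk]] [<-].
by apply/set0Pn; exists k; rewrite inE.
Qed.

(** Grouping by [level] and [high] yields classes that are stable under the permutations preserving
    contents and [S], each with a nonempty [S] and hence a factor [u]. *)
Lemma sum_vanish : ((size mu) * ((size mu).+1 * a + shift) < m)%N -> exists2 r, regular a r &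
  \sum_(v : {ffun I -> 'I_Bm} | total v && okc (lamv v) one) vterm (lamv v) = u * r.
Proof.
move=> hm; rewrite (partition_big (fun v => (level v, high v)) xpredT) //=.
elim/big_rec: _ => [|[c S] z _ [r hr ->]]; first by exists 0; [apply: (regular_int a 0)|rewrite mulr0].
pose Q v := total v && ((level v, high v) == (c, S)).
rewrite (eq_bigl (fun v => Q v && okc (lamv v) one)) => [|v]; last by rewrite /Q andbAC.
suff [s hs ->] : exists2 s, regular a s & \sum_(v | Q v && okc (lamv v) one) vterm (lamv v) = u * s.
  by exists (s + r); [apply: regularD|rewrite mulrDr].
have hS v : Q v -> exists i : 'I_(size mu).+1, [/\ S != set0, S = [set k | (i.+1 * a)%N%:Z < lamv v k] & gap v i].
  case/andP=> tv /eqP[_ <-]; have [i ei hi] := level_some tv hm; exists i; split=> //.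
    by rewrite /high ei.
  by move: ei; rewrite /level; case: pickP => // j gj [<-].
have [|none] := boolP [exists v, Q v]; last first.
  exists 0; first exact: (regular_int a 0).
  by rewrite mulr0 big_pred0 // => v; move: none; rewrite negb_exists => /forallP/(_ v)/negbTE ->.
case/existsP=> v0 /hS[_ [S0 _ _]].
have [|||s hs e] := @class_vterm S Q; last by exists s => //; rewrite e S0 expr1.
- move=> v k l /hS[i [_ -> /andP[/forallP/(_ l) hl _]]]; rewrite !inE -leNgt => kS lS.
  move: hl; rewrite lS andbT -leNgt => hl; apply: le_lt_trans kS.
  by apply: le_trans (lerD hl (lexx _)) _; rewrite -PoszD lez_nat mulSn addnC.
- move=> v k /hS[i [_ -> _]]; rewrite inE; apply: le_lt_trans.
  by rewrite lez_nat mulSn leq_addr.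
move=> v t gt; have [tS _] := good_dsh gt.
rewrite /Q total_rl level_rl; congr (_ && _); rewrite !xpair_eqE; congr (_ && _).
apply/eqP/eqP => [e|e]; apply/setP => k.
  by rewrite -[k](permKV t) -high_rl e tS.
by rewrite high_rl e tS.
Qed.
End Evaluation.
End Enumeration.

Theorem theorem4 (mu : seq (nat * nat)) (ii : seq nat) (a : nat) :
  young mu -> mu != [::] -> (0 < a)%N ->
  exists N : nat, forall n : nat,
    exists P D : Poly3,
      Wcoef mu ii n = P%:F / D%:F /\ spec a D != 0 /\
      ((N <= n)%N -> spec a P = 0).
Proof.
move=> ymu _ a0; pose T := ((size mu) * ((size mu).+1 * a + shift mu a))%N.
(* The exponent of [q] exceeds the length by [size mu], and a length above [T] guarantees a gap. *)
exists (size mu + T.+1)%N => n.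
have [lt|ge] := ltnP n (size mu).
  exists 0, 1; rewrite /Wcoef leqNgt lt /= spec0 spec1 oner_neq0 tofrac0 mul0r.
  by [].
suff [r hr e] : exists2 r, regular a r & Wcoef mu ii n = uval a ^+ (size mu + T.+1 <= n)%N * r.
  have [P [D [e1 hD hP]]] := regular_vanish a0 (size mu + T.+1 <= n)%N hr.
  by exists P, D; rewrite e.
set c := (1 / (sv 0 * sv 1)) ^+ size ii * vconst mu a.
have hc : regular a c.
  apply: regularM; last exact: vconst_regular.
  by apply: (regX (regular_int a) (@regularM a)); apply: regular_svV.
rewrite /Wcoef ge (submods_sum ymu ii a0) mulrA -/c.
case: (leqP _ n) => [big|_].
  have [|r hr ->] := @sum_vanish mu ymu a ii a0 (n - size mu); first by rewrite -/T; lia.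
  by exists (c * r); [apply: regularM|rewrite expr1 mulrCA].
have [r hr ->] := @sum_regular mu ymu a ii a0 (n - size mu).
by exists (c * r); [apply: regularM|rewrite expr0 mul1r].
Qed.
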